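(* Let $\mathcal C$ be a dg category and write $\mathcal P=\mathbf{Pretr}(\mathcal C)$. For a sequence of composable morphisms $\mathbf X_0\xleftarrow{\mathbf f_1}\mathbf X_1\leftarrow\cdots\xleftarrow{\mathbf f_r}\mathbf X_r$ in $\mathcal P$ ($r\ge0$), write $\mathbf X_u=\mathrm{tw}_{\boldsymbol\alpha_u}\bigl(\bigoplus_{a\in A_u}q^{i_a}X_a\bigr)$, with $A_u$ a finite partially ordered set and $\boldsymbol\alpha_u$ strictly lower triangular, and for $a\in A_u$ let $\sigma_a\in\mathrm{Hom}^{i_a}_{\mathcal P}(X_a,\mathbf X_u)$ and $\pi_a\in\mathrm{Hom}_{\mathcal P}^{-i_a}(\mathbf X_u,X_a)$ be the inclusion and projection of the direct summand. There is a chain map of $(\mathcal P,\mathcal P)$-bimodules $\Xi_{\mathbf{Pretr}}\colon\mathrm{Bar}(\mathcal P)\to\mathcal P\otimes_{\mathcal C}\mathrm{Bar}(\mathcal C)\otimes_{\mathcal C}\mathcal P$ defined by $$\Xi_{\mathbf{Pretr}}\bigl([\mathrm{id}_{\mathbf X_0},\mathbf f_1,\dots,\mathbf f_r,\mathrm{id}_{\mathbf X_r}]\bigr)=\sum_{\vec n,\vec a}(-1)^{\mathrm{sgn}}\,\sigma_{a_0}\cdot\bigl[\mathrm{id}_{X_{a_0}},h_1,\dots,h_s,\mathrm{id}_{X_{a_s}}\bigr]\cdot\pi_{a_s},$$ where: (1) the sum is over pairs $(\vec n,\vec a)$ with $\vec n=(n_0,\dots,n_r)\in\mathbb Z_{\ge0}^{r+1}$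 and $\vec a=(a_0,\dots,a_s)\in A_0^{n_0+1}\times\cdots\times A_r^{n_r+1}$; (2) $s=r+n_0+\cdots+n_r$; (3) for $1\le v\le s$, $$h_v=\begin{cases}\pi_{a_{v-1}}\circ\mathbf f_u\circ\sigma_{a_v}&\text{if }v=u+n_0+\cdots+n_{u-1},\\ \pi_{a_{v-1}}\circ\boldsymbol\alpha_u\circ\sigma_{a_v}&\text{if }v-(u+n_0+\cdots+n_{u-1})\in\{1,\dots,n_u\};\end{cases}$$ (4) with $N:=n_0+\cdots+n_r$, the sign is $$\mathrm{sgn}=(r+N)\langle\iota,i_{a_0}\rangle+\binom{N+1}{2}+\sum_{0\le u\le r}(r-u)n_u+\sum_{1\le u\le u'\le r}\langle\iota,|\mathbf f_u|\rangle\,n_{u'}.$$ This map $\Xi_{\mathbf{Pretr}}$ is a homotopy equivalence in $\mathrm{Bim}_{\mathcal P,\mathcal P}$.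
   Context: **Ground conventions.** Fix a commutative ring $K$, an abelian group $\Gamma$, a symmetric bilinear form $\langle\ ,\ \rangle\colon\Gamma\times\Gamma\to\mathbb Z/2$ and $\iota\in\Gamma$ with $\langle\iota,\iota\rangle=1$. A dg module is a $\Gamma$-graded $K$-module with a differential of degree $\iota$ squaring to zero; only homogeneous elements are considered and $|m|$ denotes degree. Tensor products over $K$ have differential $d(m\otimes n)=dm\otimes n+(-1)^{\langle\iota,|m|\rangle}m\otimes dn$. The shift is $(q^jM)^i=M^{i-j}$, with differential multiplied by $(-1)^{\langle j,\iota\rangle}$; for bimodules it also multiplies the left action of $g$ by $(-1)^{\langle j,|g|\rangle}$. A dg category is a category enriched in dg modules. A morphism $f$ is closed if $d(f)=0$. A closed degree zero map is a homotopy equivalence if it is invertible modulo exact morphisms. **Envelopes.** $\mathbf S(\mathcal C)$: objects $q^iX$ ($i\in\Gamma$, $X\in\mathcal C$), $\mathrm{Hom}^l(q^iX,q^jY)=\mathrm{Hom}^{l+i-j}_{\mathcal C}(X,Y)$; the element corresponding to $f$ is written $f^j_i$, with $d(f^j_i)=(-1)^{\langle\iota,j\rangle}d(f)^j_i$ and $g^k_j\circ f^j_i=(g\circ f)^k_i$. The map $\phi_{X,i}=(\mathrm{id}_X)^i_0\colon X=q^0X\to q^iX$ is closed invertible of degree $i$. $\mathbf A(\mathcal C)$: objects formal finite direct sums $\bigoplus_{a\in A}X_a$, morphisms matrices $(f_{a,b})$, $f_{a,b}\in\mathrm{Hom}_{\mathcal C}(Y_b,X_a)$, composed by matrix multiplication,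 with componentwise differential. $\mathbf{Tw}(\mathcal C)$: objects $\mathrm{tw}_\alpha(X)$ with $\alpha\in\mathrm{End}^\iota_{\mathcal C}(X)$, $d(\alpha)+\alpha^2=0$; $\mathrm{Hom}(\mathrm{tw}_\alpha(X),\mathrm{tw}_\beta(Y))=\mathrm{Hom}_{\mathcal C}(X,Y)$ with the same composition and with differential $f\mapsto d_{\mathcal C}(f)+\beta\circ f-(-1)^{\langle\iota,|f|\rangle}f\circ\alpha$. $\mathbf{Pretr}(\mathcal C)$: the full subcategory of $\mathbf{Tw}(\mathbf A(\mathbf S(\mathcal C)))$ on the finite one-sided twisted complexes, i.e. objects $\mathrm{tw}_{\boldsymbol\alpha}(\bigoplus_{a\in A}q^{i_a}X_a)$, $A$ finite, such that $A$ admits a partial order for which $\boldsymbol\alpha$ is strictly lower triangular: $\boldsymbol\alpha_{a,b}=0$ unless $a>b$. $\mathcal C$ is a full subcategory via $X\mapsto q^0X$ (one-term sum, zero twist). **Inclusions and projections.** For $a\in A_u$, $\sigma_a$ is the composite $X_a\xrightarrow{\phi_{X_a,i_a}}q^{i_a}X_a\hookrightarrow\mathbf X_u$ and $\pi_a$ is the composite $\mathbf X_u\twoheadrightarrow q^{i_a}X_a\xrightarrow{\phi_{X_a,i_a}^{-1}}X_a$, using the matrix inclusion/projection (these are generally not closed, because of the twist). Thus $\pi_a\sigma_b=\delta_{a,b}\mathrm{id}$ and $\sum_a\sigma_a\pi_a=\mathrm{id}$. In $h_v$ the twist $\boldsymbol\alpha_u$ is regarded as a degree $\iota$ endomorphism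 of $\mathbf X_u$, so that each $h_v$ is a morphism of $\mathcal C$ from $X_{a_v}$ to $X_{a_{v-1}}$. **Bimodules.** Write $\langle X|Y\rangle=\langle X|\mathcal D|Y\rangle:=\mathrm{Hom}_{\mathcal D}(Y,X)$. A $(\mathcal D,\mathcal E)$-bimodule $M$ is a family of dg modules $\langle X|M|Y\rangle$ with associative unital action chain maps $\langle X'|\mathcal D|X\rangle\otimes\langle X|M|Y\rangle\otimes\langle Y|\mathcal E|Y'\rangle\to\langle X'|M|Y'\rangle$; they form a dg category $\mathrm{Bim}_{\mathcal D,\mathcal E}$ (a degree $l$ morphism satisfies $f(g\cdot m\cdot g')=(-1)^{\langle l,|g|\rangle}g\cdot f(m)\cdot g'$). $\otimes_{\mathcal C}$ is the underived tensor product, the quotient of $\bigoplus_Y\langle X|M|Y\rangle\otimes\langle Y|N|Z\rangle$ by $mf\otimes n\sim m\otimes fn$; $\mathcal P$ is viewed as a bimodule over itself, restricted to $\mathcal C$ on one side where needed. Elements of $\mathcal P\otimes_{\mathcal C}\mathrm{Bar}(\mathcal C)\otimes_{\mathcal C}\mathcal P$ are written $\mathbf g\cdot[f_0,\dots,f_{r+1}]\cdot\mathbf g'$. **Bar complex.** $\mathrm{Bar}(\mathcal D)\in\mathrm{Bim}_{\mathcal D,\mathcal D}$ has underlying graded modules $$\langle Y|\mathrm{Bar}(\mathcal D)|Y'\rangle=\bigoplus_{r\ge0}q^{-r\iota}\bigoplus_{X_0,\dots,X_r\in\mathrm{Obj}(\mathcal D)}\langle Y|X_0\rangle\otimes\langle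 X_0|X_1\rangle\otimes\cdots\otimes\langle X_r|Y'\rangle.$$ With $[f_0,\dots,f_{r+1}]:=f_0\otimes\cdots\otimes f_{r+1}$ and $k_i=\langle\iota,|f_i|\rangle$, the action is $g\cdot[f_0,\dots,f_{r+1}]\cdot g'=(-1)^{r\langle\iota,|g|\rangle}[g\circ f_0,f_1,\dots,f_r,f_{r+1}\circ g']$, and $d[f_0,\dots,f_{r+1}]$ is the sum of the terms $(-1)^{r+k_0+\cdots+k_{i-1}}[f_0,\dots,d(f_i),\dots,f_{r+1}]$ ($0\le i\le r+1$) and, for $r\ge1$, the terms $(-1)^i[f_0,\dots,f_i\circ f_{i+1},\dots,f_{r+1}]$ ($0\le i\le r$). The elements $[\mathrm{id}_{\mathbf X_0},\mathbf f_1,\dots,\mathbf f_r,\mathrm{id}_{\mathbf X_r}]$ generate $\mathrm{Bar}(\mathcal P)$ as a bimodule, so a bimodule map is determined by its values on them. *)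

(* Defs.v *)
From HB Require Import structures.
From mathcomp Require Import all_boot all_order all_algebra.
From mathcomp Require Import boolp classical_sets functions cardinality fsbigop.

Set Implicit Arguments.
Unset Strict Implicit.
Unset Printing Implicit Defensive.

Import GRing.Theory.
Local Open Scope ring_scope.

(* Z/2 is [bool] with exclusive or as addition. *)
Record ground := Ground {
  gring : comPzRingType;
  gdeg : zmodType;
  pairing : gdeg -> gdeg -> bool;
  pairingDl : forall i j k,
    pairing (i + j) k = pairing i k (+) pairing j k;
  pairingC : forall i j, pairing i j = pairing j i;
  io : gdeg;
  pairing_io : pairing io io = true }.

#[global] Arguments pairing {g}.
#[global] Arguments io {g}.

Section LinearMaps.
Variable K : pzRingType.
Implicit Types U V W : lmodType K.

Lemma linD U V (f : U -> V) : linear f -> forall x y, f (x + y) = f x + f y.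
Proof. by move=> H x y; have := H 1 x y; rewrite !scale1r. Qed.

Lemma lin0 U V (f : U -> V) : linear f -> f 0 = 0.
Proof. by move=> H; have := linD H 0 0; rewrite addr0 => /(congr1 (+%R^~ (- f 0))); rewrite addrK subrr. Qed.

Lemma linZ U V (f : U -> V) : linear f -> forall a x, f (a *: x) = a *: f x.
Proof. by move=> H a x; have := H a x 0; rewrite !addr0 lin0 // addr0. Qed.

Lemma linN U V (f : U -> V) : linear f -> forall x, f (- x) = - f x.
Proof. by move=> H x; rewrite -scaleN1r linZ // scaleN1r. Qed.

Lemma linB U V (f : U -> V) : linear f -> forall x y, f (x - y) = f x - f y.
Proof. by move=> H x y; rewrite linD // linN. Qed.

Lemma lin_sum U V (f : U -> V) : linear f -> forall (I : Type) (r : seq I) F,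
  f (\sum_(i <- r) F i) = \sum_(i <- r) f (F i).
Proof.
move=> H I r F; elim: r => [|i r IH]; first by rewrite !big_nil lin0.
by rewrite !big_cons linD // IH.
Qed.

Lemma lin_id U : linear (fun x : U => x).
Proof. by []. Qed.

Lemma lin_zero U V : linear (fun _ : U => 0 : V).
Proof. by move=> a x y; rewrite scaler0 addr0. Qed.

Lemma lin_app U V W (f : V -> W) (g : U -> V) :
  linear f -> linear g -> linear (fun x => f (g x)).
Proof. by move=> Hf Hg a x y; rewrite Hg Hf. Qed.

Lemma lin_add U V (f g : U -> V) :
  linear f -> linear g -> linear (fun x => f x + g x).
Proof. by move=> Hf Hg a x y; rewrite Hf Hg scalerDr addrACA. Qed.

Lemma lin_opp U V (f : U -> V) : linear f -> linear (fun x => - f x).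
Proof. by move=> Hf a x y; rewrite Hf opprD scalerN. Qed.

End LinearMaps.

Section LinearMapsCom.
Variable K : comPzRingType.

Lemma lin_scale (U V : lmodType K) (c : K) (f : U -> V) :
  linear f -> linear (fun x => c *: f x).
Proof. by move=> Hf a x y; rewrite Hf scalerDr !scalerA mulrC. Qed.

End LinearMapsCom.

(* The K-module presented by generators [G] and relations [R]: formal linear
   combinations modulo the congruence generated by [R] and the module axioms. *)
Section Presented.
Variables (K : pzRingType) (G : Type).

Inductive fterm :=
  | F0
  | FD of fterm & fterm
  | FZ of K & fterm
  | Fg of G.

HB.instance Definition _ := gen_eqMixin fterm.
HB.instance Definition _ := gen_choiceMixin fterm.

Variable R : fterm -> fterm -> Prop.

Inductive feq : fterm -> fterm -> Prop :=
  | feq_rel t t' : R t t' -> feq t t'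
  | feq_refl t : feq t t
  | feq_sym t t' : feq t t' -> feq t' t
  | feq_trans t2 t1 t3 : feq t1 t2 -> feq t2 t3 -> feq t1 t3
  | feq_congD t1 t1' t2 t2' :
      feq t1 t1' -> feq t2 t2' -> feq (FD t1 t2) (FD t1' t2')
  | feq_congZ a t t' : feq t t' -> feq (FZ a t) (FZ a t')
  | feq_addA t1 t2 t3 : feq (FD t1 (FD t2 t3)) (FD (FD t1 t2) t3)
  | feq_addC t1 t2 : feq (FD t1 t2) (FD t2 t1)
  | feq_add0 t : feq (FD F0 t) t
  | feq_addN t : feq (FD (FZ (-1) t) t) F0
  | feq_scaleA a b t : feq (FZ a (FZ b t)) (FZ (a * b) t)
  | feq_scale1 t : feq (FZ 1 t) t
  | feq_scaleDr a t1 t2 : feq (FZ a (FD t1 t2)) (FD (FZ a t1) (FZ a t2))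
  | feq_scaleDl t a b : feq (FZ (a + b) t) (FD (FZ a t) (FZ b t)).

Definition feqb t t' := `[< feq t t' >].

Lemma feqb_refl : reflexive feqb.
Proof. by move=> t; apply/asboolP; apply: feq_refl. Qed.

Lemma feqb_sym : symmetric feqb.
Proof. by move=> t t'; apply/asboolP/asboolP; apply: feq_sym. Qed.

Lemma feqb_trans : transitive feqb.
Proof.
by move=> t2 t1 t3 /asboolP H1 /asboolP H2; apply/asboolP; apply: feq_trans H2.
Qed.

Canonical feq_equiv := EquivRel feqb feqb_refl feqb_sym feqb_trans.

Definition pres := {eq_quot feq_equiv}%qT.
HB.instance Definition _ := Choice.on pres.
HB.instance Definition _ := EqQuotient.on pres.

Local Open Scope quotient_scope.

Definition pcl (t : fterm) : pres := \pi_pres t.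
Definition pgen (g : G) : pres := pcl (Fg g).

Lemma pcl_eq t t' : feq t t' -> pcl t = pcl t'.
Proof. by move=> H; apply/eqmodP/asboolP. Qed.

Lemma pcl_feq t t' : pcl t = pcl t' -> feq t t'.
Proof. by move=> /eqmodP /asboolP. Qed.

Lemma pcl_repr (x : pres) : pcl (repr x) = x.
Proof. exact: reprK. Qed.

Definition padd (x y : pres) := pcl (FD (repr x) (repr y)).
Definition pscale a (x : pres) := pcl (FZ a (repr x)).

Lemma pcl_add t t' : padd (pcl t) (pcl t') = pcl (FD t t').
Proof. by apply/pcl_eq/feq_congD; apply/pcl_feq; rewrite pcl_repr. Qed.

Lemma pcl_scale a t : pscale a (pcl t) = pcl (FZ a t).
Proof. by apply/pcl_eq/feq_congZ/pcl_feq; rewrite pcl_repr. Qed.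

Lemma pclP (P : pres -> Prop) : (forall t, P (pcl t)) -> forall x, P x.
Proof. by move=> H x; rewrite -(pcl_repr x). Qed.

Lemma paddA : associative padd.
Proof.
move=> x y z; elim/pclP: x => x; elim/pclP: y => y; elim/pclP: z => z.
by rewrite !pcl_add; apply: pcl_eq; apply: feq_addA.
Qed.

Lemma paddC : commutative padd.
Proof.
move=> x y; elim/pclP: x => x; elim/pclP: y => y.
by rewrite !pcl_add; apply: pcl_eq; apply: feq_addC.
Qed.

Lemma padd0 : left_id (pcl F0) padd.
Proof. by move=> x; elim/pclP: x => x; rewrite pcl_add; apply/pcl_eq/feq_add0. Qed.

Lemma paddN : left_inverse (pcl F0) (pscale (-1)) padd.
Proof.
by move=> x; elim/pclP: x => x; rewrite pcl_scale pcl_add; apply/pcl_eq/feq_addN.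
Qed.

HB.instance Definition _ := GRing.isZmodule.Build pres paddA paddC padd0 paddN.

Lemma pscaleA a b x : pscale a (pscale b x) = pscale (a * b) x.
Proof. by elim/pclP: x => x; rewrite !pcl_scale; apply/pcl_eq/feq_scaleA. Qed.

Lemma pscale1 : left_id 1 pscale.
Proof. by move=> x; elim/pclP: x => x; rewrite !pcl_scale; apply/pcl_eq/feq_scale1. Qed.

Lemma pscaleDr : right_distributive pscale +%R.
Proof.
move=> a x y; elim/pclP: x => x; elim/pclP: y => y.
change (pscale a (padd (pcl x) (pcl y)) = padd (pscale a (pcl x)) (pscale a (pcl y))).
by rewrite pcl_add !pcl_scale pcl_add; apply/pcl_eq/feq_scaleDr.
Qed.

Lemma pscaleDl x : {morph pscale^~ x : a b / a + b}.
Proof.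
move=> a b; elim/pclP: x => x.
change (pscale (a + b) (pcl x) = padd (pscale a (pcl x)) (pscale b (pcl x))).
by rewrite !pcl_scale pcl_add; apply/pcl_eq/feq_scaleDl.
Qed.

HB.instance Definition _ :=
  GRing.Zmodule_isLmodule.Build K pres pscaleA pscale1 pscaleDr pscaleDl.

Lemma pclD t t' : pcl (FD t t') = pcl t + pcl t'.
Proof. by rewrite -pcl_add. Qed.

Lemma pclZ a t : pcl (FZ a t) = a *: pcl t.
Proof. by rewrite -pcl_scale. Qed.

Lemma pcl0 : pcl F0 = 0.
Proof. by []. Qed.

Section Lift.
Variables (V : lmodType K) (phi : G -> V).

Fixpoint feval (t : fterm) : V :=
  match t with
  | F0 => 0
  | FD t1 t2 => feval t1 + feval t2
  | FZ a t => a *: feval t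
  | Fg g => phi g
  end.

(* The induced map; meaningful when [phi] respects the relations. *)
Definition plift (x : pres) : V := feval (repr x).

Hypothesis respects : forall t t', R t t' -> feval t = feval t'.

Lemma feval_feq t t' : feq t t' -> feval t = feval t'.
Proof.
elim=> //=.
- by move=> t1 t2 t3 _ -> _ ->.
- by move=> t1 t1' t2 t2' _ -> _ ->.
- by move=> a t1 t2 _ ->.
- by move=> *; rewrite addrA.
- by move=> *; rewrite addrC.
- by move=> *; rewrite add0r.
- by move=> *; rewrite scaleN1r addNr.
- by move=> *; rewrite scalerA.
- by move=> *; rewrite scale1r.
- by move=> *; rewrite scalerDr.
- by move=> *; rewrite scalerDl.
Qed.

Lemma plift_pcl t : plift (pcl t) = feval t.
Proof. by apply/feval_feq/pcl_feq; rewrite pcl_repr. Qed.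

Lemma plift_gen g : plift (pgen g) = phi g.
Proof. exact: plift_pcl. Qed.

Lemma plift_lin : linear plift.
Proof.
move=> a x y; elim/pclP: x => x; elim/pclP: y => y.
by rewrite -pclZ -pclD !plift_pcl.
Qed.

End Lift.

Lemma pres_ind (P : pres -> Prop) :
  P 0 -> (forall a x y, P x -> P y -> P (a *: x + y)) ->
  (forall g, P (pgen g)) -> forall x, P x.
Proof.
move=> H0 HL Hg x; elim/pclP: x; elim=> [|t Ht t' Ht'|a t Ht|g].
- exact: H0.
- by rewrite pclD -[pcl t]scale1r; apply: HL.
- by rewrite pclZ -[_ *: _]addr0; apply: HL.
- exact: Hg.
Qed.

Lemma pres_ext (V : lmodType K) (f g : pres -> V) :
  linear f -> linear g -> (forall x, f (pgen x) = g (pgen x)) ->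
  forall x, f x = g x.
Proof.
move=> Hf Hg H; elim/pres_ind => [|a x y Hx Hy|//].
  by rewrite !lin0.
by rewrite Hf Hg Hx Hy.
Qed.

End Presented.

Section DProd.
Variables (K : pzRingType) (I : Type) (M : I -> lmodType K).

Definition dprod := forall i, M i.

HB.instance Definition _ := gen_eqMixin dprod.
HB.instance Definition _ := gen_choiceMixin dprod.

Definition dp_add (f g : dprod) : dprod := fun i => f i + g i.
Definition dp_zero : dprod := fun i => 0.
Definition dp_opp (f : dprod) : dprod := fun i => - f i.
Definition dp_scale a (f : dprod) : dprod := fun i => a *: f i.

Lemma dp_addA : associative dp_add.
Proof. by move=> f g h; apply: functional_extensionality_dep => i; apply: addrA. Qed.
Lemma dp_addC : commutative dp_add.
Proof. by move=> f g; apply: functional_extensionality_dep => i; apply: addrC. Qed.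
Lemma dp_add0 : left_id dp_zero dp_add.
Proof. by move=> f; apply: functional_extensionality_dep => i; apply: add0r. Qed.
Lemma dp_addN : left_inverse dp_zero dp_opp dp_add.
Proof. by move=> f; apply: functional_extensionality_dep => i; apply: addNr. Qed.

HB.instance Definition _ :=
  GRing.isZmodule.Build dprod dp_addA dp_addC dp_add0 dp_addN.

Lemma dp_scaleA a b f : dp_scale a (dp_scale b f) = dp_scale (a * b) f.
Proof. by apply: functional_extensionality_dep => i; apply: scalerA. Qed.
Lemma dp_scale1 : left_id 1 dp_scale.
Proof. by move=> f; apply: functional_extensionality_dep => i; apply: scale1r. Qed.
Lemma dp_scaleDr : right_distributive dp_scale +%R.
Proof. by move=> a f g; apply: functional_extensionality_dep => i; apply: scalerDr. Qed.
Lemma dp_scaleDl f : {morph dp_scale^~ f : a b / a + b}.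
Proof. by move=> a b; apply: functional_extensionality_dep => i; apply: scalerDl. Qed.

HB.instance Definition _ :=
  GRing.Zmodule_isLmodule.Build K dprod dp_scaleA dp_scale1 dp_scaleDr dp_scaleDl.

Lemma dpD (f g : dprod) i : (f + g) i = f i + g i. Proof. by []. Qed.
Lemma dpN (f : dprod) i : (- f) i = - f i. Proof. by []. Qed.
Lemma dpZ a (f : dprod) i : (a *: f) i = a *: f i. Proof. by []. Qed.
Lemma dp0 i : (0 : dprod) i = 0. Proof. by []. Qed.

End DProd.

Section Dg.
#[local] Obligation Tactic := idtac.
Variable G : ground.
Local Notation K := (gring G).
Local Notation Gam := (gdeg G).

(* Degrees are tracked by equations: an operation taking degrees [i], [j] to
   [i + j] produces an element of degree [k] for any [k] provably equal to
   [i + j].  Since [Gam] has decidable equality, the choice of the proof is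
   irrelevant. *)
Record dgMod := DgMod {
  gr :> Gam -> lmodType K;
  dd : forall i j, i + io = j -> gr i -> gr j;
  dd_lin : forall i j (e : i + io = j), linear (dd e);
  dd_dd : forall i j k (e : i + io = j) (e' : j + io = k) m,
    dd e' (dd e m) = 0 }.

Definition gcast (M : dgMod) i j (e : i = j) (m : M i) : M j :=
  eq_rect i (fun l => M l : Type) m j e.

(* [hom X Y] is the dg module of morphisms from X to Y. *)
Record dgCat := DgCat {
  obj :> Type;
  hom : obj -> obj -> dgMod;
  idm : forall X, hom X X 0;
  comp : forall X Y Z i j k, i + j = k -> hom Y Z i -> hom X Y j -> hom X Z k;
  comp_linl : forall X Y Z i j k (e : i + j = k) (f : hom X Y j),
    linear (fun g : hom Y Z i => comp e g f);
  comp_linr : forall X Y Z i j k (e : i + j = k) (g : hom Y Z i),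
    linear (fun f : hom X Y j => comp e g f);
  compA : forall W X Y Z i j k ij jk l (e1 : i + j = ij) (e2 : ij + k = l)
      (e3 : j + k = jk) (e4 : i + jk = l)
      (h : hom Y Z i) (g : hom X Y j) (f : hom W X k),
    comp e2 (comp e1 h g) f = comp e4 h (comp e3 g f);
  comp1l : forall X Y i (e : 0 + i = i) (f : hom X Y i), comp e (idm Y) f = f;
  comp1r : forall X Y i (e : i + 0 = i) (f : hom X Y i), comp e f (idm X) = f;
  dd_idm : forall X i (e : 0 + io = i), dd e (idm X) = 0;
  dd_comp : forall X Y Z i j k i' j' l (e : i + j = k) (e' : k + io = l)
      (ei : i + io = i') (e1 : i' + j = l) (ej : j + io = j') (e2 : i + j' = l)
      (g : hom Y Z i) (f : hom X Y j),
    dd e' (comp e g f) =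
    comp e1 (dd ei g) f + (-1) ^+ (pairing io i) *: comp e2 g (dd ej f) }.

#[global] Arguments comp {d X Y Z i j k}.

Record dgFun (C D : dgCat) := DgFun {
  fobj :> C -> D;
  fhom : forall X Y i, hom X Y i -> hom (fobj X) (fobj Y) i;
  fhom_lin : forall X Y i, linear (@fhom X Y i);
  fhom_id : forall X, fhom (idm X) = idm (fobj X);
  fhom_comp : forall X Y Z i j k (e : i + j = k)
      (g : hom Y Z i) (f : hom X Y j),
    fhom (comp e g f) = comp e (fhom g) (fhom f);
  fhom_dd : forall X Y i j (e : i + io = j) (f : hom X Y i),
    fhom (dd e f) = dd e (fhom f) }.

(* [bm X Y] is <X|M|Y>; recall that <X'|D|X> is [hom X X']. *)
Record bimod (D E : dgCat) := Bimod {
  bm :> D -> E -> dgMod;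
  lact : forall X' X Y i j k, i + j = k ->
    hom X X' i -> bm X Y j -> bm X' Y k;
  ract : forall X Y Y' i j k, i + j = k ->
    bm X Y i -> hom Y' Y j -> bm X Y' k;
  lact_linl : forall X' X Y i j k (e : i + j = k) (m : bm X Y j),
    linear (fun g : hom X X' i => lact e g m);
  lact_linr : forall X' X Y i j k (e : i + j = k) (g : hom X X' i),
    linear (fun m : bm X Y j => lact e g m);
  ract_linl : forall X Y Y' i j k (e : i + j = k) (g : hom Y' Y j),
    linear (fun m : bm X Y i => ract e m g);
  ract_linr : forall X Y Y' i j k (e : i + j = k) (m : bm X Y i),
    linear (fun g : hom Y' Y j => ract e m g);
  lactA : forall X'' X' X Y i j k ij jk l (e1 : i + j = ij) (e2 : ij + k = l)
      (e3 : j + k = jk) (e4 : i + jk = l)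
      (h : hom X' X'' i) (g : hom X X' j) (m : bm X Y k),
    lact e2 (comp e1 h g) m = lact e4 h (lact e3 g m);
  ractA : forall X Y Y' Y'' i j k ij jk l (e1 : i + j = ij) (e2 : ij + k = l)
      (e3 : j + k = jk) (e4 : i + jk = l)
      (m : bm X Y i) (g : hom Y' Y j) (h : hom Y'' Y' k),
    ract e2 (ract e1 m g) h = ract e4 m (comp e3 g h);
  lractA : forall X' X Y Y' i j k ij jk l (e1 : i + j = ij) (e2 : ij + k = l)
      (e3 : j + k = jk) (e4 : i + jk = l)
      (g : hom X X' i) (m : bm X Y j) (h : hom Y' Y k),
    ract e2 (lact e1 g m) h = lact e4 g (ract e3 m h);
  lact1 : forall X Y i (e : 0 + i = i) (m : bm X Y i), lact e (idm X) m = m;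
  ract1 : forall X Y i (e : i + 0 = i) (m : bm X Y i), ract e m (idm Y) = m;
  dd_lact : forall X' X Y i j k i' j' l (e : i + j = k) (e' : k + io = l)
      (ei : i + io = i') (e1 : i' + j = l) (ej : j + io = j') (e2 : i + j' = l)
      (g : hom X X' i) (m : bm X Y j),
    dd e' (lact e g m) =
    lact e1 (dd ei g) m + (-1) ^+ (pairing io i) *: lact e2 g (dd ej m);
  dd_ract : forall X Y Y' i j k i' j' l (e : i + j = k) (e' : k + io = l)
      (ei : i + io = i') (e1 : i' + j = l) (ej : j + io = j') (e2 : i + j' = l)
      (m : bm X Y i) (g : hom Y' Y j),
    dd e' (ract e m g) =
    ract e1 (dd ei m) g + (-1) ^+ (pairing io i) *: ract e2 m (dd ej g) }.

#[global] Arguments lact {D E b X' X Y i j k}.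
#[global] Arguments ract {D E b X Y Y' i j k}.

Section BimHom.
Variables D E : dgCat.

(* Bimodule morphisms of degree [l]. *)
Record bimHom (M N : bimod D E) (l : Gam) := BimHom {
  bh : forall X Y i j, l + i = j -> M X Y i -> N X Y j;
  bh_lin : forall X Y i j (e : l + i = j), linear (@bh X Y i j e);
  bh_lact : forall X' X Y i j k j' k' (e : i + j = k) (e1 : l + k = k')
      (e2 : l + j = j') (e3 : i + j' = k') (g : hom X X' i) (m : M X Y j),
    bh e1 (lact e g m) = (-1) ^+ (pairing l i) *: lact e3 g (bh e2 m);
  bh_ract : forall X Y Y' i j k i' k' (e : i + j = k) (e1 : l + k = k')
      (e2 : l + i = i') (e3 : i' + j = k') (m : M X Y i) (g : hom Y' Y j),
    bh e1 (ract e m g) = ract e3 (bh e2 m) g }.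

#[global] Arguments bh {M N l} b {X Y i j} e m.

(* The differential of [Bim], evaluated at [m]. *)
Definition bim_diff (M N : bimod D E) l (F : bimHom M N l) X Y i i' j k
    (e1 : l + i = j) (e2 : j + io = k) (e3 : i + io = i') (e4 : l + i' = k)
    (m : M X Y i) : N X Y k :=
  dd e2 (bh F e1 m) - (-1) ^+ (pairing io l) *: bh F e4 (dd e3 m).

Definition bim_closed (M N : bimod D E) l (F : bimHom M N l) :=
  forall X Y i i' j k (e1 : l + i = j) (e2 : j + io = k) (e3 : i + io = i')
    (e4 : l + i' = k) (m : M X Y i), bim_diff F e1 e2 e3 e4 m = 0.

(* [F' \o F] and the identity differ by an exact morphism. *)
Definition bim_inverse_mod_exact (M N : bimod D E)
    (F : bimHom M N 0) (F' : bimHom N M 0) :=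
  exists H : bimHom M M (- io),
    forall X Y i i' j (e : 0 + i = i) (e1 : - io + i = j) (e2 : j + io = i)
      (e3 : i + io = i') (e4 : - io + i' = i) (m : M X Y i),
    bh F' e (bh F e m) - m = bim_diff H e1 e2 e3 e4 m.

Definition bim_homotopy_equivalence (M N : bimod D E) (F : bimHom M N 0) :=
  bim_closed F /\
  exists F' : bimHom N M 0,
    [/\ bim_closed F', bim_inverse_mod_exact F F' & bim_inverse_mod_exact F' F].

End BimHom.

Lemma sgrD (V : lmodType K) (a b : bool) (x : V) :
  (-1) ^+ a *: ((-1) ^+ b *: x) = (-1) ^+ (a (+) b) *: x.
Proof. by rewrite scalerA -signr_addb. Qed.

Lemma pairing0l i : @pairing G 0 i = false.
Proof. by have := pairingDl (g := G) 0 0 i; rewrite add0r; case: pairing. Qed.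

Lemma pairing0r i : @pairing G i 0 = false.
Proof. by rewrite pairingC pairing0l. Qed.

Lemma pairingDr i j k : @pairing G i (j + k) = pairing i j (+) pairing i k.
Proof. by rewrite pairingC pairingDl pairingC (pairingC k). Qed.

Lemma pairingNl i j : @pairing G (- i) j = pairing i j.
Proof.
have := pairingDl (g := G) i (- i) j; rewrite subrr pairing0l.
by case: (pairing i j); case: (pairing _ j).
Qed.

Lemma pairingNr i j : @pairing G i (- j) = pairing i j.
Proof. by rewrite pairingC pairingNl pairingC. Qed.

Definition pairingE :=
  (pairingDl, pairingDr, pairingNl, pairingNr, pairing0l, pairing0r, pairing_io).

(* Regular bimodule, restricted along functors on both sides. *)
Section Regular.
Variables (D E P : dgCat) (F : dgFun D P) (H : dgFun E P).

Definition reg_lact X' X Y i j k (e : i + j = k)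
    (g : hom X X' i) (m : hom (H Y) (F X) j) : hom (H Y) (F X') k :=
  comp e (fhom F g) m.
Definition reg_ract X Y Y' i j k (e : i + j = k)
    (m : hom (H Y) (F X) i) (g : hom Y' Y j) : hom (H Y') (F X) k :=
  comp e m (fhom H g).

Program Definition reg : bimod D E :=
  (@Bimod D E (fun X Y => hom (H Y) (F X)) reg_lact reg_ract
  _ _ _ _ _ _ _ _ _ _ _).
Next Obligation.
rewrite /reg_lact /reg_ract.
by move=> *; apply: (lin_app (comp_linl _ _)); apply: fhom_lin.
Qed.
Next Obligation.
rewrite /reg_lact /reg_ract.
by move=> *; apply: comp_linr.
Qed.
Next Obligation.
rewrite /reg_lact /reg_ract.
by move=> *; apply: comp_linl.
Qed.
Next Obligation.
rewrite /reg_lact /reg_ract.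
by move=> *; apply: (lin_app (comp_linr _ _)); apply: fhom_lin.
Qed.
Next Obligation.
rewrite /reg_lact /reg_ract.
by move=> *; rewrite fhom_comp; apply: compA.
Qed.
Next Obligation.
rewrite /reg_lact /reg_ract.
by move=> *; rewrite fhom_comp; apply: compA.
Qed.
Next Obligation.
rewrite /reg_lact /reg_ract.
by move=> *; apply: compA.
Qed.
Next Obligation.
rewrite /reg_lact /reg_ract.
by move=> *; rewrite fhom_id comp1l.
Qed.
Next Obligation.
rewrite /reg_lact /reg_ract.
by move=> *; rewrite fhom_id comp1r.
Qed.
Next Obligation.
rewrite /reg_lact /reg_ract.
by move=> *; rewrite fhom_dd; apply: dd_comp.
Qed.
Next Obligation.
rewrite /reg_lact /reg_ract.
by move=> *; rewrite fhom_dd; apply: dd_comp.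
Qed.

End Regular.

Program Definition fun_id (C : dgCat) : dgFun C C :=
  @DgFun C C id (fun X Y i f => f) _ _ _ _.
Solve All Obligations with by [].

(* [M (x) N]: generators are the homogeneous elementary tensors m (x) n over
   all intermediate objects [ty]; relations are bilinearity and, if [bal],
   also mf (x) n = m (x) fn.  Thus [tens true] is the tensor product over C,
   and [tens false M N] is the direct sum over Y of <X|M|Y> (x)_K <Y|N|Z>. *)
Section Tensor.
Variables (bal : bool) (D C E : dgCat) (M : bimod D C) (N : bimod C E).

Record tgen (X : D) (Z : E) (l : Gam) := TGen {
  ty : C;
  ti : Gam;
  tj : Gam;
  te : ti + tj = l;
  tm : M X ty ti;
  tn : N ty Z tj }.

Inductive trel (X : D) (Z : E) (l : Gam) :
    fterm K (tgen X Z l) -> fterm K (tgen X Z l) -> Prop :=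
  | trel_l Y i j (e : i + j = l) a (m m' : M X Y i) (n : N Y Z j) :
      trel (Fg K (TGen e (a *: m + m') n))
           (FD (FZ a (Fg K (TGen e m n))) (Fg K (TGen e m' n)))
  | trel_r Y i j (e : i + j = l) a (m : M X Y i) (n n' : N Y Z j) :
      trel (Fg K (TGen e m (a *: n + n')))
           (FD (FZ a (Fg K (TGen e m n))) (Fg K (TGen e m n')))
  | trel_bal Y Y' i j k ij jk (e1 : i + j = ij) (e2 : ij + k = l)
      (e3 : j + k = jk) (e4 : i + jk = l)
      (m : M X Y i) (f : hom Y' Y j) (n : N Y' Z k) : bal ->
      trel (Fg K (TGen e2 (ract e1 m f) n)) (Fg K (TGen e4 m (lact e3 f n))).

Definition tmod X Z l : lmodType K := pres (@trel X Z l).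

Definition telt X Y Z i j l (e : i + j = l) (m : M X Y i) (n : N Y Z j) :
  tmod X Z l := pgen (@trel X Z l) (TGen e m n).

Lemma telt_linl X Y Z i j l (e : i + j = l) (n : N Y Z j) :
  linear (fun m : M X Y i => telt e m n).
Proof.
move=> a m m'; rewrite /telt /pgen -pclZ -pclD.
by apply/pcl_eq/feq_rel; constructor.
Qed.

Lemma telt_linr X Y Z i j l (e : i + j = l) (m : M X Y i) :
  linear (fun n : N Y Z j => telt e m n).
Proof.
move=> a n n'; rewrite /telt /pgen -pclZ -pclD.
by apply/pcl_eq/feq_rel; constructor.
Qed.

Lemma telt_bal X Y Y' Z i j k ij jk l (e1 : i + j = ij) (e2 : ij + k = l)
    (e3 : j + k = jk) (e4 : i + jk = l)
    (m : M X Y i) (f : hom Y' Y j) (n : N Y' Z k) : bal ->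
  telt e2 (ract e1 m f) n = telt e4 m (lact e3 f n).
Proof. by move=> hb; apply/pcl_eq/feq_rel; apply: trel_bal. Qed.

Definition tlift X Z l (V : lmodType K)
    (phi : forall Y i j, i + j = l -> M X Y i -> N Y Z j -> V) :
  tmod X Z l -> V :=
  plift (fun g : tgen X Z l => phi (ty g) (ti g) (tj g) (te g) (tm g) (tn g)).

Section TLift.
Variables (X : D) (Z : E) (l : Gam) (V : lmodType K).
Variable phi : forall Y i j, i + j = l -> M X Y i -> N Y Z j -> V.
Hypothesis phi_l : forall Y i j (e : i + j = l) (n : N Y Z j),
  linear (fun m => phi e m n).
Hypothesis phi_r : forall Y i j (e : i + j = l) (m : M X Y i),
  linear (fun n => phi e m n).
Hypothesis phi_bal : forall Y Y' i j k ij jk (e1 : i + j = ij) (e2 : ij + k = l)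
    (e3 : j + k = jk) (e4 : i + jk = l)
    (m : M X Y i) (f : hom Y' Y j) (n : N Y' Z k), bal ->
  phi e2 (ract e1 m f) n = phi e4 m (lact e3 f n).

Lemma tlift_respects (t t' : fterm K (tgen X Z l)) : trel t t' ->
  feval (fun g : tgen X Z l => phi (te g) (tm g) (tn g)) t =
  feval (fun g : tgen X Z l => phi (te g) (tm g) (tn g)) t'.
Proof.
case=> /=.
- by move=> Y i j e a m m' n; rewrite phi_l.
- by move=> Y i j e a m n n'; rewrite phi_r.
- by move=> *; apply: phi_bal.
Qed.

Lemma tliftE Y i j (e : i + j = l) (m : M X Y i) (n : N Y Z j) :
  tlift phi (telt e m n) = phi e m n.
Proof. exact: (plift_gen tlift_respects). Qed.

Lemma tlift_lin : linear (tlift phi).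
Proof. exact: (plift_lin tlift_respects). Qed.

End TLift.

Lemma tens_ext X Z l (V : lmodType K) (f g : tmod X Z l -> V) :
  linear f -> linear g ->
  (forall Y i j (e : i + j = l) (m : M X Y i) (n : N Y Z j),
     f (telt e m n) = g (telt e m n)) ->
  forall x, f x = g x.
Proof. by move=> Hf Hg H; apply: pres_ext => // -[Y i j e m n]; apply: H. Qed.

Lemma deg_dl i j l l' : i + j = l -> l + io = l' -> (i + io) + j = l' :> Gam.
Proof. by move=> <- <-; rewrite addrAC. Qed.
Lemma deg_dr i j l l' : i + j = l -> l + io = l' -> i + (j + io) = l' :> Gam.
Proof. by move=> <- <-; rewrite addrA. Qed.
Lemma deg_la a i j l l' : i + j = l -> a + l = l' -> (a + i) + j = l' :> Gam.
Proof. by move=> <- <-; rewrite addrA. Qed.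
Lemma deg_ra a i j l l' : i + j = l -> l + a = l' -> i + (j + a) = l' :> Gam.
Proof. by move=> <- <-; rewrite addrA. Qed.

Definition tdd_gen X Z l l' (e' : l + io = l') Y i j (e : i + j = l)
    (m : M X Y i) (n : N Y Z j) : tmod X Z l' :=
  telt (deg_dl e e') (dd erefl m) n +
  (-1) ^+ (pairing io i) *: telt (deg_dr e e') m (dd erefl n).

Definition tdd X Z l l' (e' : l + io = l') : tmod X Z l -> tmod X Z l' :=
  tlift (tdd_gen e').

Definition tlact_gen X' X Z a l l' (e' : a + l = l') (g : hom X X' a)
    Y i j (e : i + j = l) (m : M X Y i) (n : N Y Z j) : tmod X' Z l' :=
  telt (deg_la e e') (lact erefl g m) n.

Definition tlact X' X Z a l l' (e' : a + l = l') (g : hom X X' a) :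
  tmod X Z l -> tmod X' Z l' := tlift (tlact_gen e' g).

Definition tract_gen X Z Z' l a l' (e' : l + a = l') (g : hom Z' Z a)
    Y i j (e : i + j = l) (m : M X Y i) (n : N Y Z j) : tmod X Z' l' :=
  telt (deg_ra e e') m (ract erefl n g).

Definition tract X Z Z' l a l' (e' : l + a = l') (x : tmod X Z l)
  (g : hom Z' Z a) : tmod X Z' l' := tlift (tract_gen e' g) x.

Lemma telt_eq X Y Z i j i' j' l (e : i + j = l) (e' : i' + j' = l)
    (ei : i = i') (ej : j = j') (m : M X Y i) (n : N Y Z j) :
  telt e m n = telt e' (gcast ei m) (gcast ej n).
Proof. by case: _ / ei e'; case: _ / ej => e'; rewrite (eq_irrelevance e e'). Qed.

Section Tdd.
Variables (X : D) (Z : E) (l l' : Gam) (e' : l + io = l').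

Lemma tdd_gen_l Y i j (e : i + j = l) (n : N Y Z j) :
  linear (fun m : M X Y i => tdd_gen e' e m n).
Proof.
apply: lin_add; first by apply: (lin_app (telt_linl _ _)); apply: dd_lin.
by apply: lin_scale; apply: telt_linl.
Qed.

Lemma tdd_gen_r Y i j (e : i + j = l) (m : M X Y i) :
  linear (fun n : N Y Z j => tdd_gen e' e m n).
Proof.
apply: lin_add; first exact: telt_linr.
by apply: lin_scale; apply: (lin_app (telt_linr _ _)); apply: dd_lin.
Qed.

Lemma tdd_gen_bal Y Y' i j k ij jk (e1 : i + j = ij) (e2 : ij + k = l)
    (e3 : j + k = jk) (e4 : i + jk = l)
    (m : M X Y i) (f : hom Y' Y j) (n : N Y' Z k) : bal ->
  tdd_gen e' e2 (ract e1 m f) n = tdd_gen e' e4 m (lact e3 f n).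
Proof.
move=> hb; rewrite /tdd_gen.
have h1 : (i + io) + j = ij + io by rewrite -e1 addrAC.
have h2 : i + (j + io) = ij + io by rewrite -e1 addrA.
have h3 : (j + io) + k = jk + io by rewrite -e3 addrAC.
have h4 : j + (k + io) = jk + io by rewrite -e3 addrA.
rewrite (dd_ract e1 _ erefl h1 erefl h2) (dd_lact e3 _ erefl h3 erefl h4).
rewrite (linD (telt_linl _ _)) (linZ (telt_linl _ _)).
rewrite (linD (telt_linr _ _)) (linZ (telt_linr _ _)) scalerDr sgrD.
have -> : pairing io ij = pairing io i (+) pairing io j by rewrite -e1 pairingE.
rewrite -!addrA; congr (_ + (_ *: _ + _ *: _)).
all: exact: telt_bal.
Qed.

Lemma tddE Y i j i' j' (e : i + j = l)
    (ei : i + io = i') (e1 : i' + j = l') (ej : j + io = j') (e2 : i + j' = l')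
    (m : M X Y i) (n : N Y Z j) :
  tdd e' (telt e m n) =
  telt e1 (dd ei m) n + (-1) ^+ (pairing io i) *: telt e2 m (dd ej n).
Proof.
rewrite /tdd tliftE; [|exact: tdd_gen_l|exact: tdd_gen_r|exact: tdd_gen_bal].
case: _ / ei e1; case: _ / ej e2 => e2 e1; rewrite /tdd_gen.
by rewrite (eq_irrelevance (deg_dl _ _) e1) (eq_irrelevance (deg_dr _ _) e2).
Qed.

Lemma tdd_lin : linear (@tdd X Z l l' e').
Proof. by apply: tlift_lin; [exact: tdd_gen_l|exact: tdd_gen_r|exact: tdd_gen_bal]. Qed.

End Tdd.

Section Tlact.
Variables (X' X : D) (Z : E) (a l l' : Gam) (e' : a + l = l') (g : hom X X' a).

Lemma tlact_gen_l Y i j (e : i + j = l) (n : N Y Z j) :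
  linear (fun m : M X Y i => tlact_gen e' g e m n).
Proof. by apply: (lin_app (telt_linl _ _)); apply: lact_linr. Qed.

Lemma tlact_gen_r Y i j (e : i + j = l) (m : M X Y i) :
  linear (fun n : N Y Z j => tlact_gen e' g e m n).
Proof. exact: telt_linr. Qed.

Lemma tlact_gen_bal Y Y' i j k ij jk (e1 : i + j = ij) (e2 : ij + k = l)
    (e3 : j + k = jk) (e4 : i + jk = l)
    (m : M X Y i) (f : hom Y' Y j) (n : N Y' Z k) : bal ->
  tlact_gen e' g e2 (ract e1 m f) n = tlact_gen e' g e4 m (lact e3 f n).
Proof.
move=> hb; rewrite /tlact_gen.
have h1 : (a + i) + j = a + ij by rewrite -e1 addrA.
by rewrite -(lractA erefl h1); apply: telt_bal.
Qed.

Lemma tlactE Y i j i' (e : i + j = l) (ei : a + i = i') (e1 : i' + j = l')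
    (m : M X Y i) (n : N Y Z j) :
  tlact e' g (telt e m n) = telt e1 (lact ei g m) n.
Proof.
rewrite /tlact tliftE; [|exact: tlact_gen_l|exact: tlact_gen_r|exact: tlact_gen_bal].
by case: _ / ei e1 => e1; rewrite /tlact_gen (eq_irrelevance (deg_la _ _) e1).
Qed.

Lemma tlact_linr : linear (tlact e' g : tmod X Z l -> tmod X' Z l').
Proof. by apply: tlift_lin; [exact: tlact_gen_l|exact: tlact_gen_r|exact: tlact_gen_bal]. Qed.

End Tlact.

Section Tract.
Variables (X : D) (Z Z' : E) (l a l' : Gam) (e' : l + a = l') (g : hom Z' Z a).

Lemma tract_gen_l Y i j (e : i + j = l) (n : N Y Z j) :
  linear (fun m : M X Y i => tract_gen e' g e m n).
Proof. exact: telt_linl. Qed.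

Lemma tract_gen_r Y i j (e : i + j = l) (m : M X Y i) :
  linear (fun n : N Y Z j => tract_gen e' g e m n).
Proof. by apply: (lin_app (telt_linr _ _)); apply: ract_linl. Qed.

Lemma tract_gen_bal Y Y' i j k ij jk (e1 : i + j = ij) (e2 : ij + k = l)
    (e3 : j + k = jk) (e4 : i + jk = l)
    (m : M X Y i) (f : hom Y' Y j) (n : N Y' Z k) : bal ->
  tract_gen e' g e2 (ract e1 m f) n = tract_gen e' g e4 m (lact e3 f n).
Proof.
move=> hb; rewrite /tract_gen.
have h1 : j + (k + a) = jk + a by rewrite -e3 addrA.
by rewrite (lractA e3 erefl erefl h1); apply: telt_bal.
Qed.

Lemma tractE Y i j j' (e : i + j = l) (ej : j + a = j') (e1 : i + j' = l')
    (m : M X Y i) (n : N Y Z j) :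
  tract e' (telt e m n) g = telt e1 m (ract ej n g).
Proof.
rewrite /tract tliftE; [|exact: tract_gen_l|exact: tract_gen_r|exact: tract_gen_bal].
by case: _ / ej e1 => e1; rewrite /tract_gen (eq_irrelevance (deg_ra _ _) e1).
Qed.

Lemma tract_linl : linear (fun x : tmod X Z l => tract e' x g).
Proof. by apply: tlift_lin; [exact: tract_gen_l|exact: tract_gen_r|exact: tract_gen_bal]. Qed.

End Tract.

Lemma tdd_tdd X Z l l' l'' (e : l + io = l') (e' : l' + io = l'') (x : tmod X Z l) :
  tdd e' (tdd e x) = 0.
Proof.
move: x; apply: tens_ext => [||Y i j e0 m n].
- by apply: (lin_app (tdd_lin _)); apply: tdd_lin.
- exact: lin_zero.
have h1 : i + io + j = l' by rewrite -e -e0 addrAC.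
have h2 : i + (j + io) = l' by rewrite -e -e0 addrA.
have h3 : i + io + io + j = l'' by rewrite -e' -h1 addrAC.
have h4 : i + io + (j + io) = l'' by rewrite -e' -h1 addrA.
have h5 : i + (j + io + io) = l'' by rewrite -e' -h2 addrA.
rewrite (tddE e e0 erefl h1 erefl h2) (linD (tdd_lin _)) (linZ (tdd_lin _)).
rewrite (tddE e' h1 erefl h3 erefl h4) (tddE e' h2 erefl h4 erefl h5) !dd_dd.
rewrite (lin0 (telt_linl _ _)) (lin0 (telt_linr _ _)) add0r scaler0 addr0.
rewrite !pairingE addbT -scalerDl.
by case: pairing; rewrite /= ?expr0 ?expr1 ?addrN ?addNr scale0r.
Qed.

Definition tensM X Z : dgMod :=
  @DgMod (tmod X Z) (@tdd X Z) (@tdd_lin X Z) (@tdd_tdd X Z).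

Program Definition tens : bimod D E :=
  (@Bimod D E tensM tlact tract _ _ _ _ _ _ _ _ _ _ _).
Next Obligation.
move=> X' X Z a l l' e x b g g' /=; move: x; apply: tens_ext.
+ exact: tlact_linr.
+ apply: lin_add; last exact: tlact_linr.
  by apply: lin_scale; apply: tlact_linr.
move=> Y i j e0 m n; rewrite !(tlactE e _ e0 erefl (deg_la e0 e)).
by rewrite lact_linl telt_linl.
Qed.
Next Obligation.
by move=> *; apply: tlact_linr.
Qed.
Next Obligation.
by move=> *; apply: tract_linl.
Qed.
Next Obligation.
move=> X Z Z' l a l' e x b g g' /=; move: x; apply: tens_ext.
+ exact: tract_linl.
+ apply: lin_add; last exact: tract_linl.
  by apply: lin_scale; apply: tract_linl.
move=> Y i j e0 m n; rewrite !(tractE e _ e0 erefl (deg_ra e0 e)).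
by rewrite ract_linr telt_linr.
Qed.
Next Obligation.
move=> X'' X' X Z a b l ab bl l' e1 e2 e3 e4 h g x /=; move: x; apply: tens_ext.
+ exact: tlact_linr.
+ by apply: (lin_app (tlact_linr _ _)); apply: tlact_linr.
move=> Y i j e0 m n.
rewrite (tlactE e3 _ e0 erefl (deg_la e0 e3)).
rewrite (tlactE e2 _ e0 erefl (deg_la e0 e2)).
have h1 : a + (b + i) = ab + i by rewrite -e1 addrA.
rewrite (tlactE e4 _ _ h1 (deg_la e0 e2)).
by rewrite (lactA e1 _ erefl h1).
Qed.
Next Obligation.
move=> X Z Z' Z'' l a b la ab l' e1 e2 e3 e4 x g h /=; move: x; apply: tens_ext.
+ by apply: (lin_app (tract_linl _ _)); apply: tract_linl.
+ exact: tract_linl.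
move=> Y i j e0 m n.
rewrite (tractE e1 _ e0 erefl (deg_ra e0 e1)).
rewrite (tractE e4 _ e0 erefl (deg_ra e0 e4)).
have h1 : j + a + b = j + ab by rewrite -e3 addrA.
rewrite (tractE e2 _ _ h1 (deg_ra e0 e4)).
by rewrite (ractA erefl h1 e3 erefl).
Qed.
Next Obligation.
move=> X' X Z Z' a l b al lb l' e1 e2 e3 e4 g x h /=; move: x; apply: tens_ext.
+ by apply: (lin_app (tract_linl _ _)); apply: tlact_linr.
+ by apply: (lin_app (tlact_linr _ _)); apply: tract_linl.
move=> Y i j e0 m n.
rewrite (tlactE e1 _ e0 erefl (deg_la e0 e1)).
rewrite (tractE e2 _ _ erefl (deg_ra (deg_la e0 e1) e2)).
rewrite (tractE e3 _ e0 erefl (deg_ra e0 e3)).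
by rewrite (tlactE e4 _ _ erefl (deg_ra (deg_la e0 e1) e2)).
Qed.
Next Obligation.
move=> X Z l e x /=; move: x; apply: tens_ext; [exact: tlact_linr|exact: lin_id|].
move=> Y i j e0 m n.
by rewrite (tlactE e _ e0 (add0r i) e0) lact1.
Qed.
Next Obligation.
move=> X Z l e x /=; move: x; apply: tens_ext; [exact: tract_linl|exact: lin_id|].
move=> Y i j e0 m n.
by rewrite (tractE e _ e0 (addr0 j) e0) ract1.
Qed.
Next Obligation.
move=> X' X Z a l k a' l' k' e e' ea e1 el e2 g x /=; move: x; apply: tens_ext.
+ by apply: (lin_app (tdd_lin _)); apply: tlact_linr.
+ apply: lin_add; first exact: tlact_linr.
  by apply: lin_scale; apply: (lin_app (tlact_linr _ _)); apply: tdd_lin.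
move=> Y i j e0 m n.
have h1 : (a + i + io) + j = k' by rewrite -e' -e -e0 addrAC addrA.
have h2 : (a + i) + (j + io) = k' by rewrite -e' -e -e0 !addrA.
have h3 : i + io + j = l' by rewrite -el -e0 addrAC.
have h4 : i + (j + io) = l' by rewrite -el -e0 !addrA.
have h5 : a' + i = a + i + io by rewrite -ea addrAC.
have h6 : a + (i + io) = a + i + io by rewrite !addrA.
rewrite (tlactE e _ e0 erefl (deg_la e0 e)) (tddE e' _ erefl h1 erefl h2).
rewrite (tddE el e0 erefl h3 erefl h4) (linD (tlact_linr _ _)) (linZ (tlact_linr _ _)).
rewrite (tlactE e1 _ e0 h5 h1) (tlactE e2 _ h3 h6 h1) (tlactE e2 _ h4 erefl h2).
rewrite (dd_lact erefl erefl ea h5 erefl h6) (linD (telt_linl _ _)) (linZ (telt_linl _ _)).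
by rewrite scalerDr sgrD pairingE addrA.
Qed.
Next Obligation.
move=> X Z Z' l a k l' a' k' e e' el e1 ea e2 x g /=; move: x; apply: tens_ext.
+ by apply: (lin_app (tdd_lin _)); apply: tract_linl.
+ apply: lin_add; first by apply: (lin_app (tract_linl _ _)); apply: tdd_lin.
  by apply: lin_scale; apply: tract_linl.
move=> Y i j e0 m n.
have h1 : (i + io) + (j + a) = k' by rewrite -e' -e -e0 !addrA (addrAC _ io) addrAC.
have h2 : i + (j + a + io) = k' by rewrite -e' -e -e0 !addrA.
have h3 : i + io + j = l' by rewrite -el -e0 addrAC.
have h4 : i + (j + io) = l' by rewrite -el -e0 !addrA.
have h5 : (j + io) + a = j + a + io by rewrite addrAC.
have h6 : j + a' = j + a + io by rewrite -ea !addrA.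
rewrite (tractE e _ e0 erefl (deg_ra e0 e)) (tddE e' _ erefl h1 erefl h2).
rewrite (tddE el e0 erefl h3 erefl h4) (linD (tract_linl _ _)) (linZ (tract_linl _ _)).
rewrite (tractE e1 _ h3 erefl h1) (tractE e1 _ h4 h5 h2) (tractE e2 _ e0 h6 h2).
rewrite (dd_ract erefl erefl erefl h5 ea h6) (linD (telt_linr _ _)) (linZ (telt_linr _ _)).
have -> : pairing io l = pairing io i (+) pairing io j by rewrite -e0 pairingE.
by rewrite scalerDr sgrD addrA.
Qed.

End Tensor.

#[global] Arguments tddE {bal D C E M N X Z l l'} e' {Y i j i' j'} e ei e1 ej e2 m n.
#[global] Arguments tlactE {bal D C E M N X' X Z a l l'} e' g {Y i j i'} e ei e1 m n.
#[global] Arguments tractE {bal D C E M N X Z Z' l a l'} e' g {Y i j j'} e ej e1 m n.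
#[global] Arguments tdd_lin {bal D C E M N X Z l l'} e'.
#[global] Arguments tlact_linr {bal D C E M N X' X Z a l l'} e' g.
#[global] Arguments tract_linl {bal D C E M N X Z Z' l a l'} e' g.
#[global] Arguments telt_linl bal {D C E M N X Y Z i j l} e n.
#[global] Arguments telt_linr bal {D C E M N X Y Z i j l} e m.
#[global] Arguments telt bal {D C E M N X Y Z i j l} e m n.
#[global] Arguments tens bal {D C E} M N.

Section DSum.
Variable M : nat -> lmodType K.

Inductive drel : fterm K {r & M r} -> fterm K {r & M r} -> Prop :=
  | drel_lin r a (x y : M r) :
      drel (Fg K (existT _ r (a *: x + y)))
           (FD (FZ a (Fg K (existT _ r x))) (Fg K (existT _ r y))).

Definition dsum : lmodType K := pres drel.

Definition din r (x : M r) : dsum := pgen drel (existT _ r x).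

Lemma din_lin r : linear (@din r).
Proof.
move=> a x y; rewrite /din /pgen -pclZ -pclD.
by apply/pcl_eq/feq_rel; constructor.
Qed.

Definition dlift (V : lmodType K) (phi : forall r, M r -> V) : dsum -> V :=
  plift (fun g : {r & M r} => @phi (projT1 g) (projT2 g)).

Section DLift.
Variables (V : lmodType K) (phi : forall r, M r -> V).
Hypothesis phi_lin : forall r, linear (@phi r).

Lemma dlift_respects (t t' : fterm K {r & M r}) : drel t t' ->
  feval (fun g : {r & M r} => @phi (projT1 g) (projT2 g)) t =
  feval (fun g : {r & M r} => @phi (projT1 g) (projT2 g)) t'.
Proof. by case=> r a x y /=; rewrite phi_lin. Qed.

Lemma dliftE r x : dlift phi (@din r x) = @phi r x.
Proof. exact: (plift_gen dlift_respects). Qed.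

Lemma dlift_lin : linear (dlift phi).
Proof. exact: (plift_lin dlift_respects). Qed.

End DLift.

Lemma dsum_ext (V : lmodType K) (f g : dsum -> V) :
  linear f -> linear g -> (forall r x, f (@din r x) = g (din x)) ->
  forall x, f x = g x.
Proof. by move=> Hf Hg H; apply: pres_ext => // -[r x]; apply: H. Qed.

End DSum.

Section Bar.
Variable C : dgCat.

Definition regC : bimod C C := reg (fun_id C) (fun_id C).

(* [hompow n] is the (n+1)-fold tensor product over K of hom modules, summed
   over the n intermediate objects, bracketed to the right. *)
Fixpoint hompow (n : nat) : bimod C C :=
  if n is n'.+1 then tens false regC (hompow n') else regC.

(* The bimodule map f (x) t |-> f t. *)
Section Mul.
Variable N : bimod C C.
Local Notation T := (tens false regC N).

Definition mul_gen X Z l l' (e' : 0 + l = l') Y i j (e : i + j = l)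
    (f : regC X Y i) (t : N Y Z j) : N X Z l' :=
  lact (etrans e (etrans (esym (add0r l)) e')) (f : hom Y X i) t.

Definition mul_fun X Z l l' (e' : 0 + l = l') : T X Z l -> N X Z l' :=
  tlift (mul_gen e').

Section MulLin.
Variables (X Z : C) (l l' : Gam) (e' : 0 + l = l').

Lemma mul_gen_l Y i j (e : i + j = l) (t : N Y Z j) :
  linear (fun f : regC X Y i => mul_gen e' e f t).
Proof. exact: lact_linl. Qed.

Lemma mul_gen_r Y i j (e : i + j = l) (f : regC X Y i) :
  linear (fun t : N Y Z j => mul_gen e' e f t).
Proof. exact: lact_linr. Qed.

Lemma mulE Y i j (e : i + j = l) (e1 : i + j = l') (f : regC X Y i) (t : N Y Z j) :
  mul_fun e' (telt false e f t : T X Z l) = lact e1 (f : hom Y X i) t.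
Proof.
rewrite /mul_fun tliftE; [|exact: mul_gen_l|exact: mul_gen_r|by []].
by rewrite /mul_gen (eq_irrelevance (etrans _ _) e1).
Qed.

Lemma mul_lin : linear (@mul_fun X Z l l' e').
Proof. by apply: tlift_lin; [exact: mul_gen_l|exact: mul_gen_r|]. Qed.

End MulLin.

Program Definition mulh : bimHom T N 0 :=
  (@BimHom C C T N 0 mul_fun mul_lin _ _).
Next Obligation.
move=> X' X Z a l k l' k' e e1 e2 e3 g x /=; rewrite pairing0l expr0 scale1r.
move: x; apply: tens_ext.
+ by apply: (lin_app (mul_lin _)); apply: tlact_linr.
+ by apply: (lin_app (lact_linr _ _)); apply: mul_lin.
move=> Y i j e0 f t; rewrite (tlactE e _ e0 erefl (deg_la e0 e)).
have h1 : a + i + j = k' by rewrite -e1 -e -e0 add0r addrA.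
have h2 : i + j = l' by rewrite -e2 -e0 add0r.
by rewrite (mulE _ _ h1) (mulE _ _ h2) -(lactA erefl h1).
Qed.
Next Obligation.
move=> X Z Z' l a k l' k' e e1 e2 e3 x g /=; move: x; apply: tens_ext.
+ by apply: (lin_app (mul_lin _)); apply: tract_linl.
+ by apply: (lin_app (ract_linl _ _)); apply: mul_lin.
move=> Y i j e0 f t; rewrite (tractE e _ e0 erefl (deg_ra e0 e)).
have h1 : i + (j + a) = k' by rewrite -e1 -e -e0 add0r addrA.
have h2 : i + j = l' by rewrite -e2 -e0 add0r.
by rewrite (mulE _ _ h1) (mulE _ _ h2) (lractA h2 _ erefl h1).
Qed.

Lemma mulh_dd X Z l l' k k' (e1 : 0 + l = l') (e2 : l' + io = k')
    (e3 : l + io = k) (e4 : 0 + k = k') (x : T X Z l) :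
  dd e2 (bh mulh e1 x) = bh mulh e4 (dd e3 x).
Proof.
rewrite /=; move: x; apply: tens_ext.
- by apply: (lin_app (dd_lin _)); apply: mul_lin.
- by apply: (lin_app (mul_lin _)); apply: tdd_lin.
move=> Y i j e0 f t.
have h0 : i + j = l' by rewrite -e1 add0r.
have h1 : i + io + j = k by rewrite -e3 -e0 addrAC.
have h2 : i + (j + io) = k by rewrite -e3 -e0 addrA.
have h3 : i + io + j = k' by rewrite h1 -e4 add0r.
have h4 : i + (j + io) = k' by rewrite h2 -e4 add0r.
rewrite (tddE e3 e0 erefl h1 erefl h2) (linD (mul_lin _)) (linZ (mul_lin _)).
rewrite (mulE _ _ h0) (mulE _ _ h3) (mulE _ _ h4).
exact: dd_lact.
Qed.

End Mul.

(* The bimodule map f (x) t |-> f t - f (x) b t. *)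
Section Next.
Variables (N : bimod C C) (b : bimHom (tens false regC N) N 0).
Local Notation T := (tens false regC N).
Local Notation TT := (tens false regC T).

Definition next_gen X Z l l' (e' : 0 + l = l') Y i j (e : i + j = l)
    (f : regC X Y i) (t : T Y Z j) : T X Z l' :=
  lact (etrans e (etrans (esym (add0r l)) e')) (f : hom Y X i) t -
  telt false (etrans e (etrans (esym (add0r l)) e')) f (bh b (add0r j) t).

Definition next_fun X Z l l' (e' : 0 + l = l') : TT X Z l -> T X Z l' :=
  tlift (next_gen e').

Section NextLin.
Variables (X Z : C) (l l' : Gam) (e' : 0 + l = l').

Lemma next_gen_l Y i j (e : i + j = l) (t : T Y Z j) :
  linear (fun f : regC X Y i => next_gen e' e f t).
Proof.
apply: lin_add; first exact: lact_linl.
by apply: lin_opp; apply: telt_linl.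
Qed.

Lemma next_gen_r Y i j (e : i + j = l) (f : regC X Y i) :
  linear (fun t : T Y Z j => next_gen e' e f t).
Proof.
apply: lin_add; first exact: lact_linr.
by apply: lin_opp; apply: (lin_app (telt_linr _ _ _)); apply: bh_lin.
Qed.

Lemma nextE Y i j j' (e : i + j = l) (e1 : i + j = l') (e2 : 0 + j = j')
    (e3 : i + j' = l') (f : regC X Y i) (t : T Y Z j) :
  next_fun e' (telt false e f t : TT X Z l) =
  lact e1 (f : hom Y X i) t - telt false e3 f (bh b e2 t).
Proof.
rewrite /next_fun tliftE; [|exact: next_gen_l|exact: next_gen_r|by []].
rewrite /next_gen (eq_irrelevance (etrans _ _) e1).
have ej : j = j' by rewrite -e2 add0r.
case: _ / ej e2 e3 => e2 e3.
by rewrite (eq_irrelevance e3 e1) (eq_irrelevance (add0r j) e2).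
Qed.

Lemma next_lin : linear (@next_fun X Z l l' e').
Proof. by apply: tlift_lin; [exact: next_gen_l|exact: next_gen_r|]. Qed.

End NextLin.

Program Definition nexth : bimHom TT T 0 :=
  (@BimHom C C TT T 0 next_fun next_lin _ _).
Next Obligation.
move=> X' X Z a l k l' k' e e1 e2 e3 g x /=; rewrite pairing0l expr0 scale1r.
move: x; apply: tens_ext.
+ by apply: (lin_app (next_lin _)); apply: tlact_linr.
+ by apply: (lin_app (tlact_linr _ _)); apply: next_lin.
move=> Y i j e0 f t; rewrite (tlactE e _ e0 erefl (deg_la e0 e)).
have h1 : a + i + j = k' by rewrite -e1 -e -e0 add0r addrA.
have h2 : i + j = l' by rewrite -e2 -e0 add0r.
rewrite (nextE _ _ h1 (add0r j) h1) (nextE _ _ h2 (add0r j) h2).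
rewrite (linB (tlact_linr _ _)) (tlactE _ _ _ erefl h1).
by congr (_ - _); apply: (lactA (b := T) erefl).
Qed.
Next Obligation.
move=> X Z Z' l a k l' k' e e1 e2 e3 x g /=; move: x; apply: tens_ext.
+ by apply: (lin_app (next_lin _)); apply: tract_linl.
+ by apply: (lin_app (tract_linl _ _)); apply: next_lin.
move=> Y i j e0 f t; rewrite (tractE e _ e0 erefl (deg_ra e0 e)).
have h1 : i + (j + a) = k' by rewrite -e1 -e -e0 add0r addrA.
have h2 : i + j = l' by rewrite -e2 -e0 add0r.
rewrite (nextE _ _ h1 (add0r _) h1) (nextE _ _ h2 (add0r j) h2).
rewrite (linB (tract_linl _ _)) (tractE _ _ _ erefl h1).
congr (_ - _); first by symmetry; apply: (lractA (b := T)).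
by congr telt; apply: bh_ract.
Qed.

Hypothesis b_dd : forall X Z l l' k k' (e1 : 0 + l = l') (e2 : l' + io = k')
    (e3 : l + io = k) (e4 : 0 + k = k') (x : T X Z l),
  dd e2 (bh b e1 x) = bh b e4 (dd e3 x).

Lemma nexth_dd X Z l l' k k' (e1 : 0 + l = l') (e2 : l' + io = k')
    (e3 : l + io = k) (e4 : 0 + k = k') (x : TT X Z l) :
  dd e2 (bh nexth e1 x) = bh nexth e4 (dd e3 x).
Proof.
rewrite /=; move: x; apply: tens_ext.
- by apply: (lin_app (tdd_lin _)); apply: next_lin.
- by apply: (lin_app (next_lin _)); apply: tdd_lin.
move=> Y i j e0 f t.
have h0 : i + j = l' by rewrite -e1 add0r.
have h1 : i + io + j = k by rewrite -e3 -e0 addrAC.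
have h2 : i + (j + io) = k by rewrite -e3 -e0 addrA.
have h3 : i + io + j = k' by rewrite h1 -e4 add0r.
have h4 : i + (j + io) = k' by rewrite h2 -e4 add0r.
rewrite (tddE e3 e0 erefl h1 erefl h2) (linD (next_lin _)) (linZ (next_lin _)).
rewrite (nextE _ _ h0 (add0r j) h0) (nextE _ _ h3 (add0r j) h3).
rewrite (nextE _ _ h4 (add0r (j + io)) h4) (linB (tdd_lin _)).
rewrite (tddE e2 h0 erefl h3 erefl h4) (b_dd _ _ erefl (add0r _)).
rewrite scalerBr opprD addrACA; congr (_ + _).
exact: (dd_lact (b := T)).
Qed.

End Next.

(* The composition part of the bar differential:
   f_0 (x) ... (x) f_(n+1) |->
     sum over i <= n of (-1)^i f_0 (x) ... (x) f_i f_(i+1) (x) ... *)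
Fixpoint contr (n : nat) : bimHom (hompow n.+1) (hompow n) 0 :=
  if n is n'.+1 return bimHom (hompow n.+1) (hompow n) 0
  then nexth (contr n') else mulh regC.

Lemma contr_dd n X Z l l' k k' (e1 : 0 + l = l') (e2 : l' + io = k')
    (e3 : l + io = k) (e4 : 0 + k = k') (x : hompow n.+1 X Z l) :
  dd e2 (bh (contr n) e1 x) = bh (contr n) e4 (dd e3 x).
Proof.
elim: n X Z l l' k k' e1 e2 e3 e4 x => [|n IH] X Z l l' k k' e1 e2 e3 e4 x.
  exact: mulh_dd.
exact: nexth_dd.
Qed.

Lemma contr_contr n X Z l l' l'' (e1 : 0 + l = l') (e2 : 0 + l' = l'')
    (x : hompow n.+2 X Z l) :
  bh (contr n) e2 (bh (contr n.+1) e1 x) = 0.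
Proof.
elim: n X Z l l' l'' e1 e2 x => [|n IH] X Z l l' l'' e1 e2.
- apply: tens_ext; [|exact: lin_zero|].
    by apply: (lin_app (bh_lin _ _)); apply: next_lin.
  move=> Y i j e f t.
  have h1 : i + j = l' by rewrite -e1 add0r.
  have h2 : i + j = l'' by rewrite -e2 add0r.
  have -> : bh (contr 1) e1 (telt false e f t : hompow 2 X Z l) =
     lact h1 (f : hom Y X i) t - telt false h1 f (bh (mulh regC) (add0r j) t).
    exact: nextE.
  rewrite (linB (bh_lin _ _)); apply/eqP; rewrite subr_eq0; apply/eqP.
  have -> := bh_lact (contr 0) h1 e2 (add0r j) h2 (f : hom Y X i) t.
  rewrite pairing0l expr0 scale1r; symmetry; exact: mulE.
apply: tens_ext; [|exact: lin_zero|].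
  by apply: (lin_app (bh_lin _ _)); apply: next_lin.
move=> Y i j e f t.
have h1 : i + j = l' by rewrite -e1 add0r.
have h2 : i + j = l'' by rewrite -e2 add0r.
have -> : bh (contr n.+2) e1 (telt false e f t : hompow n.+3 X Z l) =
   lact h1 (f : hom Y X i) t - telt false h1 f (bh (contr n.+1) (add0r j) t).
  exact: nextE.
rewrite (linB (bh_lin _ _)).
have -> := bh_lact (contr n.+1) h1 e2 (add0r j) h2 (f : hom Y X i) t.
have -> : bh (contr n.+1) e2 (telt false h1 f (bh (contr n.+1) (add0r j) t) : hompow n.+2 X Z l') =
   lact h2 (f : hom Y X i) (bh (contr n.+1) (add0r j) t) -
   telt false h2 f (bh (contr n) (add0r j) (bh (contr n.+1) (add0r j) t)).
  exact: nextE.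
by rewrite IH (lin0 (telt_linr _ _ _)) subr0 pairing0l expr0 scale1r subrr.
Qed.

Section BarMod.
Variables Y Y' : C.

Definition bar_mod (l : Gam) : lmodType K :=
  dsum (fun r => hompow r.+1 Y Y' (l + io *+ r)).

(* [bin r l u]: the element u, of degree l + r io in the tensor product,
   regarded in the summand q^(-r io) of Bar, where it has degree l. *)
Definition bin r l (u : hompow r.+1 Y Y' (l + io *+ r)) : bar_mod l :=
  @din (fun r => hompow r.+1 Y Y' (l + io *+ r)) r u.

Lemma deg_bd l l' r : l + io = l' -> l + io *+ r + io = l' + io *+ r :> Gam.
Proof. by move=> <-; rewrite addrAC. Qed.

Lemma deg_bc l l' r :
  l + io = l' -> 0 + (l + io *+ r.+1) = l' + io *+ r :> Gam.
Proof. by move=> <-; rewrite add0r mulrS addrA. Qed.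

(* Differential on the summand r: the tensor differential, with the sign
   (-1)^r of the shift q^(-r io), plus the composition terms if r >= 1. *)
Definition bar_contr l l' (e : l + io = l') r :
    hompow r.+1 Y Y' (l + io *+ r) -> bar_mod l' :=
  if r is r'.+1
  return hompow r.+1 Y Y' (l + io *+ r) -> bar_mod l'
  then fun u => bin (bh (contr r'.+1) (deg_bc r' e) u)
  else fun _ => 0.

Definition bar_dd_gen l l' (e : l + io = l') r
    (u : hompow r.+1 Y Y' (l + io *+ r)) : bar_mod l' :=
  (-1) ^+ r *: bin (dd (deg_bd r e) u) + bar_contr e u.

Definition bar_dd l l' (e : l + io = l') : bar_mod l -> bar_mod l' :=
  dlift (bar_dd_gen e).

Lemma bin_lin r l : linear (@bin r l).
Proof. exact: (@din_lin (fun r => hompow r.+1 Y Y' (l + io *+ r))). Qed.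

Lemma bar_contr_lin l l' (e : l + io = l') r : linear (@bar_contr l l' e r).
Proof.
case: r => [|r]; first exact: lin_zero.
by apply: (lin_app (@bin_lin _ _)); apply: bh_lin.
Qed.

Lemma bar_dd_gen_lin l l' (e : l + io = l') r : linear (@bar_dd_gen l l' e r).
Proof.
apply: lin_add; last exact: bar_contr_lin.
by apply: lin_scale; apply: (lin_app (@bin_lin _ _)); apply: dd_lin.
Qed.

Lemma bar_ddE l l' (e : l + io = l') r (u : hompow r.+1 Y Y' (l + io *+ r)) :
  bar_dd e (bin u) = (-1) ^+ r *: bin (dd (deg_bd r e) u) + bar_contr e u.
Proof. exact: (dliftE (@bar_dd_gen_lin l l' e)). Qed.

Lemma bar_dd_lin l l' (e : l + io = l') : linear (bar_dd e).
Proof. exact: (dlift_lin (@bar_dd_gen_lin l l' e)). Qed.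

Lemma bar_ext l (V : lmodType K) (f g : bar_mod l -> V) :
  linear f -> linear g ->
  (forall r (u : hompow r.+1 Y Y' (l + io *+ r)), f (bin u) = g (bin u)) ->
  forall x, f x = g x.
Proof. exact: dsum_ext. Qed.

Lemma bar_contr_dd l l' l'' (e : l + io = l') (e' : l' + io = l'') r
    (u : hompow r.+1 Y Y' (l + io *+ r)) :
  bar_dd e' (bar_contr e u) =
  - ((-1) ^+ r *: bar_contr e' (dd (deg_bd r e) u)).
Proof.
case: r u => [|r] u; first by rewrite (lin0 (bar_dd_lin _)) scaler0 oppr0.
rewrite /bar_contr bar_ddE.
rewrite (contr_dd _ _ (deg_bd r.+1 e) (deg_bc r e')).
rewrite exprS mulN1r scaleNr opprK.
case: r u => [|r] u; first by rewrite /bar_contr addr0.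
by rewrite /bar_contr contr_contr (lin0 (@bin_lin _ _)) addr0.
Qed.

Lemma bar_dd_dd l l' l'' (e : l + io = l') (e' : l' + io = l'') (x : bar_mod l) :
  bar_dd e' (bar_dd e x) = 0.
Proof.
move: x; apply: bar_ext; [|exact: lin_zero|].
  by apply: (lin_app (bar_dd_lin _)); apply: bar_dd_lin.
move=> r u; rewrite bar_ddE (linD (bar_dd_lin _)) (linZ (bar_dd_lin _)).
rewrite bar_contr_dd bar_ddE dd_dd (lin0 (@bin_lin _ _)) scaler0 add0r.
by rewrite subrr.
Qed.

Definition barM : dgMod := @DgMod bar_mod bar_dd bar_dd_lin bar_dd_dd.

End BarMod.

Lemma deg_bla a l k r :
  a + l = k -> a + (l + io *+ r) = k + io *+ r :> Gam.
Proof. by move=> <-; rewrite addrA. Qed.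

Lemma deg_bra l a k r :
  l + a = k -> l + io *+ r + a = k + io *+ r :> Gam.
Proof. by move=> <-; rewrite addrAC. Qed.

(* The sign (-1)^(r <io,|g|>) is the one of the shift q^(-r io). *)
Definition bar_lact_gen X' X Y a l k (e : a + l = k) (g : hom X X' a) r
    (u : hompow r.+1 X Y (l + io *+ r)) : bar_mod X' Y k :=
  (-1) ^+ (r * pairing io a) *: bin (lact (deg_bla r e) g u).

Definition bar_lact X' X Y a l k (e : a + l = k) (g : hom X X' a)
  (x : bar_mod X Y l) : bar_mod X' Y k := dlift (bar_lact_gen e g) x.

Definition bar_ract_gen X Y Y' l a k (e : l + a = k) (g : hom Y' Y a) r
    (u : hompow r.+1 X Y (l + io *+ r)) : bar_mod X Y' k :=
  bin (ract (deg_bra r e) u g).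

Definition bar_ract X Y Y' l a k (e : l + a = k) (x : bar_mod X Y l)
  (g : hom Y' Y a) : bar_mod X Y' k := dlift (bar_ract_gen e g) x.

Lemma bar_lact_gen_lin X' X Y a l k (e : a + l = k) (g : hom X X' a) r :
  linear (@bar_lact_gen X' X Y a l k e g r).
Proof.
by apply: lin_scale; apply: (lin_app (@bin_lin _ _ _ _)); apply: lact_linr.
Qed.

Lemma bar_ract_gen_lin X Y Y' l a k (e : l + a = k) (g : hom Y' Y a) r :
  linear (@bar_ract_gen X Y Y' l a k e g r).
Proof. by apply: (lin_app (@bin_lin _ _ _ _)); apply: ract_linl. Qed.

Lemma bar_lactE X' X Y a l k (e : a + l = k) (g : hom X X' a) r
    (u : hompow r.+1 X Y (l + io *+ r)) :
  bar_lact e g (bin u) =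
  (-1) ^+ (r * pairing io a) *: bin (lact (deg_bla r e) g u).
Proof. exact: (dliftE (@bar_lact_gen_lin X' X Y a l k e g)). Qed.

Lemma bar_lact_linr X' X Y a l k (e : a + l = k) (g : hom X X' a) :
  linear (@bar_lact X' X Y a l k e g).
Proof. exact: (dlift_lin (@bar_lact_gen_lin X' X Y a l k e g)). Qed.

Lemma bar_ractE X Y Y' l a k (e : l + a = k) (g : hom Y' Y a) r
    (u : hompow r.+1 X Y (l + io *+ r)) :
  bar_ract e (bin u) g = bin (ract (deg_bra r e) u g).
Proof. exact: (dliftE (@bar_ract_gen_lin X Y Y' l a k e g)). Qed.

Lemma bar_ract_linl X Y Y' l a k (e : l + a = k) (g : hom Y' Y a) :
  linear (fun x : bar_mod X Y l => bar_ract e x g).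
Proof. exact: (dlift_lin (@bar_ract_gen_lin X Y Y' l a k e g)). Qed.

Lemma sgr_mulb (V : lmodType K) (r : nat) (b : bool) (x : V) :
  (-1) ^+ (r * b) *: x = (-1) ^+ (odd r && b) *: x.
Proof. by rewrite -[in LHS]signr_odd oddM oddb. Qed.

Lemma sgr_nat (V : lmodType K) (r : nat) (x : V) :
  (-1) ^+ r *: x = (-1) ^+ odd r *: x.
Proof. by rewrite signr_odd. Qed.

Lemma pairing_ion r : @pairing G io (io *+ r) = odd r.
Proof.
elim: r => [|r IH]; first by rewrite mulr0n pairing0r.
by rewrite mulrS pairingDr IH pairing_io.
Qed.

Lemma bar_contr_lact X' X Y a l l' k k' (e : a + l = k) (ek : k + io = k')
    (el : l + io = l') (e2 : a + l' = k') (g : hom X X' a) r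
    (u : hompow r.+1 X Y (l + io *+ r)) :
  (-1) ^+ (r * pairing io a) *: bar_contr ek (lact (deg_bla r e) g u) =
  (-1) ^+ (pairing io a) *: bar_lact e2 g (bar_contr el u).
Proof.
case: r u => [|r] u.
  by rewrite /bar_contr (lin0 (bar_lact_linr _ _)) !scaler0.
rewrite /bar_contr bar_lactE !sgr_mulb sgrD.
rewrite (bh_lact _ _ _ (deg_bc r el) (deg_bla r e2)) pairing0l expr0 scale1r.
by congr (_ *: _); rewrite /=; case: (odd r); case: pairing.
Qed.

Lemma bar_contr_ract X Y Y' l a l' k k' (e : l + a = k) (ek : k + io = k')
    (el : l + io = l') (e1 : l' + a = k') (g : hom Y' Y a) r
    (u : hompow r.+1 X Y (l + io *+ r)) :
  bar_contr ek (ract (deg_bra r e) u g) = bar_ract e1 (bar_contr el u) g.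
Proof.
case: r u => [|r] u; first by rewrite /bar_contr (lin0 (bar_ract_linl _ _)).
rewrite /bar_contr bar_ractE.
by rewrite (bh_ract _ _ _ (deg_bc r el) (deg_bra r e1)).
Qed.

Program Definition bar : bimod C C :=
  (@Bimod C C barM bar_lact bar_ract _ _ _ _ _ _ _ _ _ _ _).
Next Obligation.
move=> X' X Y i j k e x c g g' /=; move: x; apply: bar_ext.
+ exact: bar_lact_linr.
+ apply: lin_add; last exact: bar_lact_linr.
  by apply: lin_scale; apply: bar_lact_linr.
move=> r u; rewrite !bar_lactE lact_linl bin_lin scalerDr !scalerA.
by rewrite [c * _]mulrC.
Qed.
Next Obligation.
by move=> *; apply: bar_lact_linr.
Qed.
Next Obligation.
by move=> *; apply: bar_ract_linl.
Qed.
Next Obligation.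
move=> X Y Y' i j k e x c g g' /=; move: x; apply: bar_ext.
+ exact: bar_ract_linl.
+ apply: lin_add; last exact: bar_ract_linl.
  by apply: lin_scale; apply: bar_ract_linl.
by move=> r u; rewrite !bar_ractE ract_linr bin_lin.
Qed.
Next Obligation.
move=> X'' X' X Y a b l ab bl k e1 e2 e3 e4 h g x /=; move: x; apply: bar_ext.
+ exact: bar_lact_linr.
+ by apply: (lin_app (bar_lact_linr _ _)); apply: bar_lact_linr.
move=> r u; rewrite !bar_lactE (linZ (bar_lact_linr _ _)) bar_lactE.
rewrite (lactA e1 _ (deg_bla r e3) (deg_bla r e4)) !sgr_mulb sgrD.
by rewrite -e1 pairingDr andb_addr addbC.
Qed.
Next Obligation.
move=> X Y Y' Y'' l a b la ab k e1 e2 e3 e4 x g h /=; move: x; apply: bar_ext.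
+ by apply: (lin_app (bar_ract_linl _ _)); apply: bar_ract_linl.
+ exact: bar_ract_linl.
by move=> r u; rewrite !bar_ractE (ractA _ _ e3 (deg_bra r e4)).
Qed.
Next Obligation.
move=> X' X Y Y' a l b al lb k e1 e2 e3 e4 g x h /=; move: x; apply: bar_ext.
+ by apply: (lin_app (bar_ract_linl _ _)); apply: bar_lact_linr.
+ by apply: (lin_app (bar_lact_linr _ _)); apply: bar_ract_linl.
move=> r u; rewrite bar_lactE (linZ (bar_ract_linl _ _)) !bar_ractE bar_lactE.
by rewrite (lractA _ _ (deg_bra r e3) (deg_bla r e4)).
Qed.
Next Obligation.
move=> X Y l e x /=; move: x; apply: bar_ext; [exact: bar_lact_linr|exact: lin_id|].
move=> r u; rewrite bar_lactE pairing0r muln0 expr0 scale1r.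
by rewrite lact1.
Qed.
Next Obligation.
move=> X Y l e x /=; move: x; apply: bar_ext; [exact: bar_ract_linl|exact: lin_id|].
by move=> r u; rewrite bar_ractE ract1.
Qed.
Next Obligation.
move=> X' X Y a l k a' l' k' e ek ea e1 el e2 g x /=; move: x; apply: bar_ext.
+ by apply: (lin_app (bar_dd_lin _)); apply: bar_lact_linr.
+ apply: lin_add; first exact: bar_lact_linr.
  by apply: lin_scale; apply: (lin_app (bar_lact_linr _ _)); apply: bar_dd_lin.
move=> r u; rewrite bar_lactE (linZ (bar_dd_lin _)) !bar_ddE.
rewrite (linD (bar_lact_linr _ _)) (linZ (bar_lact_linr _ _)) !bar_lactE.
rewrite !scalerDr (bar_contr_lact _ _ el e2) addrA; congr (_ + _).
rewrite (dd_lact (deg_bla r e) (deg_bd r ek) ea (deg_bla r e1) (deg_bd r el) (deg_bla r e2)).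
rewrite (linD (@bin_lin _ _ _ _)) (linZ (@bin_lin _ _ _ _)).
have -> : pairing io a' = pairing io a (+) true.
  by rewrite -ea pairingDr pairing_io.
rewrite !sgr_mulb !(sgr_nat r) !scalerDr !sgrD.
by congr (_ *: _ + _ *: _); case: (odd r); case: pairing.
Qed.
Next Obligation.
move=> X Y Y' l a k l' a' k' e ek el e1 ea e2 x g /=; move: x; apply: bar_ext.
+ by apply: (lin_app (bar_dd_lin _)); apply: bar_ract_linl.
+ apply: lin_add; first by apply: (lin_app (bar_ract_linl _ _)); apply: bar_dd_lin.
  by apply: lin_scale; apply: bar_ract_linl.
move=> r u; rewrite !bar_ractE !bar_ddE.
rewrite (linD (bar_ract_linl _ _)) (linZ (bar_ract_linl _ _)) !bar_ractE.
rewrite (bar_contr_ract _ _ el e1) addrAC; congr (_ + _).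
rewrite (dd_ract (deg_bra r e) (deg_bd r ek) (deg_bd r el) (deg_bra r e1) ea (deg_bra r e2)).
rewrite (linD (@bin_lin _ _ _ _)) (linZ (@bin_lin _ _ _ _)).
rewrite !(sgr_nat r) !scalerDr !sgrD pairingDr pairing_ion.
by congr (_ + _ *: _); case: (odd r); case: pairing.
Qed.

(* Composable sequences Z_0 <- Z_1 <- ... <- Z_r of homogeneous morphisms:
   [ccons f c] prepends f : Z_1 -> Z_0 of degree [k]. *)
Inductive chain : C -> C -> Type :=
  | cnil X : chain X X
  | ccons X Y Z (k : Gam) (f : hom Y X k) (c : chain Y Z) : chain X Z.

Fixpoint clen X Z (c : chain X Z) : nat :=
  if c is ccons _ _ _ _ _ c' then (clen c').+1 else 0.

(* |f_1| + ( ... + (|f_r| + k)) *)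
Fixpoint cdeg X Z (c : chain X Z) (k : Gam) : Gam :=
  if c is ccons _ _ _ i _ c' then i + cdeg c' k else k.

(* f_1 (x) ( ... (x) (f_r (x) g)) *)
Fixpoint ctens X Z (c : chain X Z) Y k (g : hom Y Z k) :
    hompow (clen c) X Y (cdeg c k) :=
  match c in chain X0 Z0
    return hom Y Z0 k -> hompow (clen c) X0 Y (cdeg c k) with
  | cnil X0 => fun g => g
  | ccons X0 Y0 Z0 i f c' => fun g =>
      telt false (erefl (i + cdeg c' k)) (f : regC X0 Y0 i) (ctens c' g)
  end g.

(* The element [f_0, f_1, ..., f_r, f_(r+1)] of Bar, where c = (f_1, ..., f_r). *)
Definition bar_elt Y X Z Y' i k l (f0 : hom X Y i) (c : chain X Z)
    (g : hom Y' Z k) (e : i + cdeg c k = l + io *+ clen c) : bar Y Y' l :=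
  bin (telt false e (f0 : regC Y X i) (ctens c g)).

End Bar.

#[global] Arguments bar_elt {C Y X Z Y' i k l} f0 c g e.

Lemma comp_cast1l (C : dgCat) (X Y : C) z i (ez : 0 = z) (e : z + i = i)
    (f : hom X Y i) : comp e (gcast ez (idm Y)) f = f.
Proof. by case: _ / ez e => e; apply: comp1l. Qed.

Lemma comp_cast1r (C : dgCat) (X Y : C) z i (ez : 0 = z) (e : i + z = i)
    (f : hom X Y i) : comp e f (gcast ez (idm X)) = f.
Proof. by case: _ / ez e => e; apply: comp1r. Qed.

Lemma comp_cast (C : dgCat) (X Y Z : C) i i' j j' k k' (ei : i = i')
    (ej : j = j') (ek : k = k') (e : i + j = k) (e' : i' + j' = k')
    (g : hom Y Z i) (f : hom X Y j) :
  comp e' (gcast ei g) (gcast ej f) = gcast ek (comp e g f).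
Proof.
by case: _ / ei e'; case: _ / ej; case: _ / ek => e'; rewrite (eq_irrelevance e' e).
Qed.

Lemma dd_cast (M : dgMod) i i' j j' (ei : i = i') (ej : j = j')
    (e : i + io = j) (e' : i' + io = j') (m : M i) :
  dd e' (gcast ei m) = gcast ej (dd e m).
Proof. by case: _ / ei e'; case: _ / ej => e'; rewrite (eq_irrelevance e' e). Qed.

Lemma gcast_lin (M : dgMod) i j (e : i = j) : linear (@gcast M i j e).
Proof. by case: _ / e. Qed.

Section Shifts.
Variable C : dgCat.

(* [SObj i X] is q^i X. *)
Record sobj := SObj { sdeg : Gam; sbase : C }.

Lemma deg_sd i j a b : i + io = j -> i + a - b + io = j + a - b :> Gam.
Proof. by move=> <-; rewrite addrAC (addrAC i). Qed.

Lemma deg_sc i j k a b c :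
  i + j = k -> (i + b - c) + (j + a - b) = k + a - c :> Gam.
Proof.
by move=> <-; rewrite addrACA (addrACA i) (addrC b a) addrA (addrAC _ (- c)) addrA addrK.
Qed.

Lemma deg_s1 a : 0 = 0 + a - a :> Gam.
Proof. by rewrite add0r subrr. Qed.

Definition shom_gr (X Y : sobj) (l : Gam) : lmodType K :=
  hom (sbase X) (sbase Y) (l + sdeg X - sdeg Y).

Definition shom_dd (X Y : sobj) i j (e : i + io = j) (f : shom_gr X Y i) :
    shom_gr X Y j :=
  (-1) ^+ (pairing io (sdeg Y)) *: dd (deg_sd (sdeg X) (sdeg Y) e) f.

Lemma shom_dd_lin X Y i j (e : i + io = j) : linear (@shom_dd X Y i j e).
Proof. by apply: lin_scale; apply: dd_lin. Qed.

Lemma shom_dd_dd X Y i j k (e : i + io = j) (e' : j + io = k) m :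
  @shom_dd X Y j k e' (shom_dd e m) = 0.
Proof. by rewrite /shom_dd (linZ (dd_lin _)) dd_dd !scaler0. Qed.

Definition shom (X Y : sobj) : dgMod :=
  @DgMod (shom_gr X Y) (@shom_dd X Y) (@shom_dd_lin X Y) (@shom_dd_dd X Y).

Definition scomp (X Y Z : sobj) i j k (e : i + j = k)
    (g : shom Y Z i) (f : shom X Y j) : shom X Z k :=
  comp (deg_sc (sdeg X) (sdeg Y) (sdeg Z) e)
    (g : hom (sbase Y) (sbase Z) _) (f : hom (sbase X) (sbase Y) _).

Definition sid (X : sobj) : shom X X 0 :=
  gcast (deg_s1 (sdeg X)) (idm (sbase X)).

(* The dg category S(C). *)
Program Definition dgS : dgCat :=
  (@DgCat sobj shom sid scomp _ _ _ _ _ _ _).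
Next Obligation.
by move=> *; apply: comp_linl.
Qed.
Next Obligation.
by move=> *; apply: comp_linr.
Qed.
Next Obligation.
by move=> *; apply: compA.
Qed.
Next Obligation.
by move=> *; apply: comp_cast1l.
Qed.
Next Obligation.
by move=> *; apply: comp_cast1r.
Qed.
Next Obligation.
move=> X i e; rewrite /= /shom_dd /sid.
have h : i = i + sdeg X - sdeg X by rewrite addrK.
by rewrite (dd_cast _ h e) dd_idm (lin0 (gcast_lin _)) scaler0.
Qed.
Next Obligation.
move=> X Y Z i j k i' j' l e e' ei e1 ej e2 g f; rewrite /= /shom_dd /scomp.
rewrite (dd_comp _ _ (deg_sd _ _ ei) (deg_sc _ _ _ e1) (deg_sd _ _ ej) (deg_sc _ _ _ e2)).
rewrite (linZ (comp_linl _ _)) (linZ (comp_linr _ _)) scalerDr !sgrD; congr (_ + _ *: _).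
by rewrite !pairingE; case: (pairing io i); case: (pairing io (sdeg Y)); case: (pairing io (sdeg Z)).
Qed.

End Shifts.

(* Finite index sets live in [Set] so that objects of envelopes are small
   enough to index the direct sums in Bar. *)
Record fidx := FIdx { fcar : Set; fcar_fin : Finite fcar }.
Definition fidx_finType (I : fidx) : finType := Finite.Pack (fcar_fin I).
Coercion fidx_finType : fidx >-> finType.
Definition unit_idx : fidx := @FIdx unit (Finite.class (unit : finType)).

Section Sums.
Variable C : dgCat.

Record aobj := AObj { aidx : fidx; abase : aidx -> C }.

Definition ahom_gr (X Y : aobj) (l : Gam) : lmodType K :=
  dprod (fun b : aidx Y => dprod (fun a : aidx X =>
    (hom (abase a) (abase b) l : lmodType K)) : lmodType K).

Definition ahom_dd (X Y : aobj) i j (e : i + io = j) (f : ahom_gr X Y i) :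
  ahom_gr X Y j := fun b a => dd e (f b a).

Lemma ahom_ext (X Y : aobj) l (f g : ahom_gr X Y l) :
  (forall b a, f b a = g b a) -> f = g.
Proof. by move=> H; do 2![apply: functional_extensionality_dep => ?]; apply: H. Qed.

Lemma ahom_dd_lin X Y i j (e : i + io = j) : linear (@ahom_dd X Y i j e).
Proof. by move=> a f g; apply: ahom_ext => b c; rewrite /ahom_dd dd_lin. Qed.

Lemma ahom_dd_dd X Y i j k (e : i + io = j) (e' : j + io = k) f :
  @ahom_dd X Y j k e' (ahom_dd e f) = 0.
Proof. by apply: ahom_ext => b c; rewrite /ahom_dd dd_dd. Qed.

Definition ahom (X Y : aobj) : dgMod :=
  @DgMod (ahom_gr X Y) (@ahom_dd X Y) (@ahom_dd_lin X Y) (@ahom_dd_dd X Y).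

Definition acomp (X Y Z : aobj) i j k (e : i + j = k)
    (g : ahom Y Z i) (f : ahom X Y j) : ahom X Z k :=
  fun c a => \sum_(b : aidx Y) comp e (g c b) (f b a).

(* The (a, b) entry of the identity matrix. *)
Definition adelta (X : aobj) (a b : aidx X) : hom (abase b) (abase a) 0 :=
  match b =P a with
  | ReflectT e =>
      eq_rect b (fun a => hom (abase b) (abase a) 0 : Type) (idm (abase b)) a e
  | ReflectF _ => 0
  end.

Definition aid (X : aobj) : ahom X X 0 := @adelta X.
#[global] Arguments aid : clear implicits.

Lemma adeltaxx (X : aobj) (a : aidx X) : adelta a a = idm (abase a).
Proof.
by rewrite /adelta; case: eqP => // e; rewrite (eq_irrelevance e erefl).
Qed.

Lemma adelta_neq (X : aobj) (a b : aidx X) : b != a -> adelta a b = 0.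
Proof. by rewrite /adelta; case: eqP. Qed.

Lemma sumE (X Y : aobj) l (I : Type) (r : seq I) (F : I -> ahom_gr X Y l) b a :
  (\sum_(i <- r) F i) b a = \sum_(i <- r) F i b a.
Proof. by elim: r => [|i r IH]; rewrite ?big_nil // !big_cons -IH. Qed.

Lemma acomp1l (X Y : aobj) i (e : 0 + i = i) (f : ahom X Y i) :
  acomp e (aid Y) f = f.
Proof.
apply: ahom_ext => c a; rewrite /acomp (bigD1 c) //= big1 => [|b hb].
  by rewrite addr0 /aid adeltaxx comp1l.
by rewrite /aid adelta_neq // (lin0 (comp_linl _ _)).
Qed.

Lemma acomp1r (X Y : aobj) i (e : i + 0 = i) (f : ahom X Y i) :
  acomp e f (aid X) = f.
Proof.
apply: ahom_ext => c a; rewrite /acomp (bigD1 a) //= big1 => [|b hb].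
  by rewrite addr0 /aid adeltaxx comp1r.
by rewrite /aid adelta_neq 1?eq_sym // (lin0 (comp_linr _ _)).
Qed.

(* The dg category A(C). *)
Program Definition dgA : dgCat :=
  (@DgCat aobj ahom aid acomp _ _ _ acomp1l acomp1r _ _).
Next Obligation.
move=> X Y Z i j k e f a g g'; apply: ahom_ext => c b.
rewrite -[RHS]/(a *: acomp e g f c b + acomp e g' f c b) /acomp.
rewrite scaler_sumr -big_split /=.
by apply: eq_bigr => d _; rewrite -comp_linl.
Qed.
Next Obligation.
move=> X Y Z i j k e g a f f'; apply: ahom_ext => c b.
rewrite -[RHS]/(a *: acomp e g f c b + acomp e g f' c b) /acomp.
rewrite scaler_sumr -big_split /=.
by apply: eq_bigr => d _; rewrite -comp_linr.
Qed.
Next Obligation.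
move=> W X Y Z i j k ij jk l e1 e2 e3 e4 h g f; apply: ahom_ext => d a.
rewrite /acomp.
under eq_bigr do rewrite (lin_sum (comp_linl _ _)).
rewrite exchange_big /=; apply: eq_bigr => c _.
rewrite (lin_sum (comp_linr _ _)); apply: eq_bigr => b _.
exact: compA.
Qed.
Next Obligation.
move=> X i e; apply: ahom_ext => c a; rewrite /= /ahom_dd /aid.
case: (eqVneq a c) => [->|h]; first by rewrite adeltaxx dd_idm.
by rewrite adelta_neq // (lin0 (dd_lin _)).
Qed.
Next Obligation.
move=> X Y Z i j k i' j' l e e' ei e1 ej e2 g f; apply: ahom_ext => c a.
rewrite -[RHS]/(acomp e1 (ahom_dd ei g) f c a +
  (-1) ^+ (pairing io i) *: acomp e2 g (ahom_dd ej f) c a) /= /ahom_dd /acomp.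
rewrite (lin_sum (dd_lin _)) scaler_sumr -big_split /=.
by apply: eq_bigr => b _; apply: dd_comp.
Qed.

Definition aone (X : C) : dgA := @AObj unit_idx (fun=> X).
Definition amor (X Y : C) l (f : hom X Y l) : hom (aone X) (aone Y) l :=
  fun _ _ => f.
Definition aentry (X Y : C) l (f : hom (aone X) (aone Y) l) : hom X Y l :=
  f tt tt.

Definition ains (X : aobj) (a : aidx X) : hom (aone (abase a)) (X : dgA) 0 :=
  fun b _ => adelta b a.
Definition aproj (X : aobj) (a : aidx X) : hom (X : dgA) (aone (abase a)) 0 :=
  fun _ b => adelta a b.

End Sums.

#[global] Arguments ains {C X} a.
#[global] Arguments aproj {C X} a.

Section Twisted.
Variable C : dgCat.

Record twobj := TwObj {
  tbase : C;
  twist : hom tbase tbase io;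
  twistP : dd erefl twist + comp erefl twist twist = 0 }.

Lemma deg_twl i j : i + io = j -> io + i = j :> Gam.
Proof. by rewrite addrC. Qed.

Definition twhom_dd (X Y : twobj) i j (e : i + io = j)
    (f : hom (tbase X) (tbase Y) i) : hom (tbase X) (tbase Y) j :=
  dd e f + comp (deg_twl e) (twist Y) f -
  (-1) ^+ (pairing io i) *: comp e f (twist X).

Lemma twhom_dd_lin (X Y : twobj) i j (e : i + io = j) :
  linear (@twhom_dd X Y i j e).
Proof.
apply: lin_add; last by apply: lin_opp; apply: lin_scale; apply: comp_linl.
by apply: lin_add; [apply: dd_lin|apply: comp_linr].
Qed.

Lemma twhom_dd_dd (X Y : twobj) i j k (e : i + io = j) (e' : j + io = k) f :
  @twhom_dd X Y j k e' (twhom_dd e f) = 0.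
Proof.
rewrite /twhom_dd.
set a := twist X; set b := twist Y.
have h1 : io + io + i = k by rewrite -e' -e addrC addrA.
have h2 : io + j = k by rewrite addrC.
have h3 : j + io = k by [].
have h4 : i + (io + io) = k by rewrite -e' -e addrA.
have Eb : dd erefl b = - comp erefl b b.
  by apply/eqP; rewrite -addr_eq0; apply/eqP; apply: twistP.
have Ea : dd erefl a = - comp erefl a a.
  by apply/eqP; rewrite -addr_eq0; apply/eqP; apply: twistP.
have hj : pairing io j = ~~ pairing io i by rewrite -e !pairingE addbT.
rewrite (linB (dd_lin _)) (linD (dd_lin _)) (linZ (dd_lin _)) dd_dd add0r.
rewrite (linB (comp_linr _ _)) (linD (comp_linr _ _)) (linZ (comp_linr _ _)).
rewrite (linB (comp_linl _ _)) (linD (comp_linl _ _)) (linZ (comp_linl _ _)).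
rewrite (dd_comp _ _ erefl h1 e (deg_twl e')) (dd_comp _ _ e e' erefl h4) Eb Ea.
rewrite (linN (comp_linl _ _)) (linN (comp_linr _ _)).
rewrite (compA erefl h1 (deg_twl e) (deg_twl e')) (compA e e' erefl h4).
rewrite (compA (deg_twl e) e' e (deg_twl e')) pairing_io expr1 scaleN1r hj.
set x1 := comp _ b (dd _ f); set x2 := comp _ (dd _ f) a.
set x3 := comp _ b (comp _ b f); set x4 := comp _ b (comp _ f a).
set x5 := comp _ f _.
have key y z w : - x3 - x1 + y + (x1 + x3 + z) + w = y + z + w.
  by rewrite -opprD (addrC x3) addrACA addNr add0r.
case: pairing; rewrite /= ?expr0 ?expr1 ?scale1r ?scaleN1r.
  by rewrite !opprK key (addrAC x2) subrr.
by rewrite key -opprD opprK (addrAC x2) (addrAC x2) (addrAC x2) addNr.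
Qed.

Definition twhom (X Y : twobj) : dgMod :=
  @DgMod (fun l => hom (tbase X) (tbase Y) l : lmodType K)
    (@twhom_dd X Y) (@twhom_dd_lin X Y) (@twhom_dd_dd X Y).

Lemma tw_key (V : zmodType) (x1 x2 x3 x4 x5 : V) :
  x1 + x2 + x3 - x5 = x1 + x3 - x4 + (x2 + x4 - x5).
Proof.
by rewrite (addrAC x1 x2) (addrC x2 x4) !addrA subrK.
Qed.

(* The dg category Tw(C). *)
Program Definition dgTw : dgCat :=
  (@DgCat twobj twhom (fun X => idm (tbase X))
  (fun X Y Z i j k e g f => comp e g f) _ _ _ _ _ _ _).
Next Obligation.
by move=> *; apply: comp_linl.
Qed.
Next Obligation.
by move=> *; apply: comp_linr.
Qed.
Next Obligation.
by move=> *; apply: compA.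
Qed.
Next Obligation.
by move=> *; apply: comp1l.
Qed.
Next Obligation.
by move=> *; apply: comp1r.
Qed.
Next Obligation.
move=> X i e; rewrite /= /twhom_dd dd_idm pairing0r expr0 scale1r add0r.
have ei : io = i by rewrite -e add0r.
by case: _ / ei e => e; rewrite comp1l comp1r subrr.
Qed.
Next Obligation.
move=> X Y Z i j k i' j' l e e' ei e1 ej e2 g f; rewrite /= /twhom_dd.
set a := twist X; set b := twist Y; set c := twist Z.
rewrite (dd_comp e e' ei e1 ej e2).
rewrite (linB (comp_linl _ _)) (linD (comp_linl _ _)) (linZ (comp_linl _ _)).
rewrite (linB (comp_linr _ _)) (linD (comp_linr _ _)) (linZ (comp_linr _ _)).
rewrite -(compA (deg_twl ei) e1 e (deg_twl e')).
rewrite (compA ei e1 (deg_twl ej) e2) (compA e e' ej e2).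
have -> : pairing io k = pairing io i (+) pairing io j by rewrite -e pairingDr.
rewrite !scalerBr !scalerDr !sgrD.
exact: tw_key.
Qed.

End Twisted.

(* The full subcategory on the objects satisfying [P]. *)
Section Full.
Variables (D : dgCat) (P : D -> Prop).

Program Definition dgFull : dgCat :=
  (@DgCat {X : D | P X} (fun X Y => hom (sval X) (sval Y))
  (fun X => idm (sval X)) (fun X Y Z i j k e g f => comp e g f) _ _ _ _ _ _ _).
Next Obligation.
by move=> *; apply: comp_linl.
Qed.
Next Obligation.
by move=> *; apply: comp_linr.
Qed.
Next Obligation.
by move=> *; apply: compA.
Qed.
Next Obligation.
by move=> *; apply: comp1l.
Qed.
Next Obligation.
by move=> *; apply: comp1r.
Qed.
Next Obligation.
by move=> *; apply: dd_idm.
Qed.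
Next Obligation.
by move=> *; apply: dd_comp.
Qed.

End Full.

Section Pretr.
Variable C : dgCat.

(* One-sided: strictly lower triangular for some partial order [le]. *)
Definition one_sided (T : dgTw (dgA (dgS C))) : Prop :=
  let A := aidx (tbase T) in
  exists le : rel A,
    [/\ reflexive le, antisymmetric le, transitive le &
      forall a b : A, ~~ (le b a && (a != b)) -> twist T a b = 0].

Definition pretr : dgCat := dgFull one_sided.

(* X |-> q^0 X, as a one-term sum with zero twist. *)
Program Definition emb_tw (X : C) : dgTw (dgA (dgS C)) :=
  (@TwObj (dgA (dgS C)) (@aone (dgS C) (SObj 0 X)) 0 _).
Next Obligation.
by move=> X; rewrite (lin0 (dd_lin _)) (lin0 (comp_linl _ _)) addr0.
Qed.

Lemma emb_one_sided (X : C) : one_sided (emb_tw X).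
Proof. by exists (fun _ _ => true); split=> // -[] []. Qed.

Definition emb_obj (X : C) : pretr := exist one_sided (emb_tw X) (emb_one_sided X).

Lemma deg_s0 l : l = l + 0 - 0 :> Gam.
Proof. by rewrite addr0 subr0. Qed.

Definition emb_hom (X Y : C) l (f : hom X Y l) :
    hom (emb_obj X) (emb_obj Y) l :=
  @amor (dgS C) (SObj 0 X) (SObj 0 Y) l (gcast (deg_s0 l) f).

(* The inverse of [emb_hom], by which morphisms of P between objects of C
   are regarded as morphisms of C. *)
Definition unemb_hom (X Y : C) l (f : hom (emb_obj X) (emb_obj Y) l) :
    hom X Y l :=
  gcast (esym (deg_s0 l)) (@aentry (dgS C) (SObj 0 X) (SObj 0 Y) l f).

Lemma emb_homK (X Y : C) l : cancel (@emb_hom X Y l) (@unemb_hom X Y l).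
Proof.
move=> f; rewrite /unemb_hom /aentry /emb_hom /amor.
by case: _ / (deg_s0 l).
Qed.

Lemma unemb_homK (X Y : C) l : cancel (@unemb_hom X Y l) (@emb_hom X Y l).
Proof.
move=> f; apply: (@ahom_ext (dgS C)) => -[] []; rewrite /unemb_hom /emb_hom /amor /aentry.
move: (f tt tt) => {f}; rewrite /= /shom_gr /=; move: (deg_s0 l).
by move: (l + 0 - 0) => l' e x; case: _ / e x.
Qed.

Program Definition emb : dgFun C pretr :=
  (@DgFun C pretr emb_obj emb_hom _ _ _ _).
Next Obligation.
move=> X Y i a f g; apply: (@ahom_ext (dgS C)) => b c.
by rewrite /emb_hom /amor gcast_lin.
Qed.
Next Obligation.
move=> X; apply: (@ahom_ext (dgS C)) => -[] [].
rewrite /emb_hom /amor /= /aid adeltaxx /= /sid /=.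
by congr gcast; apply: eq_irrelevance.
Qed.
Next Obligation.
move=> X Y Z i j k e g f; apply: (@ahom_ext (dgS C)) => -[] [].
rewrite -[RHS]/(\sum_(b : unit_idx)
   @scomp C (SObj 0 X) (SObj 0 Y) (SObj 0 Z) i j k e
     (gcast (deg_s0 i) g) (gcast (deg_s0 j) f)).
rewrite (big_pred1 tt); last by case.
by rewrite /scomp (comp_cast (deg_s0 i) (deg_s0 j) (deg_s0 k) e).
Qed.
Next Obligation.
move=> X Y i j e f; apply: (@ahom_ext (dgS C)) => -[] [].
rewrite /= /twhom_dd (lin0 (comp_linl _ _)) (lin0 (comp_linr _ _)) addr0 scaler0 subr0.
rewrite /= /ahom_dd /emb_hom /amor /= /shom_dd /= pairing0r expr0 scale1r.
by rewrite (dd_cast _ (deg_s0 j) e).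
Qed.

End Pretr.

(* Data of an object X = tw_alpha (sum_(a in A) q^(i_a) X_a) of Pretr(C). *)
Section PretrObj.
Variables (C : dgCat) (X : pretr C).

Definition pidx : fidx := aidx (tbase (sval X)).
Definition pdeg (a : pidx) : Gam := sdeg (abase a).
Definition pterm (a : pidx) : C := sbase (abase a).

(* The twist as a degree [io] endomorphism of X in Pretr(C). *)
Definition ptwist : hom X X io := twist (sval X).

Lemma deg_phi i : 0 = i + 0 - i :> Gam.
Proof. by rewrite addr0 subrr. Qed.

Lemma deg_phiV i : 0 = - i + i - 0 :> Gam.
Proof. by rewrite addNr subr0. Qed.

(* phi_(Y,i) and its inverse, as morphisms of S(C). *)
Definition phi (Y : C) (i : Gam) : @hom (dgS C) (SObj 0 Y) (SObj i Y) i :=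
  gcast (deg_phi i) (idm Y).
Definition phiV (Y : C) (i : Gam) : @hom (dgS C) (SObj i Y) (SObj 0 Y) (- i) :=
  gcast (deg_phiV i) (idm Y).

Definition sigma (a : pidx) : hom (emb_obj (pterm a)) X (pdeg a) :=
  @comp (dgA (dgS C)) (aone (SObj 0 (pterm a) : dgS C)) (aone (abase a)) (tbase (sval X))
    0 (pdeg a) (pdeg a) (add0r _)
    (ains a) (amor (phi (pterm a) (pdeg a))).

Definition proj (a : pidx) : hom X (emb_obj (pterm a)) (- pdeg a) :=
  @comp (dgA (dgS C)) (tbase (sval X)) (aone (abase a)) (aone (SObj 0 (pterm a) : dgS C))
    (- pdeg a) 0 (- pdeg a) (addr0 _)
    (amor (phiV (pterm a) (pdeg a))) (aproj a).

End PretrObj.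

#[global] Arguments ptwist {C} X.
#[global] Arguments sigma {C X} a.
#[global] Arguments proj {C X} a.

Section Xi.
Variable C : dgCat.
Local Notation P := (pretr C).

(* pi_a o f o sigma_b, regarded as a morphism of C. *)
Definition hmor (X Y : P) k (f : hom Y X k) (a : pidx X) (b : pidx Y) :
    hom (pterm b) (pterm a) (- pdeg a + k + pdeg b) :=
  unemb_hom (comp erefl (comp erefl (proj a) f) (sigma b)).

(* A pair (n_u, (a_0, ..., a_(n_u)) in A_u^(n_u + 1)) is encoded by the head
   a_0 and the tail, n_u being the size of the tail. *)
Definition blk (X : P) : choiceType := (pidx X * seq (pidx X))%type.

(* The pairs (n, a): one block for each of X_0, ..., X_r. *)
Fixpoint xidx (X Z : P) (c : chain X Z) : choiceType :=
  match c with
  | cnil X0 => blk X0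
  | ccons X0 _ _ _ _ c' => (blk X0 * xidx c')%type
  end.

(* a_0 *)
Definition xfst (X Z : P) (c : chain X Z) : xidx c -> pidx X :=
  match c in chain X0 Z0 return xidx c -> pidx X0 with
  | cnil _ => fun w => w.1
  | ccons _ _ _ _ _ _ => fun w => w.1.1
  end.

(* a_s *)
Fixpoint xlst (X Z : P) (c : chain X Z) : xidx c -> pidx Z :=
  match c in chain X0 Z0 return xidx c -> pidx Z0 with
  | cnil _ => fun w => last w.1 w.2
  | ccons _ _ _ _ _ c' => fun w => xlst w.2
  end.

(* n_0, ..., n_r *)
Fixpoint xcount (X Z : P) (c : chain X Z) : xidx c -> seq nat :=
  match c return xidx c -> seq nat with
  | cnil _ => fun w => [:: size w.2]
  | ccons _ _ _ _ _ c' => fun w => size w.1.2 :: xcount w.2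
  end.

(* |f_1|, ..., |f_r| *)
Fixpoint cdegs (X Z : P) (c : chain X Z) : seq Gam :=
  if c is ccons _ _ _ k _ c' then k :: cdegs c' else [::].

(* The h_v inside one block (a, s), followed by [t]. *)
Fixpoint twist_chain (X : P) (a : pidx X) (s : seq (pidx X)) (Z : C) :
    chain (pterm (last a s)) Z -> chain (pterm a) Z :=
  match s return chain (pterm (last a s)) Z -> chain (pterm a) Z with
  | [::] => fun t => t
  | b :: s' => fun t => ccons (hmor (ptwist X) a b) (@twist_chain X b s' Z t)
  end.

(* h_1, ..., h_s *)
Fixpoint hchain (X Z : P) (c : chain X Z) :
    forall w : xidx c, chain (pterm (xfst w)) (pterm (xlst w)) :=
  match c in chain X0 Z0
    return forall w : xidx c, chain (pterm (xfst w)) (pterm (xlst w)) with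
  | cnil X0 => fun w => @twist_chain X0 w.1 w.2 _ (cnil (pterm (last w.1 w.2)))
  | ccons X0 Y0 Z0 k f c' => fun w =>
      @twist_chain X0 w.1.1 w.1.2 _
        (ccons (hmor f (last w.1.1 w.1.2) (xfst w.2)) (hchain w.2))
  end.

(* The exponent sgn; Booleans are coerced to 0 and 1. *)
Definition xsgn (X Z : P) (c : chain X Z) (w : xidx c) : nat :=
  let r := clen c in
  let n u := nth 0 (xcount w) u in
  let N := (\sum_(0 <= u < r.+1) n u)%N in
  let fdeg u := nth 0 (cdegs c) u.-1 in
  ((r + N) * pairing io (pdeg (xfst w)) + 'C(N.+1, 2)
   + \sum_(0 <= u < r.+1) (r - u) * n u
   + \sum_(1 <= u < r.+1) \sum_(u <= u' < r.+1) pairing io (fdeg u) * n u')%N.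

(* P (x)_C Bar(C) (x)_C P *)
Definition pbarp : bimod P P :=
  tens true (tens true (reg (fun_id P) (emb C)) (bar C)) (reg (emb C) (fun_id P)).

Lemma twist_chain_deg (X : P) (a : pidx X) s (Z : C)
    (t : chain (pterm (last a s)) Z) k :
  cdeg (twist_chain t) k + io *+ clen t =
  - pdeg a + pdeg (last a s) + cdeg t k + io *+ clen (twist_chain t).
Proof.
elim: s a t => [|b s IH] a t /=; first by rewrite addNr add0r.
rewrite -addrA IH mulrS !addrA; congr (_ + _).
rewrite -!addrA; congr (_ + _); rewrite !addrA.
by rewrite addrK addrC !addrA addrC !addrA.
Qed.

Lemma hchain_key (A i n c a l k f B T D z : Gam) :
  A + (i + n) = - a + l + (- l + k + f + B) + T ->
  B + c = - f + D + z + n -> A + (i + c) = - a + (k + D) + z + T.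
Proof.
move=> H1 H2; apply: (addIr n).
have -> : A + (i + c) + n = A + (i + n) + c by rewrite !addrA (addrAC _ c).
rewrite H1.
have -> : - a + l + (- l + k + f + B) + T + c = - a + k + f + (B + c) + T.
  by rewrite !addrA addrK (addrAC _ T c).
by rewrite H2 !addrA addrK (addrAC _ n).
Qed.

Lemma hchain_deg (X Z : P) (c : chain X Z) (w : xidx c) :
  cdeg (hchain w) 0 + io *+ clen c =
  - pdeg (xfst w) + cdeg c 0 + pdeg (xlst w) + io *+ clen (hchain w).
Proof.
elim: c w => [X0|X0 Y0 Z0 k f c IH] w.
  have := @twist_chain_deg X0 w.1 w.2 _ (cnil (pterm (last w.1 w.2))) 0.
  by rewrite /= !addr0.
have := @twist_chain_deg X0 w.1.1 w.1.2 _
  (ccons (hmor f (last w.1.1 w.1.2) (xfst w.2)) (hchain w.2)) 0.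
rewrite /= !mulrS => H; apply: hchain_key H (IH w.2).
Qed.

Lemma deg_xbar (X Z : P) (c : chain X Z) (w : xidx c) :
  0 + cdeg (hchain w) 0 =
  (cdeg (hchain w) 0 - io *+ clen (hchain w)) + io *+ clen (hchain w).
Proof. by rewrite add0r subrK. Qed.

Lemma deg_xterm (X Z : P) (c : chain X Z) (w : xidx c) l :
  0 + cdeg c 0 = l + io *+ clen c ->
  pdeg (xfst w) + (cdeg (hchain w) 0 - io *+ clen (hchain w)) - pdeg (xlst w)
  = l.
Proof.
move=> e; apply: (addIr (io *+ clen c)); rewrite -e add0r.
set B := cdeg _ 0; set n := _ *+ clen (hchain w); set z := pdeg (xlst w).
have -> : pdeg (xfst w) + (B - n) - z + io *+ clen c =
    pdeg (xfst w) + (B + io *+ clen c) - n - z.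
  by rewrite !addrA (addrAC _ (- z)) (addrAC _ (- n)).
by rewrite hchain_deg !addrA subrr add0r !addrK.
Qed.

(* sigma_(a_0) . [id, h_1, ..., h_s, id] . pi_(a_s) *)
Definition xterm (X Z : P) (c : chain X Z) l
    (e : 0 + cdeg c 0 = l + io *+ clen c) (w : xidx c) : pbarp X Z l :=
  telt true (deg_xterm w e)
    (telt true erefl
      (sigma (xfst w) : reg (fun_id P) (emb C) X (pterm (xfst w)) _)
      (bar_elt (idm _) (hchain w) (idm _) (deg_xbar w)) : tens true _ _ X _ _)
    (proj (xlst w) : reg (emb C) (fun_id P) (pterm (xlst w)) Z _).

End Xi.

End Dg.

(* Main.v *)
From mathcomp Require Import all_boot all_algebra.
From mathcomp Require Import boolp classical_sets fsbigop zify.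
Require Import Defs.

(** The bar complex of a dg category resolves the diagonal bimodule, and the target of
Xi resolves the diagonal bimodule of P = Pretr(C) as well; Xi is a comparison map
between the two resolutions, and the content of the theorem is that the comparison map
can be made explicit.

A resolution is recorded as a right-linear contraction (record [contraction]): a
homotopy s of degree -io with ds + sd = 1 - p, where p(f s(x)) = 0 for every left
multiplication by f. For Bar(D), s(x) = [1, x] and p[f, g] = [1, fg]
([bar_contraction]). Given a contraction (s, p) of a bimodule W, a closed bimodule map
theta from Bar(D) to W with p theta = 0, and closed elements u_X with p(f u) = +-u f,
the equations H[1, 1] = s theta[1, 1] + u and H[1, x] = s(theta[1, x] +- H(x)) define
a bimodule map H with differential theta ([comparison], [comparison_diff]).

An object X of P is a finite sum of shifts of objects of C, deformed by its twist
alpha. A contraction s of a left C-module N gives on P (x)_C N the operator S(g (x) x)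
= sum_a +-sigma_a (x) s(pi_a g x). Without the twist S would be a contraction; because
of d(sigma_a) = alpha sigma_a it satisfies instead dS + Sd = 1 - p0 + alpha S + S
alpha ([spread_htp_dd]). As alpha is strictly triangular, S alpha is nilpotent, and by
the perturbation lemma ([perturbation]) (1 + S alpha)^-1 S is a contraction. Apply
this to N = Bar(C) and tensor with P on the right: the target of Xi is contracted, and
the elements u_X = sum_a (1 + S alpha)^-1 (sigma_a (x) [1, 1]) (x) pi_a satisfy the
hypotheses of the comparison theorem. Taking theta = 0 yields Xi ([Xi_map]), with
Xi[1, 1] = u and Xi[1, x] = (1 + S alpha)^-1 S Xi(x).

Expanding the geometric series gives the sum of the theorem: every factor S alpha
inserts one more entry pi alpha sigma into the bar, every step of the recursion
inserts one entry pi f sigma, and the signs obey the same recursion ([gxsgn_cons],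
[Xi_map_elt]). The words that are too long contribute zero since their entries lower a
height function, so the sum is finite.

The homotopy inverse Psi extends the inclusion of Bar(C) into Bar(P) to the target of
Xi by the actions of P. Nothing is perturbed on objects of C, whence Xi Psi = 1
exactly ([Xi_Psi]); and p(Psi Xi - 1) = 0, so that the comparison theorem with theta =
Psi Xi - 1 and u = 0 produces a homotopy ([Psi_Xi]).

All this uses only a few properties of P, which are collected in the record [envelope]
and verified for Pretr(C) in [pretr_envelope]. *)

Set Implicit Arguments.
Unset Strict Implicit.
Unset Printing Implicit Defensive.
Import GRing.Theory.
Local Open Scope ring_scope.

(** * Equations between degrees *)

Section ZmodReflection.
Variable V : zmodType.

(** Equations between degrees hold in every abelian group, so it suffices to compare
the integer coefficients of the atoms on both sides. *)
Inductive zexpr :=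
  | ZVar of nat
  | ZAdd of zexpr & zexpr
  | ZOpp of zexpr
  | ZZero.

Fixpoint zeval (env : seq V) (e : zexpr) : V :=
  match e with
  | ZVar n => nth 0 env n
  | ZAdd a b => zeval env a + zeval env b
  | ZOpp a => - zeval env a
  | ZZero => 0
  end.

Fixpoint zcoef (k : nat) (e : zexpr) : int :=
  match e with
  | ZVar n => if n == k then Posz 1 else Posz 0
  | ZAdd a b => zcoef k a + zcoef k b
  | ZOpp a => - zcoef k a
  | ZZero => Posz 0
  end.

Lemma zeval_coef env e :
  zeval env e = \sum_(k < size env) nth 0 env k *~ zcoef k e.
Proof.
elim: e => [n|a IHa b IHb|a IHa|] /=.
- case: (ltnP n (size env)) => hn.
    rewrite (bigD1 (Ordinal hn)) //= eqxx mulr1z big1 ?addr0 // => i /negPf hi.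
    by rewrite eq_sym; move: hi; rewrite -val_eqE /= => ->; rewrite mulr0z.
  rewrite nth_default // big1 // => i _; case: eqP => [h|]; last by rewrite mulr0z.
  by move: (ltn_ord i); rewrite -h ltnNge hn.
- by rewrite IHa IHb -big_split /=; apply: eq_bigr => i _; rewrite mulrzDr.
- by rewrite IHa -sumrN; apply: eq_bigr => i _; rewrite mulrNz.
- by rewrite big1 // => i _; rewrite mulr0z.
Qed.

Lemma zeval_eq env a b :
  all (fun k => zcoef k a == zcoef k b) (iota 0 (size env)) ->
  zeval env a = zeval env b.
Proof.
move/allP=> h; rewrite !zeval_coef; apply: eq_bigr => k _.
by congr (_ *~ _); apply/eqP/h; rewrite mem_iota add0n /=.
Qed.

Lemma eq_shift (a b x y : V) : a = b -> x + b = y + a -> x = y.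
Proof. by move=> ->; apply: addIr. Qed.

End ZmodReflection.

(** The second branch identifies atoms which differ only in the way their algebraic
structures are inferred. *)
Ltac zsame x y :=
  match goal with
  | _ => constr_eq x y
  | _ => lazymatch x with ?f _ => lazymatch y with ?g _ => unify x y end end
  end.

(** The idle match on the goal lets a tactic run inside an expression that returns a
term. *)
Ltac zindex x l :=
  match l with
  | ?y :: _ => let _ := match goal with _ => zsame x y end in constr:(0%N)
  | _ :: ?t => let n := zindex x t in constr:(n.+1)
  end.

Ltac zmember x l :=
  match l with
  | ?y :: _ => zsame x y
  | _ :: ?t => zmember x t
  end.

Ltac zinsert x l :=
  match l with
  | _ => let _ := match goal with _ => zmember x l end in l
  | _ => constr:(x :: l)
  end.

Ltac zatoms t l :=
  match t with
  | (?a + ?b)%R => let l1 := zatoms a l in zatoms b l1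
  | (- ?a)%R => zatoms a l
  | 0%R => l
  | _ => zinsert t l
  end.

Ltac zreify t l :=
  match t with
  | (?a + ?b)%R =>
      let ea := zreify a l in let eb := zreify b l in constr:(ZAdd ea eb)
  | (- ?a)%R => let ea := zreify a l in constr:(ZOpp ea)
  | 0%R => constr:(ZZero)
  | _ => let n := zindex t l in constr:(ZVar n)
  end.

Ltac zmod :=
  match goal with
  | |- @eq ?T ?a ?b =>
      let l0 := constr:(@nil T) in
      let l1 := zatoms a l0 in
      let l := zatoms b l1 in
      let ea := zreify a l in
      let eb := zreify b l in
      apply: (@zeval_eq _ l ea eb); vm_compute; reflexivity
  end.

(** Substituting the equations of the context leaves an identity of abelian
groups. *)
Ltac deg := intros; try subst; rewrite ?mulr0n ?mulrS; zmod.
Tactic Notation "degw" constr(h) :=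
  first [ apply: (eq_shift h); deg | apply: (eq_shift (esym h)); deg ].

(** * Signs and elementary tensors *)

Section Signs.
Variables (G : ground) (V : lmodType (gring G)).
Implicit Types (x y : V).

Lemma sgr0 x : (-1) ^+ false *: x = x.
Proof. by rewrite expr0 scale1r. Qed.

Lemma sgr1 x : (-1) ^+ true *: x = - x.
Proof. by rewrite expr1 scaleN1r. Qed.

End Signs.

Section TensorRules.
Variables (G : ground) (bal : bool) (D C E : dgCat G).
Variables (M : bimod D C) (N : bimod C E).
Local Notation T := (tens bal M N).

Lemma dd_telt X Y Z i j i' j' l l' (e' : l + io = l') (e : i + j = l)
    (ei : i + io = i') (e1 : i' + j = l') (ej : j + io = j') (e2 : i + j' = l')
    (m : M X Y i) (n : N Y Z j) :
  dd e' (telt bal e m n : T X Z l) =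
  telt bal e1 (dd ei m) n + (-1) ^+ (pairing io i) *: telt bal e2 m (dd ej n).
Proof. exact: tddE. Qed.

Lemma lact_telt X' X Y Z a i j i' l l' (e' : a + l = l') (e : i + j = l)
    (ei : a + i = i') (e1 : i' + j = l') (g : hom X X' a)
    (m : M X Y i) (n : N Y Z j) :
  lact e' g (telt bal e m n : T X Z l) = telt bal e1 (lact ei g m) n.
Proof. exact: tlactE. Qed.

Lemma ract_telt X Y Z Z' a i j j' l l' (e' : l + a = l') (e : i + j = l)
    (ej : j + a = j') (e1 : i + j' = l') (g : hom Z' Z a)
    (m : M X Y i) (n : N Y Z j) :
  ract e' (telt bal e m n : T X Z l) g = telt bal e1 m (ract ej n g).
Proof. exact: tractE. Qed.

Lemma tens_telt_ext X Z l (V : lmodType (gring G)) (f g : T X Z l -> V) :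
  linear f -> linear g ->
  (forall Y i j (e : i + j = l) (m : M X Y i) (n : N Y Z j),
     f (telt bal e m n) = g (telt bal e m n)) ->
  forall x, f x = g x.
Proof. exact: tens_ext. Qed.

End TensorRules.
#[global] Arguments dd_telt {G bal D C E M N X Y Z i j i' j' l l'} e' e ei e1 ej e2 m n.
#[global] Arguments lact_telt {G bal D C E M N X' X Y Z a i j i' l l'} e' e ei e1 g m n.
#[global] Arguments ract_telt {G bal D C E M N X Y Z Z' a i j j' l l'} e' e ej e1 g m n.

(** * Right-linear contractions *)

Section Contractions.
Variable G : ground.
Local Notation Gam := (gdeg G).

(** A contraction of M, as a complex of right modules, onto the image of the
augmentation [aug]. The left action is not respected: for a bar complex the homotopy
is x |-> [1, x]. What survives of left linearity is [aug_htp], the vanishing of the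
augmentation on all bars of positive length, and this is enough to build maps of
bimodules. *)
Record contraction (D E : dgCat G) (M : bimod D E) := Contraction {
  htp : forall X Z i j, i + io = j -> M X Z j -> M X Z i;
  aug : forall X Z i, M X Z i -> M X Z i;
  htp_lin : forall X Z i j (e : i + io = j), linear (@htp X Z i j e);
  aug_lin : forall X Z i, linear (@aug X Z i);
  htp_ract : forall X Z Z' i j a k l (e : i + io = j) (e1 : j + a = k)
      (e2 : l + io = k) (e3 : i + a = l) (m : M X Z j) (g : hom Z' Z a),
    htp e2 (ract e1 m g) = ract e3 (htp e m) g;
  aug_ract : forall X Z Z' j a k (e : j + a = k) (m : M X Z j) (g : hom Z' Z a),
    aug (ract e m g) = ract e (aug m) g;
  htp_dd : forall X Z i j k (e : i + io = j) (e' : j + io = k) (m : M X Z j),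
    dd e (htp e m) + htp e' (dd e' m) = m - aug m;
  aug_htp : forall X' X Z a i j k (e : i + io = j) (e1 : a + i = k)
      (f : hom X X' a) (m : M X Z j), aug (lact e1 f (htp e m)) = 0 }.

#[global] Arguments aug_lin {D E M} c {X Z i}.

Section Theory.
Variables (D E : dgCat G) (M : bimod D E) (k : contraction M).

Lemma aug_dd X Z i j (e : i + io = j) (m : M X Z i) :
  aug k (dd e m) = dd e (aug k m).
Proof.
have e0 : i - io + io = i by rewrite subrK.
have e1 : j + io = j + io by [].
(* both differences are d (htp (dd m)) *)
have /(congr1 (dd e)) := htp_dd k e0 e m.
rewrite (linD (dd_lin _)) dd_dd add0r (linB (dd_lin _)) => h.
have := htp_dd k e e1 (dd e m).
rewrite dd_dd (lin0 (htp_lin _ _)) addr0 h => /addrI.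
by move/oppr_inj ->.
Qed.

(** Modulo the image of [htp], m and [aug m] differ by d(htp m); moving f across d
leaves only terms f' (htp m), on which the augmentation vanishes. *)
Lemma aug_lact_aug X' X Z a i j (e : a + i = j) (f : hom X X' a) (m : M X Z i) :
  aug k (lact e f (aug k m)) = aug k (lact e f m).
Proof.
have e0 : i - io + io = i by rewrite subrK.
have -> : aug k m = m - (dd e0 (htp k e0 m) + htp k erefl (dd erefl m)).
  by rewrite htp_dd opprB addrC subrK.
rewrite (linB (lact_linr _ _)) (linD (lact_linr _ _)).
rewrite (linB (aug_lin _)) (linD (aug_lin _)) aug_htp addr0.
suff -> : aug k (lact e f (dd e0 (htp k e0 m))) = 0 by rewrite subr0.
have e1 : a + (i - io) = j - io by rewrite -e addrA.
have e2 : j - io + io = j by rewrite subrK.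
have e3 : a + io + (i - io) = j by deg.
have := dd_lact e1 e2 erefl e3 e0 e f (htp k e0 m).
move/(congr1 (@aug _ _ _ k _ _ _)).
rewrite aug_dd aug_htp (linD (aug_lin _)) aug_htp (linZ (aug_lin _)) (lin0 (dd_lin _))
  add0r.
by case: pairing; rewrite ?sgr0 ?sgr1 // => /esym/eqP; rewrite oppr_eq0 => /eqP.
Qed.

End Theory.
End Contractions.

(** * The contraction of the bar complex *)

Section Bar.
Variables (G : ground) (C : dgCat G).
Local Notation Gam := (gdeg G).

Lemma bar_bin_ext X Z l (V : lmodType (gring G)) (f g : bar C X Z l -> V) :
  linear f -> linear g ->
  (forall r (u : hompow C r.+1 X Z (l + io *+ r)), f (bin u) = g (bin u)) ->
  forall x, f x = g x.
Proof. exact: bar_ext. Qed.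

(** The element written [1, y]. *)
Definition bar1 r X Z i m (e : 0 + i = m + io *+ r) (y : hompow C r X Z i) :
    bar C X Z m :=
  bin (telt false e (idm X : regC C X X 0) y : hompow C r.+1 X Z (m + io *+ r)).

Lemma bar1_lin r X Z i m (e : 0 + i = m + io *+ r) : linear (@bar1 r X Z i m e).
Proof. by apply: (lin_app (@bin_lin _ _ _ _ _ _)); apply: telt_linr. Qed.

Lemma bar1_ract r X Z Z' i m a i' m' (e : 0 + i = m + io *+ r) (e1 : i + a = i')
    (e2 : 0 + i' = m' + io *+ r) (e3 : m + a = m') (y : hompow C r X Z i)
    (g : hom Z' Z a) :
  bar1 e2 (ract e1 y g) = ract e3 (bar1 e y : bar C X Z m) g.
Proof.
rewrite /bar1 [RHS]bar_ractE; congr bin.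
by rewrite /= (tractE (deg_bra r e3) g e e1 e2).
Qed.

Lemma deg_bar_htp (l l' : Gam) r : l' + io = l -> 0 + (l + io *+ r) = l' + io *+ r.+1.
Proof. by deg. Qed.

(** The homotopy x |-> [1, x]. *)
Definition bar_htp X Z l' l (e : l' + io = l) : bar C X Z l -> bar C X Z l' :=
  @dlift G (fun r => hompow C r.+1 X Z (l + io *+ r)) _
    (fun r u => bar1 (deg_bar_htp r e) u).

Lemma bar_htpE X Z l' l (e : l' + io = l) r (u : hompow C r.+1 X Z (l + io *+ r)) :
  bar_htp e (bin u : bar C X Z l) = bar1 (deg_bar_htp r e) u.
Proof. by apply: dliftE => r'; apply: bar1_lin. Qed.

Lemma bar_htp_lin X Z l' l (e : l' + io = l) : linear (@bar_htp X Z l' l e).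
Proof. by apply: dlift_lin => r'; apply: bar1_lin. Qed.

Lemma bar_htp_ract X Z Z' i j a k l (e : i + io = j) (e1 : j + a = k)
    (e2 : l + io = k) (e3 : i + a = l) (m : bar C X Z j) (g : hom Z' Z a) :
  bar_htp e2 (ract e1 m g) = ract e3 (bar_htp e m) g.
Proof.
move: m; apply: bar_bin_ext => [||r u].
- by apply: (lin_app (bar_htp_lin _)); apply: ract_linl.
- by apply: (lin_app (ract_linl _ _)); apply: bar_htp_lin.
rewrite [ract e1 _ _]bar_ractE !bar_htpE; exact: bar1_ract.
Qed.

Lemma deg_bar_aug (l : Gam) : 0 + (l + io *+ 0) = l + io *+ 0.
Proof. by rewrite add0r. Qed.

(** The augmentation [f, g] |-> [1, fg]; it is zero on longer bars. *)
Definition bar_aug_gen X Z l r : hompow C r.+1 X Z (l + io *+ r) -> bar C X Z l :=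
  if r is 0 return hompow C r.+1 X Z (l + io *+ r) -> bar C X Z l
  then fun u => bar1 (deg_bar_aug l) (bh (contr C 0) (deg_bar_aug l) u)
  else fun _ => 0.

Definition bar_aug X Z l : bar C X Z l -> bar C X Z l :=
  @dlift G (fun r => hompow C r.+1 X Z (l + io *+ r)) _ (@bar_aug_gen X Z l).

Lemma bar_aug_gen_lin X Z l r : linear (@bar_aug_gen X Z l r).
Proof.
case: r => [|r]; last exact: lin_zero.
by apply: (lin_app (@bar1_lin _ _ _ _ _ _)); apply: bh_lin.
Qed.

Lemma bar_augE X Z l r (u : hompow C r.+1 X Z (l + io *+ r)) :
  bar_aug (bin u : bar C X Z l) = bar_aug_gen u.
Proof. exact: dliftE (@bar_aug_gen_lin X Z l) _ _. Qed.

Lemma bar_aug_lin X Z l : linear (@bar_aug X Z l).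
Proof. exact: dlift_lin (@bar_aug_gen_lin X Z l). Qed.

Lemma bar_aug_ract X Z Z' j a k (e : j + a = k) (m : bar C X Z j) (g : hom Z' Z a) :
  bar_aug (ract e m g) = ract e (bar_aug m) g.
Proof.
move: m; apply: bar_bin_ext => [||r u].
- by apply: (lin_app (@bar_aug_lin _ _ _)); apply: ract_linl.
- by apply: (lin_app (ract_linl _ _)); apply: bar_aug_lin.
rewrite [ract e _ _]bar_ractE !bar_augE; case: r u => [|r] u.
  rewrite /bar_aug_gen (bh_ract _ _ _ (deg_bar_aug j) (deg_bra 0 e)).
  exact: bar1_ract.
by rewrite /bar_aug_gen (lin0 (ract_linl _ _)).
Qed.

Lemma bar_aug_htp X' X Z a i j k (e : i + io = j) (e1 : a + i = k)
    (f : hom X X' a) (m : bar C X Z j) : bar_aug (lact e1 f (bar_htp e m)) = 0.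
Proof.
move: m; apply: bar_bin_ext => [||r u].
- apply: (lin_app (@bar_aug_lin _ _ _)); apply: (lin_app (lact_linr _ _)).
  exact: bar_htp_lin.
- exact: lin_zero.
rewrite bar_htpE [lact _ _ _]bar_lactE (linZ (@bar_aug_lin _ _ _)) bar_augE.
by rewrite /bar_aug_gen scaler0.
Qed.

(** Composing the first two entries of [1, u] gives back u. *)
Lemma contr_bar1 n X Z i j l l' (e : 0 + l = l') (e0 : 0 + i = l) (e1 : 0 + i = j)
    (e2 : i = l') (e3 : 0 + j = l') (u : hompow C n.+1 X Z i) :
  bh (contr C n.+1) e (telt false e0 (idm X : regC C X X 0) u
     : hompow C n.+2 X Z l) =
  gcast e2 u - telt false e3 (idm X : regC C X X 0) (bh (contr C n) e1 u).
Proof.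
case: _ / e2 e e3 => e e3.
have e4 : 0 + i = i by rewrite add0r.
have := @Defs.nextE G C (hompow C n) (contr C n) X Z l i e X 0 i j e0 e4 e1 e3
  (idm X) u.
by rewrite lact1 /=; apply: etrans.
Qed.

End Bar.

Section BarContraction.
Variables (G : ground) (C : dgCat G).
Local Notation Gam := (gdeg G).

Lemma dd_bar1 r X Z i m i' m' (e : 0 + i = m + io *+ r) (e1 : i + io = i')
    (e2 : 0 + i' = m' + io *+ r) (e3 : m + io = m') (y : hompow C r X Z i) :
  dd e3 (bar1 e y : bar C X Z m) =
  (-1) ^+ r *: bar1 e2 (dd e1 y) +
  bar_contr e3 (telt false e (idm X : regC C X X 0) y : hompow C r.+1 X Z _).
Proof.
rewrite [LHS]bar_ddE; congr (_ *: _ + _); congr bin.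
have e4 : 0 + io + i = m' + io *+ r by rewrite -e2 -e1 !add0r addrC.
rewrite (dd_telt (deg_bd r e3) e erefl e4 e1 e2) pairing0r expr0 scale1r.
have -> : dd erefl (idm X : regC C X X 0) = 0 by exact: dd_idm.
by rewrite (lin0 (telt_linl _ _ _)) add0r.
Qed.

(** In d[1, x] the composition of the first two entries gives back x; all other terms
cancel against [1, dx], except in length zero, where the composition inside x remains
and is the augmentation. *)
Lemma bar_htp_dd X Z i j k (e : i + io = j) (e' : j + io = k) (m : bar C X Z j) :
  dd e (bar_htp e m) + bar_htp e' (dd e' m) = m - bar_aug m.
Proof.
move: m; apply: bar_bin_ext => [||r u].
- apply: lin_add; first by apply: (lin_app (dd_lin _)); apply: bar_htp_lin.
  by apply: (lin_app (bar_htp_lin _)); apply: dd_lin.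
- by apply: lin_add; [|apply: lin_opp; apply: bar_aug_lin].
rewrite bar_htpE (dd_bar1 _ (deg_bd r e') (deg_bar_htp r e')).
rewrite [X in bar_htp _ X]bar_ddE (linD (bar_htp_lin _)) (linZ (bar_htp_lin _)) bar_htpE.
set y := bar1 _ (dd _ u); rewrite exprS mulN1r scaleNr bar_augE [bar_contr e _]/bar_contr.
have e1 : 0 + (j + io *+ r) = j + io *+ r by rewrite add0r.
rewrite (contr_bar1 _ _ e1 erefl e1) [gcast _ _]/= (linB (@bin_lin _ _ _ _ _ _)).
case: r u y e1 => [|r] u y e1.
  rewrite [bar_contr _ _]/bar_contr (lin0 (bar_htp_lin _)).
  have -> : bar_aug_gen u = bar1 e1 (bh (contr C 0) e1 u) :> bar C X Z j.
    by rewrite /bar_aug_gen (eq_irrelevance e1 (deg_bar_aug j)).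
  rewrite /bar1 expr0 scale1r; zmod.
rewrite /bar_contr bar_htpE [bar_aug_gen _]/= subr0.
have -> : bar1 (deg_bar_htp r e') (bh (contr C r.+1) (deg_bc r e') u) =
    bar1 e1 (bh (contr C r.+1) e1 u) :> bar C X Z j.
  move: (deg_bar_htp r e') (deg_bc r e') (e1).
  have -> : k + io *+ r = j + io *+ r.+1 by deg.
  by move=> e2 e3 e4; rewrite (eq_irrelevance e2 e4) (eq_irrelevance e3 e4).
rewrite /bar1; zmod.
Qed.

Definition bar_contraction : contraction (bar C) :=
  Contraction (@bar_htp_lin G C) (@bar_aug_lin G C) (@bar_htp_ract G C) (@bar_aug_ract
    G C)
    bar_htp_dd (@bar_aug_htp G C).

Lemma deg_bar_unit : 0 + 0 = 0 + io *+ 0 :> Gam.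
Proof. by []. Qed.

(** The element written [1, 1]. *)
Definition bar_unit X : bar C X X 0 := bar1 deg_bar_unit (idm X : hompow C 0 X X 0).

Lemma bar1_ract_unit X Z i m (e : 0 + i = m + io *+ 0) (e1 : 0 + i = m)
    (y : hompow C 0 X Z i) : bar1 e y = ract e1 (bar_unit X) (y : hom Z X i).
Proof.
have e2 : 0 + i = i by rewrite add0r.
rewrite -(bar1_ract deg_bar_unit e2 e); congr bar1.
by rewrite /= /reg_ract /= comp1l.
Qed.

Lemma bar1_htp r X Z l m (e' : m + io = l) (e : 0 + (l + io *+ r) = m + io *+ r.+1)
  (y : hompow C r.+1 X Z (l + io *+ r)) : bar1 e y = bar_htp e' (bin y : bar C X Z l).
Proof. by rewrite bar_htpE (eq_irrelevance e (deg_bar_htp r e')). Qed.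

Lemma bin_telt r X Y Z i j l m (e : i + j = l + io *+ r)
    (e1 : i + m = l) (e2 : 0 + j = m + io *+ r) (f : hom Y X i)
    (y : hompow C r Y Z j) :
  bin (telt false e (f : regC C X Y i) y : hompow C r.+1 X Z _) =
  (-1) ^+ (odd r && pairing io i) *: lact e1 f (bar1 e2 y : bar C Y Z m) :> bar C X Z l.
Proof.
rewrite [lact e1 f _]bar_lactE sgr_mulb sgrD addbb sgr0; congr bin.
have e3 : i + 0 = i by rewrite addr0.
rewrite (lact_telt _ e2 e3 e); congr telt.
by rewrite /= /reg_lact /= comp1r.
Qed.

(** The bimodule Bar(C) is generated by the elements [1, 1] and [1, x], where x may be
taken shorter. *)
Lemma bar_ind (P : forall X Z l, bar C X Z l -> Prop) :
  (forall X Z l, P X Z l 0) ->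
  (forall X Z l a (x y : bar C X Z l), P _ _ _ x -> P _ _ _ y -> P _ _ _ (a *: x + y)) ->
  (forall X Y Z i j k l (e : i + j = k) (e1 : 0 + l = j) (g : hom Y X i)
     (y : hom Z Y l), P X Z k (lact e g (ract e1 (bar_unit Y) y))) ->
  (forall X Y Z i j k l (e : i + j = k) (e1 : j + io = l) (g : hom Y X i)
     (x : bar C Y Z l), P Y Z l x -> P X Z k (lact e g (bar_htp e1 x))) ->
  forall X Z l x, P X Z l x.
Proof.
move=> P0 PL P1 Ps X Z l.
have PZ (X' Z' : C) l' a (x : bar C X' Z' l') : P _ _ _ x -> P _ _ _ (a *: x).
  by move=> h; rewrite -[_ *: _]addr0; apply: PL.
suff Pb r : forall X Z l (u : hompow C r.+1 X Z (l + io *+ r)),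
    P X Z l (bin u : bar C X Z l).
  by elim/pres_ind => [|a x y Hx Hy|[r u]]; [exact: P0|exact: PL|exact: Pb].
elim: r => [|r IH] X' Z' l'.
all: elim/pres_ind => [|a x y Hx Hy|[Y i j e f y]];
  [by rewrite (lin0 (@bin_lin _ _ _ _ _ _)); apply: P0|by rewrite bin_lin; apply: PL|].
  have e1 : i + j = l' by degw e.
  have e2 : 0 + j = j + io *+ 0 by deg.
  apply: (eq_ind_r (P _ _ _) _ (bin_telt e e1 e2 f y)); apply: PZ.
  by rewrite (bar1_ract_unit _ (add0r j)); apply: P1.
have e0 : i + (j - io *+ r.+1) = l' by degw e.
have e2 : 0 + j = j - io *+ r.+1 + io *+ r.+1 by deg.
apply: (eq_ind_r (P _ _ _) _ (bin_telt e e0 e2 f y)); apply: PZ.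
move: e0 e2; set m := j - _ => e0 e2.
have ej : j = m + io + io *+ r by degw e2.
clearbody m; subst j.
by rewrite (bar1_htp erefl); apply: Ps; apply: IH.
Qed.

Lemma bar_aug_unit X Y Z i j k n (e : i + j = k) (e1 : 0 + n = j) (e2 : i + n = k)
    (e3 : 0 + k = k) (g : hom Y X i) (y : hom Z Y n) :
  bar_aug (lact e g (ract e1 (bar_unit Y) y)) = ract e3 (bar_unit X) (comp e2 g y).
Proof.
have e5 : 0 + n = j + io *+ 0 by rewrite addr0.
have e6 : i + n = k + io *+ 0 by rewrite addr0.
have e7 : 0 + k = k + io *+ 0 by rewrite addrC.
rewrite -(bar1_ract_unit e5).
have -> : lact e g (bar1 e5 y : bar C Y Z j) =
    bin (telt false e6 (g : regC C X Y i) (y : hompow C 0 Y Z n)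
      : hompow C 1 X Z _) :> bar C X Z k.
  by rewrite (bin_telt _ e e5) andFb sgr0.
rewrite bar_augE /bar_aug_gen [bh (contr C 0) _ _](mulE _ _ e6).
rewrite -(bar1_ract_unit e7).
have gen K (d : 0 + K = k + io *+ 0) (e' : i + n = K) :
    bar1 d (lact e' g (y : regC C Y Z n)) = bar1 e7 (comp e2 g y).
  have eK : K = k by rewrite -e'.
  move: d e'; rewrite eK => d e'.
  by rewrite (eq_irrelevance d e7) (eq_irrelevance e' e2).
exact: gen.
Qed.

Lemma bar_unit_dd X i (e : 0 + io = i) : dd e (bar_unit X) = 0.
Proof.
have h : 0 + i = i + io *+ 0 by rewrite addrC.
rewrite (dd_bar1 _ e h) [bar_contr _ _]/bar_contr addr0 expr0 scale1r.
by rewrite [dd _ _]dd_idm (lin0 (bar1_lin _)).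
Qed.

End BarContraction.

(** * The comparison theorem *)

Section BimDiff.
Variables (G : ground) (D E : dgCat G) (M N : bimod D E) (l : gdeg G).
Variable F : bimHom M N l.

Lemma bim_diff_lin X Y i i' j k (e1 : l + i = j) (e2 : j + io = k)
    (e3 : i + io = i') (e4 : l + i' = k) :
  linear (@bim_diff _ _ _ _ _ _ F X Y i i' j k e1 e2 e3 e4).
Proof.
apply: lin_add; first by apply: (lin_app (dd_lin _)); apply: bh_lin.
apply: lin_opp; apply: lin_scale.
by apply: (lin_app (bh_lin _ _)); apply: dd_lin.
Qed.

(** The differential of a bimodule map is again a bimodule map, so that it is
determined by its values on generators. *)
Lemma bim_diff_lact X' X Y a i i' j k n n' p p' (e : a + i = n)
    (e1 : l + n = p) (e2 : p + io = p') (e3 : n + io = n') (e4 : l + n' = p')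
    (f1 : l + i = j) (f2 : j + io = k) (f3 : i + io = i') (f4 : l + i' = k)
    (e5 : a + k = p') (g : hom X X' a) (m : M X Y i) :
  bim_diff F e1 e2 e3 e4 (lact e g m) =
  (-1) ^+ (pairing l a (+) pairing io a) *: lact e5 g (bim_diff F f1 f2 f3 f4 m).
Proof.
have h1 : a + j = p by deg.
have h2 : a + io + j = p' by deg.
have h3 : a + io + i = n' by deg.
have h4 : a + i' = n' by deg.
rewrite /bim_diff (bh_lact F e e1 f1 h1) (linZ (dd_lin _)).
rewrite (dd_lact h1 e2 erefl h2 f2 e5) (dd_lact e e3 erefl h3 f3 h4).
rewrite (linD (bh_lin _ _)) (linZ (bh_lin _ _)).
rewrite (bh_lact F h3 e4 f1 h2) (bh_lact F h4 e4 f4 e5).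
rewrite (linB (lact_linr _ _)) (linZ (lact_linr _ _)) !scalerDr !scalerN !sgrD.
rewrite !pairingE !(pairingC l io).
by case: (pairing l a); case: (pairing io a); case: (pairing io l);
  rewrite ?sgr0 ?sgr1; zmod.
Qed.

Lemma bim_diff_ract X Y Y' a i i' j k n n' p p' (e : i + a = n)
    (e1 : l + n = p) (e2 : p + io = p') (e3 : n + io = n') (e4 : l + n' = p')
    (f1 : l + i = j) (f2 : j + io = k) (f3 : i + io = i') (f4 : l + i' = k)
    (e5 : k + a = p') (m : M X Y i) (g : hom Y' Y a) :
  bim_diff F e1 e2 e3 e4 (ract e m g) = ract e5 (bim_diff F f1 f2 f3 f4 m) g.
Proof.
have h1 : j + a = p by deg.
have h2 : j + (a + io) = p' by deg.
have h3 : i + (a + io) = n' by deg.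
have h4 : i' + a = n' by deg.
rewrite /bim_diff (bh_ract F e e1 f1 h1).
rewrite (dd_ract h1 e2 f2 e5 erefl h2) (dd_ract e e3 f3 h4 erefl h3).
rewrite (linD (bh_lin _ _)) (linZ (bh_lin _ _)).
rewrite (bh_ract F h3 e4 f1 h2) (bh_ract F h4 e4 f4 e5).
rewrite (linB (ract_linl _ _)) (linZ (ract_linl _ _)) !scalerDr !sgrD.
have -> : pairing io j = pairing io l (+) pairing io i by rewrite -f1 !pairingE.
by case: (pairing io l); case: (pairing io i); rewrite ?sgr0 ?sgr1; zmod.
Qed.

End BimDiff.

Section Comparison.
Variables (G : ground) (D : dgCat G) (W : bimod D D) (kW : contraction W).
Local Notation Gam := (gdeg G).
Variables (l q : Gam) (elq : l + io = q).
Variable theta : bimHom (bar D) W q.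
Variable u : forall X, W X X l.
Section Step.
Variables (r : nat).
Variable h : forall X Z i j, l + i = j + io *+ r -> hompow D r X Z i -> W X Z j.

Lemma deg_step1 i1 i2 i j : i1 + i2 = i -> l + i = j + io *+ r ->
  i1 + (l + i2 - io *+ r) = j.
Proof. by move=> e e'; degw (etrans (congr1 (+%R l) e) e'). Qed.
Lemma deg_step2 i2 : l + i2 = (l + i2 - io *+ r) + io *+ r.
Proof. by deg. Qed.

(** The extension of h to words with one more entry on the left, by left linearity: f
(x) y |-> +-f h(y), where h(y) stands for the value at [1, y]. *)
Definition hstep_gen X Z i j (e : l + i = j + io *+ r) Y i1 i2 (e12 : i1 + i2 = i)
    (f : regC D X Y i1) (y : hompow D r Y Z i2) : W X Z j :=
  (-1) ^+ (pairing l i1 (+) odd r && pairing io i1) *: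
  lact (deg_step1 e12 e) (f : hom Y X i1) (h (deg_step2 i2) y).

Definition hstep X Z i j (e : l + i = j + io *+ r) :
    hompow D r.+1 X Z i -> W X Z j := tlift (hstep_gen e).

Hypothesis h_lin : forall X Z i j (e : l + i = j + io *+ r), linear (@h X Z i j e).
Hypothesis h_ract : forall X Z Z' i j a i' j' (e : l + i = j + io *+ r)
  (e1 : i + a = i') (e2 : l + i' = j' + io *+ r) (e3 : j + a = j')
  (y : hompow D r X Z i) (g : hom Z' Z a),
  h e2 (ract e1 y g) = ract e3 (h e y) g.

Section StepLin.
Variables (X Z : D) (i j : Gam) (e : l + i = j + io *+ r).

Lemma hstep_gen_l Y i1 i2 (e12 : i1 + i2 = i) (y : hompow D r Y Z i2) :
  linear (fun f : regC D X Y i1 => hstep_gen e e12 f y).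
Proof. by apply: lin_scale; apply: lact_linl. Qed.

Lemma hstep_gen_r Y i1 i2 (e12 : i1 + i2 = i) (f : regC D X Y i1) :
  linear (fun y : hompow D r Y Z i2 => hstep_gen e e12 f y).
Proof. by apply: lin_scale; apply: (lin_app (lact_linr _ _)); apply: h_lin. Qed.

Lemma hstep_lin : linear (@hstep X Z i j e).
Proof. by apply: tlift_lin; [exact: hstep_gen_l|exact: hstep_gen_r|]. Qed.

Lemma hstepE Y i1 i2 j' (e12 : i1 + i2 = i) (e1 : i1 + j' = j)
    (e2 : l + i2 = j' + io *+ r) (f : regC D X Y i1) (y : hompow D r Y Z i2) :
  hstep e (telt false e12 f y : hompow D r.+1 X Z i) =
  (-1) ^+ (pairing l i1 (+) odd r && pairing io i1) *:
  lact e1 (f : hom Y X i1) (h e2 y).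
Proof.
rewrite /hstep tliftE; [|exact: hstep_gen_l|exact: hstep_gen_r|by []].
rewrite /hstep_gen; congr (_ *: _).
move: (deg_step1 _ _) (deg_step2 _).
have -> : l + i2 - io *+ r = j' by degw e2.
by move=> a b; rewrite (eq_irrelevance a e1) (eq_irrelevance b e2).
Qed.

End StepLin.

Lemma hstep_lact X' X Z a i j i' j' (e : l + i = j + io *+ r) (e1 : a + i = i')
    (e2 : l + i' = j' + io *+ r) (e3 : a + j = j') (g : hom X X' a)
    (t : hompow D r.+1 X Z i) :
  hstep e2 (lact e1 g t) =
  (-1) ^+ (pairing l a (+) odd r && pairing io a) *: lact e3 g (hstep e t).
Proof.
move: t; apply: tens_telt_ext => [||Y i1 i2 e12 f y].
- by apply: (lin_app (hstep_lin _)); apply: lact_linr.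
- by apply: lin_scale; apply: (lin_app (lact_linr _ _)); apply: hstep_lin.
have h1 : a + i1 + i2 = i' by deg.
rewrite (lact_telt e1 e12 erefl h1).
have [m h2] : exists m, l + i2 = m + io *+ r by exists (l + i2 - io *+ r); deg.
have h3 : i1 + m = j by apply: (addIr (io *+ r)); rewrite -e -e12 -addrA -h2; deg.
have h4 : a + i1 + m = j' by rewrite -e3 -h3 addrA.
rewrite (hstepE _ _ h4 h2) (hstepE _ _ h3 h2) (linZ (lact_linr _ _)) sgrD.
rewrite [lact _ g f]/= /reg_lact /= (lactA erefl h4 h3 e3); congr (_ *: _).
rewrite !pairingE; congr (_ ^+ (nat_of_bool _)).
by case: (pairing l a); case: (pairing l i1); case: (pairing io a);
  case: (pairing io i1); case: (odd r).
Qed.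

Lemma hstep_ract X Z Z' i j a i' j' (e : l + i = j + io *+ r) (e1 : i + a = i')
    (e2 : l + i' = j' + io *+ r) (e3 : j + a = j') (t : hompow D r.+1 X Z i)
    (g : hom Z' Z a) :
  hstep e2 (ract e1 t g) = ract e3 (hstep e t) g.
Proof.
move: t; apply: tens_telt_ext => [||Y i1 i2 e12 f y].
- by apply: (lin_app (hstep_lin _)); apply: ract_linl.
- by apply: (lin_app (ract_linl _ _)); apply: hstep_lin.
have h1 : i1 + (i2 + a) = i' by deg.
rewrite (ract_telt e1 e12 erefl h1).
have [m h2] : exists m, l + i2 = m + io *+ r by exists (l + i2 - io *+ r); deg.
have h3 : i1 + m = j by apply: (addIr (io *+ r)); rewrite -e -e12 -addrA -h2; deg.
have h4 : l + (i2 + a) = m + a + io *+ r by degw h2.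
have h5 : i1 + (m + a) = j' by rewrite -e3 -h3 addrA.
rewrite (hstepE _ _ h5 h4) (hstepE _ _ h3 h2) (linZ (ract_linl _ _)).
by rewrite (h_ract h2 erefl h4 erefl) (lractA h3 e3 erefl h5).
Qed.

End Step.

Lemma deg_cmp1 r i : 0 + i = (i - io *+ r) + io *+ r :> Gam.
Proof. by deg. Qed.
Lemma deg_cmp2 r i j : l + i = j + io *+ r -> q + (i - io *+ r) = j + io.
Proof. by rewrite -elq => e; degw e. Qed.
Lemma deg_cmp3 i j : l + i = j + io *+ 0 -> l + i = j.
Proof. by move=> e; degw e. Qed.
Lemma deg_cmp4 r i j : l + i = j + io *+ r.+1 -> l + i = (j + io) + io *+ r.
Proof. by move=> e; degw e. Qed.

Definition htheta r X Z i j (e : l + i = j + io *+ r) (y : hompow D r X Z i) :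
  W X Z (j + io) := bh theta (deg_cmp2 e) (bar1 (deg_cmp1 r i) y : bar D X Z _).

(** The value at [1, y] of the comparison map, by recursion on the length of y. *)
Fixpoint cmp_bar1 r : forall X Z i j, l + i = j + io *+ r ->
    hompow D r X Z i -> W X Z j :=
  match r with
  | 0 => fun X Z i j e y =>
      htp kW erefl (htheta e y) + ract (deg_cmp3 e) (u X) (y : hom Z X i)
  | r'.+1 => fun X Z i j e y =>
      htp kW erefl (htheta e y +
        (-1) ^+ (pairing io l) *: hstep (@cmp_bar1 r') (deg_cmp4 e) y)
  end.

Lemma htheta_lin r X Z i j (e : l + i = j + io *+ r) : linear (@htheta r X Z i j e).
Proof. by apply: (lin_app (bh_lin _ _)); apply: bar1_lin. Qed.

Lemma hthetaE r X Z i j m j' (e : l + i = j + io *+ r) (e1 : 0 + i = m + io *+ r)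
    (e2 : q + m = j') (e3 : j + io = j') (y : hompow D r X Z i) :
  htp kW erefl (htheta e y) = htp kW e3 (bh theta e2 (bar1 e1 y : bar D X Z _)).
Proof.
case: _ / e3 e2 => e2; rewrite /htheta.
move: (deg_cmp2 e) (deg_cmp1 r i); have -> : i - io *+ r = m by degw e1.
by move=> a b; rewrite (eq_irrelevance a e2) (eq_irrelevance b e1).
Qed.

Lemma htheta_ract r X Z Z' i j a i' j' (e : l + i = j + io *+ r)
    (e1 : i + a = i') (e2 : l + i' = j' + io *+ r) (e3 : j + io + a = j' + io)
    (y : hompow D r X Z i) (g : hom Z' Z a) :
  htheta e2 (ract e1 y g) = ract e3 (htheta e y) g.
Proof.
have h : i - io *+ r + a = i' - io *+ r by deg.
rewrite /htheta (bar1_ract (deg_cmp1 r i) _ _ h).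
exact: bh_ract.
Qed.

Lemma cmp_bar1_props r :
  (forall X Z i j (e : l + i = j + io *+ r), linear (@cmp_bar1 r X Z i j e)) /\
  (forall X Z Z' i j a i' j' (e : l + i = j + io *+ r)
    (e1 : i + a = i') (e2 : l + i' = j' + io *+ r) (e3 : j + a = j')
    (y : hompow D r X Z i) (g : hom Z' Z a),
    cmp_bar1 e2 (ract e1 y g) = ract e3 (cmp_bar1 e y) g).
Proof.
elim: r => [|r [IHl IHr]]; split.
- move=> X Z i j e /=; apply: lin_add.
    by apply: (lin_app (htp_lin _ _)); apply: (@htheta_lin 0).
  exact: ract_linr.
- move=> X Z Z' i j a i' j' e e1 e2 e3 y g; rewrite [LHS]/= [cmp_bar1 _ _]/=.
  have h : j + io + a = j' + io by rewrite -e3 addrAC.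
  rewrite (linD (ract_linl _ _)) -(htp_ract _ _ h erefl).
  rewrite -(htheta_ract e e1 e2); congr (_ + _); symmetry; exact: ractA.
- move=> X Z i j e /=; apply: (lin_app (htp_lin _ _)); apply: lin_add.
    exact: (@htheta_lin r.+1).
  by apply: lin_scale; apply: hstep_lin.
move=> X Z Z' i j a i' j' e e1 e2 e3 y g.
have h : j + io + a = j' + io by rewrite -e3 addrAC.
rewrite [LHS]/= [cmp_bar1 _ _]/= -(htp_ract _ _ h erefl).
rewrite (linD (ract_linl _ _)) -(htheta_ract e e1 e2) (linZ (ract_linl _ _)).
by rewrite (hstep_ract _ _ (deg_cmp4 e) _ _ h).
Qed.

Lemma cmp_bar1_lin r X Z i j (e : l + i = j + io *+ r) : linear (@cmp_bar1 r X Z i j e).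
Proof. by case: (cmp_bar1_props r). Qed.

Lemma deg_H m j r : l + m = j -> l + (m + io *+ r) = j + io *+ r.
Proof. by deg. Qed.

Definition cmp_fun X Z m j (e : l + m = j) : bar D X Z m -> W X Z j :=
  @dlift G (fun r => hompow D r.+1 X Z (m + io *+ r)) _
    (fun r t => hstep (@cmp_bar1 r) (deg_H r e) t).

Lemma cmpE X Z m j (e : l + m = j) r (t : hompow D r.+1 X Z (m + io *+ r)) :
  cmp_fun e (bin t : bar D X Z m) = hstep (@cmp_bar1 r) (deg_H r e) t.
Proof. by apply: dliftE => r'; apply: hstep_lin => *; apply: cmp_bar1_lin. Qed.

Lemma cmp_lin X Z m j (e : l + m = j) : linear (@cmp_fun X Z m j e).
Proof. by apply: dlift_lin => r'; apply: hstep_lin => *; apply: cmp_bar1_lin. Qed.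

Lemma cmp_lact X' X Z a m n j' n' (e : a + m = n) (e1 : l + n = n')
    (e2 : l + m = j') (e3 : a + j' = n') (g : hom X X' a) (x : bar D X Z m) :
  cmp_fun e1 (lact e g x) = (-1) ^+ (pairing l a) *: lact e3 g (cmp_fun e2 x).
Proof.
move: x; apply: bar_bin_ext => [||r t].
- by apply: (lin_app (cmp_lin _)); apply: lact_linr.
- by apply: lin_scale; apply: (lin_app (lact_linr _ _)); apply: cmp_lin.
rewrite [lact e g _]bar_lactE (linZ (cmp_lin _)) !cmpE.
rewrite (hstep_lact _ (deg_H r e2) _ _ e3); last by move=> *; apply: cmp_bar1_lin.
rewrite sgr_mulb sgrD; congr (_ ^+ (nat_of_bool _) *: _).
by case: (pairing l a); case: (pairing io a); case: (odd r).
Qed.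

Lemma cmp_ract X Z Z' m a n j' n' (e : m + a = n) (e1 : l + n = n')
    (e2 : l + m = j') (e3 : j' + a = n') (x : bar D X Z m) (g : hom Z' Z a) :
  cmp_fun e1 (ract e x g) = ract e3 (cmp_fun e2 x) g.
Proof.
move: x; apply: bar_bin_ext => [||r t].
- by apply: (lin_app (cmp_lin _)); apply: ract_linl.
- by apply: (lin_app (ract_linl _ _)); apply: cmp_lin.
rewrite [ract e _ g]bar_ractE !cmpE.
by rewrite (hstep_ract _ _ (deg_H r e2) _ _ e3); case: (cmp_bar1_props r).
Qed.

(** The bimodule map H with H[1, 1] = s theta[1, 1] + u and H[1, x] = s(theta[1, x] +-
H(x)). *)
Definition comparison : bimHom (bar D) W l := BimHom cmp_lin cmp_lact cmp_ract.

Lemma comparison_bar1 r X Z i m j (e : l + m = j) (e1 : 0 + i = m + io *+ r)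
    (e2 : l + i = j + io *+ r) (y : hompow D r X Z i) :
  bh comparison e (bar1 e1 y) = cmp_bar1 e2 y.
Proof.
rewrite [LHS]cmpE.
rewrite (hstepE (fun X Z i j e => @cmp_bar1_lin r X Z i j e) _ _ (add0r j) e2).
by rewrite pairing0r lact1 pairing0r andbF sgr0.
Qed.

Lemma comparison_unit X j k (e : l + 0 = j) (e1 : q + 0 = k) (e2 : j + io = k)
    (e3 : l = j) :
  bh comparison e (bar_unit X) =
  htp kW e2 (bh theta e1 (bar_unit X)) + gcast e3 (u X).
Proof.
case: _ / e3 e e2 => e e2.
have h : l + 0 = l + io *+ 0 by [].
rewrite (comparison_bar1 _ _ h) [LHS]/=.
by rewrite ract1 (hthetaE _ (deg_bar_unit G) e1 e2).
Qed.

Lemma comparison_htp X Z i m j k (e : i + io = m) (e1 : l + i = j)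
    (e2 : l + m = k) (e3 : j + io = k) (e4 : q + i = k) (x : bar D X Z m) :
  bh comparison e1 (bar_htp e x) =
  htp kW e3 (bh theta e4 (bar_htp e x) + (-1) ^+ (pairing io l) *: bh comparison e2 x).
Proof.
move: x; apply: bar_bin_ext => [||r t].
- by apply: (lin_app (bh_lin _ _)); apply: bar_htp_lin.
- apply: (lin_app (htp_lin _ _)); apply: lin_add.
    by apply: (lin_app (bh_lin _ _)); apply: bar_htp_lin.
  by apply: lin_scale; apply: bh_lin.
have h : l + (m + io *+ r) = j + io *+ r.+1 by deg.
rewrite bar_htpE (comparison_bar1 _ _ h) [LHS]/=.
rewrite !(linD (htp_lin _ _)) (hthetaE _ (deg_bar_htp r e) e4 e3); congr (_ + _).
case: _ / e3 e2 {e4} => e2; congr (htp _ _ (_ *: _)).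
by rewrite [RHS]cmpE; congr hstep; apply: eq_irrelevance.
Qed.

Hypothesis theta_closed : bim_closed theta.
Hypothesis theta_aug : forall X Z i j (e : q + i = j) (x : bar D X Z i),
  aug kW (bh theta e x) = 0.
Hypothesis u_dd : forall X i (e : l + io = i), dd e (u X) = 0.
Hypothesis u_aug : forall X Y a j (e : a + l = j) (e1 : l + a = j) (f : hom Y X a),
  aug kW (lact e f (u Y)) = (-1) ^+ (pairing l a) *: ract e1 (u X) f.

(** Both sides vanish at f [1, x], because [aug] vanishes at f (htp z); at f [1, 1] g
this is the hypothesis on u. *)
Lemma comparison_aug X Z m j k (e : l + m = j) (e1 : q + m = k) (e2 : j + io = k)
    (x : bar D X Z m) :
  bh comparison e (bar_aug x) =
  aug kW (bh comparison e x) + htp kW e2 (bh theta e1 (bar_aug x)).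
Proof.
elim/bar_ind: x j k e e1 e2 => {X Z m}.
- move=> X Z m j k e e1 e2; rewrite (lin0 (@bar_aug_lin _ _ _ _ _)).
  by rewrite !(lin0 (bh_lin _ _)) (lin0 (aug_lin _)) (lin0 (htp_lin _ _)) addr0.
- move=> X Z m a x y Hx Hy j k e e1 e2.
  rewrite (@bar_aug_lin _ _ _ _ _ a x y) !bh_lin aug_lin htp_lin (Hx _ _ _ e1 e2).
  by rewrite (Hy _ _ _ e1 e2) scalerDr; zmod.
- move=> X Y Z i j k n e0 e1 g y j' k' e e2 e3.
  have f1 : i + n = k by rewrite -e0 -e1 add0r.
  have f2 : 0 + k = k by rewrite add0r.
  have f3 : l + 0 = l by rewrite addr0.
  have f4 : q + 0 = q by rewrite addr0.
  have f5 : l + n = j' - i by deg.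
  have f6 : i + (j' - i) = j' by deg.
  have f7 : l + j = j' - i by deg.
  have f8 : q + k = k' by [].
  have f9 : j' - i + io = k' - i by deg.
  have f10 : q + n = k' - i by deg.
  have f11 : i + (k' - i) = k' by deg.
  have f12 : i + l = j' - n by deg.
  have f13 : j' - n + n = j' by deg.
  have f14 : l + i = j' - n by deg.
  rewrite (bar_aug_unit e0 e1 f1 f2).
  rewrite (bh_ract theta f2 e2 f4 e2) (bh_ract comparison f2 e f3 e).
  rewrite (htp_ract kW elq e2 e3 e) (bh_lact comparison e0 e f7 f6).
  rewrite (bh_ract comparison e1 f7 f3 f5) !(comparison_unit _ _ f4 elq erefl).
  rewrite !(linD (ract_linl _ _)) (linD (lact_linr _ _)) !scalerDr.
  rewrite (linD (aug_lin _)) -(htp_ract kW elq f10 f9 f5).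
  rewrite !(linZ (aug_lin _)) aug_htp scaler0 add0r addrC; congr (_ + _) => /=.
  rewrite -(lractA f12 f13 f5 f6) aug_ract (u_aug _ f14) (linZ (ract_linl _ _)) sgrD.
  by rewrite addbb sgr0; symmetry; exact: ractA.
move=> X Y Z i j k n e0 e1 g x _ j' k' e e2 e3.
have f1 : l + j = j' - i by deg.
have f2 : i + (j' - i) = j' by deg.
have f3 : j' - i + io = l + n by deg.
have f4 : q + j = l + n by deg.
rewrite bar_aug_htp !(lin0 (bh_lin _ _)) (lin0 (htp_lin _ _)) addr0.
rewrite (bh_lact comparison e0 e f1 f2) (comparison_htp e1 f1 erefl f3 f4).
by rewrite (linZ (aug_lin _)) aug_htp scaler0.
Qed.

(** At [1, x], with z = theta[1, x] +- H(x), one has d(s z) = z - p z - s(dz); since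
theta is closed and the differential of H is known at x, all terms but theta[1, x]
cancel, up to the augmentation terms, which are settled by [comparison_aug]. *)
Lemma comparison_diff X Z m m' j k (e1 : l + m = j) (e2 : j + io = k)
    (e3 : m + io = m') (e4 : l + m' = k) (e5 : q + m = k) (x : bar D X Z m) :
  bim_diff comparison e1 e2 e3 e4 x = bh theta e5 x.
Proof.
elim/bar_ind: x m' j k e1 e2 e3 e4 e5 => {X Z m}.
- by move=> X Z m *; rewrite (lin0 (bim_diff_lin _ _ _ _ _)) (lin0 (bh_lin _ _)).
- move=> X Z m a x y Hx Hy m' j k e1 e2 e3 e4 e5.
  by rewrite bim_diff_lin bh_lin (Hx _ _ _ _ _ _ _ e5) (Hy _ _ _ _ _ _ _ e5).
- move=> X Y Z i j k n e0 e0' g y m' j' k' e1 e2 e3 e4 e5.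
  have f1 : l + 0 = l by rewrite addr0.
  have f2 : l + n = j' - i by deg.
  have f3 : l + j = j' - i by deg.
  have f4 : i + (j' - i) = j' by deg.
  have f5 : j' - i + io = k' - i by deg.
  have f6 : i + (k' - i) = k' by deg.
  have f7 : q + j = k' - i by deg.
  have f8 : q + 0 = q by rewrite addr0.
  have f9 : q + n = k' - i by deg.
  have f10 : l + (j + io) = k' - i by deg.
  have f11 : 0 + io = io :> Gam by rewrite add0r.
  rewrite (bim_diff_lact _ e0 _ _ _ _ f3 f5 erefl f10 f6).
  rewrite (bim_diff_ract _ e0' _ _ _ _ f1 elq f11 elq f9).
  rewrite (bh_lact theta e0 e5 f7 f6) (bh_ract theta e0' f7 f8 f9).
  have -> : pairing q i = pairing l i (+) pairing io i by rewrite -elq pairingDl.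
  congr (_ *: lact _ _ (ract _ _ _)).
  have e6 : q + io = q + io by [].
  have h := bar_unit_dd Y f11.
  rewrite /bim_diff h (lin0 (bh_lin _ _)) scaler0 subr0.
  rewrite (comparison_unit _ _ f8 elq erefl) /= (linD (dd_lin _)) u_dd addr0.
  have := theta_closed f8 e6 f11 e6 (bar_unit Y).
  rewrite /bim_diff h (lin0 (bh_lin _ _)) scaler0 subr0 => h2.
  have := htp_dd kW elq e6 (bh theta f8 (bar_unit Y)).
  by rewrite h2 (lin0 (htp_lin _ _)) addr0 theta_aug subr0.
move=> X Y Z i j k n e0 e0' g x IH m' j' k' e1 e2 e3 e4 e5.
have f3 : l + j = j' - i by deg.
have f4 : i + (j' - i) = j' by deg.
have f5 : j' - i + io = k' - i by deg.
have f6 : i + (k' - i) = k' by deg.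
have f10 : l + n = k' - i by deg.
have f7 : q + j = k' - i by rewrite -f10 -elq -e0' (addrC j) addrA.
rewrite (bim_diff_lact _ e0 _ _ _ _ f3 f5 e0' f10 f6).
rewrite (bh_lact theta e0 e5 f7 f6).
have -> : pairing q i = pairing l i (+) pairing io i by rewrite -elq pairingDl.
  congr (_ *: lact _ _ _).
(* it remains to treat [1, x] *)
set a := k' - i in f5 f6 f7 f10 *; clearbody a.
rewrite /bim_diff (comparison_htp e0' f3 f10 f5 f7).
set z := bh theta f7 _ + _.
have hd : dd e0' (bar_htp e0' x) = x - bar_aug x - bar_htp erefl (dd erefl x).
  by rewrite -(bar_htp_dd e0' erefl x) addrK.
have g1 : n + io = n + io by [].
have g2 : l + (n + io) = a + io by rewrite -f10 addrA.
have g3 : q + n = a + io by rewrite -e0' -f7 addrA.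
have /(congr1 (fun t => t - htp kW erefl (dd erefl z))) := htp_dd kW f5 erefl z.
rewrite addrK => ->.
have := IH _ _ _ f10 erefl erefl g2 g3; rewrite /bim_diff => /eqP;
  rewrite subr_eq => /eqP hH.
have := theta_closed f7 erefl e0' g3 (bar_htp e0' x).
rewrite /bim_diff => /eqP; rewrite subr_eq add0r => /eqP hT.
have hp : pairing io q = ~~ pairing io l by rewrite -elq pairingDr pairing_io addbT.
rewrite hp hd !(linB (bh_lin _ _)) in hT.
rewrite hd !(linB (bh_lin _ _)) (comparison_aug f10 g3 erefl).
rewrite (comparison_htp erefl f10 g2 erefl g3).
rewrite {1 2}/z (linD (aug_lin _)) theta_aug (linZ (aug_lin _)) add0r.
rewrite {}/z (linD (dd_lin _)) (linZ (dd_lin _)) hT hH.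
rewrite !(linD (htp_lin _ _)) !(linZ (htp_lin _ _)) !(linB (htp_lin _ _)).
rewrite !(linD (htp_lin _ _)) !(linZ (htp_lin _ _)).
by case: (pairing io l); rewrite [~~ _]/= ?sgr0 ?sgr1; zmod.
Qed.

End Comparison.

(** * Contractions of restrictions and of tensor products *)

Section Restriction.
Variables (G : ground) (D D' E E' : dgCat G) (F : dgFun D D') (H : dgFun E E').
Variable M : bimod D' E'.

#[local] Obligation Tactic := idtac.

Program Definition res : bimod D E :=
  @Bimod G D E (fun X Y => M (F X) (H Y))
    (fun X' X Y i j k e g m => lact e (fhom F g) m)
    (fun X Y Y' i j k e m g => ract e m (fhom H g)) _ _ _ _ _ _ _ _ _ _ _.
Next Obligation.
by move=> *; apply: (lin_app (lact_linl _ _)); apply: fhom_lin.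
Qed.
Next Obligation. by move=> *; apply: lact_linr. Qed.
Next Obligation. by move=> *; apply: ract_linl. Qed.
Next Obligation.
by move=> *; apply: (lin_app (ract_linr _ _)); apply: fhom_lin.
Qed.
Next Obligation. by move=> * /=; rewrite fhom_comp; apply: lactA. Qed.
Next Obligation. by move=> * /=; rewrite fhom_comp; apply: ractA. Qed.
Next Obligation. by move=> *; apply: lractA. Qed.
Next Obligation. by move=> * /=; rewrite fhom_id lact1. Qed.
Next Obligation. by move=> * /=; rewrite fhom_id ract1. Qed.
Next Obligation. by move=> * /=; rewrite fhom_dd; apply: dd_lact. Qed.
Next Obligation. by move=> * /=; rewrite fhom_dd; apply: dd_ract. Qed.

Definition res_contraction (k : contraction M) : contraction res :=
  @Contraction G D E res (fun X Z i j e m => @htp _ _ _ _ k (F X) (H Z) i j e m)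
    (fun X Z i m => @aug _ _ _ _ k (F X) (H Z) i m)
    (fun X Z i j e => htp_lin k e) (fun X Z i => aug_lin k)
    (fun X Z Z' i j a n l e e1 e2 e3 m g => htp_ract k e e1 e2 e3 m (fhom H g))
    (fun X Z Z' j a n e m g => aug_ract k e m (fhom H g))
    (fun X Z i j n e e' m => htp_dd k e e' m)
    (fun X' X Z a i j n e e1 f m => aug_htp k e e1 (fhom F f) m).

End Restriction.

Section TensorContraction.
Variables (G : ground) (D C E : dgCat G) (M : bimod D C) (N : bimod C E).
Variable k : contraction M.
Local Notation Gam := (gdeg G).
Local Notation T := (tens true M N).

Lemma deg_tens1 (a : Gam) : a - io + io = a.
Proof. by rewrite subrK. Qed.
Lemma deg_tens2 (a b i j : Gam) : a + b = j -> i + io = j -> a - io + b = i.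
Proof. by move=> <- e; degw e. Qed.

Definition tens_htp_gen X Z i j (e : i + io = j) Y a b (eab : a + b = j)
  (m : M X Y a) (n : N Y Z b) : T X Z i :=
  telt true (deg_tens2 eab e) (htp k (deg_tens1 a) m) n.

Definition tens_htp X Z i j (e : i + io = j) : T X Z j -> T X Z i :=
  tlift (tens_htp_gen e).

Definition tens_aug_gen X Z j Y a b (eab : a + b = j)
  (m : M X Y a) (n : N Y Z b) : T X Z j := telt true eab (aug k m) n.

Definition tens_aug X Z j : T X Z j -> T X Z j := tlift (@tens_aug_gen X Z j).

Section Gens.
Variables (X : D) (Z : E).

Lemma tens_htp_gen_l i j (e : i + io = j) Y a b (eab : a + b = j) (n : N Y Z b) :
  linear (fun m : M X Y a => tens_htp_gen e eab m n).
Proof. by apply: (lin_app (telt_linl _ _ _)); apply: htp_lin. Qed.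

Lemma tens_htp_gen_r i j (e : i + io = j) Y a b (eab : a + b = j) (m : M X Y a) :
  linear (fun n : N Y Z b => tens_htp_gen e eab m n).
Proof. exact: telt_linr. Qed.

Lemma tens_htp_gen_bal i l' (e : i + io = l') Y Y' i' j k' ij jk
    (e1 : i' + j = ij) (e2 : ij + k' = l') (e3 : j + k' = jk) (e4 : i' + jk = l')
    (m : M X Y i') (f : hom Y' Y j) (n : N Y' Z k') : true ->
  tens_htp_gen e e2 (ract e1 m f) n = tens_htp_gen e e4 m (lact e3 f n).
Proof.
move=> _; rewrite /tens_htp_gen.
have h : i' - io + j = ij - io by deg.
by rewrite (htp_ract k (deg_tens1 i') _ _ h); apply: telt_bal.
Qed.

Lemma tens_htp_lin i j (e : i + io = j) : linear (@tens_htp X Z i j e).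
Proof. by apply: tlift_lin; [exact: tens_htp_gen_l|exact: tens_htp_gen_r|exact:
  tens_htp_gen_bal]. Qed.

Lemma tens_htpE i j (e : i + io = j) Y a a' b (eab : a + b = j) (e1 : a' + b = i)
    (e2 : a' + io = a) (m : M X Y a) (n : N Y Z b) :
  tens_htp e (telt true eab m n : T X Z j) = telt true e1 (htp k e2 m) n.
Proof.
rewrite /tens_htp tliftE; [|exact: tens_htp_gen_l|exact: tens_htp_gen_r|exact:
  tens_htp_gen_bal].
rewrite /tens_htp_gen; move: (deg_tens2 _ _) (deg_tens1 a).
have -> : a - io = a' by rewrite -e2 addrK.
by move=> x y; rewrite (eq_irrelevance x e1) (eq_irrelevance y e2).
Qed.

Lemma tens_aug_gen_l j Y a b (eab : a + b = j) (n : N Y Z b) :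
  linear (fun m : M X Y a => tens_aug_gen eab m n).
Proof. by apply: (lin_app (telt_linl _ _ _)); apply: aug_lin. Qed.

Lemma tens_aug_gen_r j Y a b (eab : a + b = j) (m : M X Y a) :
  linear (fun n : N Y Z b => tens_aug_gen eab m n).
Proof. exact: telt_linr. Qed.

Lemma tens_aug_gen_bal l' Y Y' i' j k' ij jk
    (e1 : i' + j = ij) (e2 : ij + k' = l') (e3 : j + k' = jk) (e4 : i' + jk = l')
    (m : M X Y i') (f : hom Y' Y j) (n : N Y' Z k') : true ->
  tens_aug_gen e2 (ract e1 m f) n = tens_aug_gen e4 m (lact e3 f n).
Proof. by move=> _; rewrite /tens_aug_gen aug_ract; apply: telt_bal. Qed.

Lemma tens_aug_lin j : linear (@tens_aug X Z j).
Proof. by apply: tlift_lin; [exact: tens_aug_gen_l|exact: tens_aug_gen_r|exact: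
  tens_aug_gen_bal]. Qed.

Lemma tens_augE j Y a b (eab : a + b = j) (m : M X Y a) (n : N Y Z b) :
  tens_aug (telt true eab m n : T X Z j) = telt true eab (aug k m) n.
Proof.
by rewrite /tens_aug tliftE; [|exact: tens_aug_gen_l|exact: tens_aug_gen_r|exact:
  tens_aug_gen_bal].
Qed.

End Gens.

Lemma tens_htp_ract X Z Z' i j a n l (e : i + io = j) (e1 : j + a = n)
    (e2 : l + io = n) (e3 : i + a = l) (x : T X Z j) (g : hom Z' Z a) :
  tens_htp e2 (ract e1 x g) = ract e3 (tens_htp e x) g.
Proof.
move: x; apply: tens_telt_ext => [||Y b c f x y].
- by apply: (lin_app (tens_htp_lin _)); apply: ract_linl.
- by apply: (lin_app (ract_linl _ _)); apply: tens_htp_lin.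
have h1 := deg_ra f e1.
have h2 : b - io + c = i := deg_tens2 f e.
have h3 : b - io + (c + a) = l by rewrite addrA h2.
rewrite (ract_telt e1 f erefl h1) (tens_htpE _ h1 h3 (deg_tens1 b)).
by rewrite (tens_htpE e f h2 (deg_tens1 b)) (ract_telt e3 h2 erefl h3).
Qed.

Lemma tens_aug_ract X Z Z' j a n (e : j + a = n) (x : T X Z j) (g : hom Z' Z a) :
  tens_aug (ract e x g) = ract e (tens_aug x) g.
Proof.
move: x; apply: tens_telt_ext => [||Y b c f x y].
- by apply: (lin_app (@tens_aug_lin _ _ _)); apply: ract_linl.
- by apply: (lin_app (ract_linl _ _)); apply: tens_aug_lin.
have h1 := deg_ra f e.
by rewrite (ract_telt e f erefl h1) !tens_augE (ract_telt e f erefl h1).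
Qed.

Lemma tens_htp_dd X Z i j n (e : i + io = j) (e' : j + io = n) (x : T X Z j) :
  dd e (tens_htp e x) + tens_htp e' (dd e' x) = x - tens_aug x.
Proof.
move: x; apply: tens_telt_ext => [||Y a b f x y].
- apply: lin_add; first by apply: (lin_app (dd_lin _)); apply: tens_htp_lin.
  by apply: (lin_app (tens_htp_lin _)); apply: dd_lin.
- by apply: lin_add; [|apply: lin_opp; apply: tens_aug_lin].
have h1 : a - io + b = i := deg_tens2 f e.
have h2 := deg_dr h1 e.
have h3 := deg_dl f e'.
have h4 := deg_dr f e'.
rewrite (tens_htpE e f h1 (deg_tens1 a)) (dd_telt e h1 (deg_tens1 a) f erefl h2).
rewrite (dd_telt e' f erefl h3 erefl h4) (linD (tens_htp_lin _)) (linZ (tens_htp_lin _)).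
rewrite (tens_htpE e' h3 f erefl) (tens_htpE e' h4 h2 (deg_tens1 a)) tens_augE.
have -> : pairing io (a - io) = ~~ pairing io a.
  by rewrite pairingDr pairingNr pairing_io addbT.
have -> := canRL (addKr _) (htp_dd k (deg_tens1 a) erefl x).
rewrite (linD (telt_linl _ _ _)) (linN (telt_linl _ _ _)) (linB (telt_linl _ _ _)).
by case: (pairing io a); rewrite [~~ _]/= ?sgr0 ?sgr1; zmod.
Qed.

Lemma tens_aug_htp X' X Z a i j n (e : i + io = j) (e1 : a + i = n)
    (g : hom X X' a) (x : T X Z j) : tens_aug (lact e1 g (tens_htp e x)) = 0.
Proof.
move: x; apply: tens_telt_ext => [||Y b c f x y].
- apply: (lin_app (@tens_aug_lin _ _ _)); apply: (lin_app (lact_linr _ _)).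
  exact: tens_htp_lin.
- exact: lin_zero.
have h1 : b - io + c = i := deg_tens2 f e.
have h2 : a + (b - io) + c = n by rewrite -addrA h1.
rewrite (tens_htpE e f h1 (deg_tens1 b)) (lact_telt e1 h1 erefl h2) tens_augE aug_htp.
exact: (lin0 (telt_linl _ _ _)).
Qed.

Definition tens_contraction : contraction T :=
  Contraction tens_htp_lin tens_aug_lin tens_htp_ract tens_aug_ract tens_htp_dd
    tens_aug_htp.

End TensorContraction.

(** * Operations on bimodule maps *)

Section BimHomOps.
Variables (G : ground) (D E : dgCat G).

Section Zero.
Variables (M N : bimod D E) (l : gdeg G).

Lemma bim_zero_lin X Y i j (e : l + i = j) : linear (fun _ : M X Y i => 0 : N X Y j).
Proof. exact: lin_zero. Qed.

Lemma bim_zero_lact X' X Y i j k j' k' (e : i + j = k) (e1 : l + k = k')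
    (e2 : l + j = j') (e3 : i + j' = k') (g : hom X X' i) (m : M X Y j) :
  0 = (-1) ^+ (pairing l i) *: lact e3 g (0 : N X Y j').
Proof. by rewrite (lin0 (lact_linr _ _)) scaler0. Qed.

Lemma bim_zero_ract X Y Y' i j k i' k' (e : i + j = k) (e1 : l + k = k')
    (e2 : l + i = i') (e3 : i' + j = k') (m : M X Y i) (g : hom Y' Y j) :
  0 = ract e3 (0 : N X Y i') g.
Proof. by rewrite (lin0 (ract_linl _ _)). Qed.

Definition bim_zero : bimHom M N l := BimHom bim_zero_lin bim_zero_lact bim_zero_ract.

Lemma bim_zero_diff X Y i i' j k (e1 : l + i = j) (e2 : j + io = k)
    (e3 : i + io = i') (e4 : l + i' = k) (m : M X Y i) :
  bim_diff bim_zero e1 e2 e3 e4 m = 0.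
Proof. by rewrite /bim_diff /= (lin0 (dd_lin _)) scaler0 subr0. Qed.

End Zero.

Section CompSub.
Variables (M N : bimod D E) (F : bimHom M N 0) (F' : bimHom N M 0).

Definition comp_sub_id_fun X Y i j (e : 0 + i = j) (m : M X Y i) : M X Y j :=
  bh F' e (bh F (add0r i) m) - gcast (etrans (esym (add0r i)) e) m.

Lemma comp_sub_id_lin X Y i j (e : 0 + i = j) : linear (@comp_sub_id_fun X Y i j e).
Proof.
apply: lin_add; first by apply: (lin_app (bh_lin _ _)); apply: bh_lin.
by apply: lin_opp; apply: gcast_lin.
Qed.

Lemma gcast_refl (V : dgMod G) i (e : i = i) (m : V i) : gcast e m = m.
Proof. by rewrite (eq_irrelevance e erefl). Qed.

Lemma comp_sub_idE X Y i (e : 0 + i = i) (m : M X Y i) :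
  comp_sub_id_fun e m = bh F' e (bh F e m) - m.
Proof. by rewrite /comp_sub_id_fun gcast_refl (eq_irrelevance (add0r i) e). Qed.

Lemma comp_sub_id_lact X' X Y i j k j' k' (e : i + j = k) (e1 : 0 + k = k')
    (e2 : 0 + j = j') (e3 : i + j' = k') (g : hom X X' i) (m : M X Y j) :
  comp_sub_id_fun e1 (lact e g m) =
  (-1) ^+ (pairing 0 i) *: lact e3 g (comp_sub_id_fun e2 m).
Proof.
have hk : k = k' by rewrite -e1 add0r.
have hj : j = j' by rewrite -e2 add0r.
case: _ / hk e1 e3 => e1 e3; case: _ / hj e2 e3 => e2 e3;
  rewrite !comp_sub_idE pairing0l sgr0 (eq_irrelevance e3 e).
rewrite (bh_lact F e e1 e2 e) pairing0l sgr0 (bh_lact F' e e1 e2 e) pairing0l sgr0.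
by rewrite (linB (lact_linr _ _)).
Qed.

Lemma comp_sub_id_ract X Y Y' i j k i' k' (e : i + j = k) (e1 : 0 + k = k')
    (e2 : 0 + i = i') (e3 : i' + j = k') (m : M X Y i) (g : hom Y' Y j) :
  comp_sub_id_fun e1 (ract e m g) = ract e3 (comp_sub_id_fun e2 m) g.
Proof.
have hk : k = k' by rewrite -e1 add0r.
have hi : i = i' by rewrite -e2 add0r.
case: _ / hk e1 e3 => e1 e3; case: _ / hi e2 e3 => e2 e3;
  rewrite !comp_sub_idE (eq_irrelevance e3 e).
rewrite (bh_ract F e e1 e2 e) (bh_ract F' e e1 e2 e).
by rewrite (linB (ract_linl _ _)).
Qed.

Definition comp_sub_id : bimHom M M 0 := BimHom comp_sub_id_lin comp_sub_id_lact
  comp_sub_id_ract.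

Lemma bim_closedE (M' N' : bimod D E) (F0 : bimHom M' N' 0) :
  bim_closed F0 <-> forall X Y i j (e : 0 + i = i) (e' : 0 + j = j)
    (e1 : i + io = j) (m : M' X Y i), dd e1 (bh F0 e m) = bh F0 e' (dd e1 m).
Proof.
split=> h.
  move=> X Y i j e e' e1 m; apply/eqP; rewrite -subr_eq0.
  by have := h X Y _ _ _ _ e e1 e1 e' m; rewrite /bim_diff pairing0r sgr0 => ->.
move=> X Y i i' j k e1 e2 e3 e4 m.
have hj : i = j by rewrite -e1 add0r.
have hk : i' = k by rewrite -e4 add0r.
case: _ / hj e1 e2 => e1 e2; case: _ / hk e2 e4 => e2 e4;
  rewrite /bim_diff pairing0r sgr0 (eq_irrelevance e2 e3).
by rewrite (h _ _ _ _ _ e4) subrr.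
Qed.

Lemma comp_sub_id_closed : bim_closed F -> bim_closed F' -> bim_closed comp_sub_id.
Proof.
move=> /bim_closedE h /bim_closedE h'; apply/bim_closedE => X Y i j e e' e1 m.
rewrite /= !comp_sub_idE (linB (dd_lin _)).
by rewrite (h' _ _ _ _ e e') (h _ _ _ _ e e').
Qed.

End CompSub.
End BimHomOps.

Section InduceLeft.
Variables (G : ground) (C P E : dgCat G) (F : dgFun C P).
Variables (N : bimod C E) (M : bimod P E).
Variable Phi : bimHom N (res F (fun_id E) M) 0.
Local Notation R := (reg (fun_id P) F).
Local Notation T := (tens true R N).
Local Notation Gam := (gdeg G).

Lemma deg_induce (a b i j : Gam) : a + b = i -> 0 + i = j -> a + b = j.
Proof. by move=> <- <-; rewrite add0r. Qed.

Definition il_gen X Z i j (e : 0 + i = j) Y a b (eab : a + b = i)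
    (g : R X Y a) (x : N Y Z b) : M X Z j :=
  lact (deg_induce eab e) (g : hom (F Y) X a) (bh Phi (add0r b) x : M (F Y) Z b).

Definition il_fun X Z i j (e : 0 + i = j) : T X Z i -> M X Z j := tlift (il_gen e).

Section Gens.
Variables (X : P) (Z : E) (i j : Gam) (e : 0 + i = j).

Lemma il_gen_l Y a b (eab : a + b = i) (x : N Y Z b) :
  linear (fun g : R X Y a => il_gen e eab g x).
Proof. exact: (lact_linl (b := M)). Qed.

Lemma il_gen_r Y a b (eab : a + b = i) (g : R X Y a) :
  linear (fun x : N Y Z b => il_gen e eab g x).
Proof. by apply: (lin_app (lact_linr (b := M) _ _)); apply: (bh_lin Phi). Qed.

Lemma il_gen_bal Y Y' a b c ab bc (e1 : a + b = ab) (e2 : ab + c = i)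
    (e3 : b + c = bc) (e4 : a + bc = i) (g : R X Y a) (f : hom Y' Y b)
    (x : N Y' Z c) : true ->
  il_gen e e2 (ract e1 g f) x = il_gen e e4 g (lact e3 f x).
Proof.
move=> _; rewrite /il_gen (bh_lact Phi e3 (add0r bc) (add0r c) e3) pairing0l sgr0.
exact: (lactA (b := M)).
Qed.

Lemma il_lin : linear (@il_fun X Z i j e).
Proof. by apply: tlift_lin; [exact: il_gen_l|exact: il_gen_r|exact: il_gen_bal]. Qed.

Lemma ilE Y a b b' (eab : a + b = i) (e1 : a + b' = j) (e2 : 0 + b = b')
    (g : R X Y a) (x : N Y Z b) :
  il_fun e (telt true eab g x : T X Z i) =
  lact e1 (g : hom (F Y) X a) (bh Phi e2 x : M (F Y) Z b').
Proof.
rewrite /il_fun tliftE; [|exact: il_gen_l|exact: il_gen_r|exact: il_gen_bal].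
have hb : b = b' by rewrite -e2 add0r.
case: _ / hb e1 e2 => e1 e2.
by rewrite /il_gen (eq_irrelevance (deg_induce _ _) e1) (eq_irrelevance (add0r b) e2).
Qed.

End Gens.

Lemma il_lact X' X Z i j k j' k' (e : i + j = k) (e1 : 0 + k = k')
    (e2 : 0 + j = j') (e3 : i + j' = k') (g : hom X X' i) (m : T X Z j) :
  il_fun e1 (lact e g m) = (-1) ^+ (pairing 0 i) *: lact e3 g (il_fun e2 m).
Proof.
rewrite pairing0l sgr0; move: m; apply: tens_telt_ext => [||Y a b f x y].
- by apply: (lin_app (il_lin _)); apply: lact_linr.
- by apply: (lin_app (lact_linr _ _)); apply: il_lin.
have h1 := deg_la f e.
have h2 := deg_induce f e2.
have h3 := deg_induce h1 e1.
rewrite (lact_telt e f erefl h1) (ilE e1 h1 h3 (add0r b)) (ilE e2 f h2 (add0r b)).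
exact: (lactA (b := M)).
Qed.

Lemma il_ract X Z Z' i j k i' k' (e : i + j = k) (e1 : 0 + k = k')
    (e2 : 0 + i = i') (e3 : i' + j = k') (m : T X Z i) (g : hom Z' Z j) :
  il_fun e1 (ract e m g) = ract e3 (il_fun e2 m) g.
Proof.
move: m; apply: tens_telt_ext => [||Y a b f x y].
- by apply: (lin_app (il_lin _)); apply: ract_linl.
- by apply: (lin_app (ract_linl _ _)); apply: il_lin.
have h1 := deg_ra f e.
have h2 := deg_induce f e2.
have h3 := deg_induce h1 e1.
rewrite (ract_telt e f erefl h1) (ilE e1 h1 h3 (add0r _)) (ilE e2 f h2 (add0r b)).
rewrite (bh_ract Phi erefl (add0r _) (add0r b) erefl) /=.
by symmetry; apply: (lractA (b := M)).
Qed.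

(** The adjunct of Phi under extension of scalars: g (x) x |-> g Phi(x). *)
Definition induce_left : bimHom T M 0 := BimHom il_lin il_lact il_ract.

Lemma induce_left_closed : bim_closed Phi -> bim_closed induce_left.
Proof.
move=> /bim_closedE h; apply/bim_closedE => X Z i j e e' e1.
change (forall m : T X Z i, dd e1 (@il_fun X Z i i e m) = @il_fun X Z j j e' (dd e1 m)).
apply: tens_telt_ext => [||Y a b f x y].
- by apply: (lin_app (dd_lin _)); apply: il_lin.
- by apply: (lin_app (il_lin _)); apply: dd_lin.
have h1 := deg_dl f e1.
have h2 := deg_dr f e1.
rewrite (dd_telt e1 f erefl h1 erefl h2) (linD (il_lin _)) (linZ (il_lin _)).
rewrite (ilE e f f (add0r b)) (ilE e' h1 h1 (add0r b)) (ilE e' h2 h2 (add0r _)).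
rewrite -(h _ _ _ _ (add0r b)).
exact: (dd_lact (b := M)).
Qed.

Lemma induce_leftE X Y Z a b b' i j (eab : a + b = i) (e : 0 + i = j)
    (e1 : a + b' = j) (e2 : 0 + b = b') (g : R X Y a) (x : N Y Z b) :
  bh induce_left e (telt true eab g x : T X Z i) =
  lact e1 (g : hom (F Y) X a) (bh Phi e2 x : M (F Y) Z b').
Proof. exact: ilE. Qed.

End InduceLeft.

Section InduceRight.
Variables (G : ground) (D C P : dgCat G) (F : dgFun C P).
Variables (N : bimod D C) (M : bimod D P).
Variable Phi : bimHom N (res (fun_id D) F M) 0.
Local Notation R := (reg F (fun_id P)).
Local Notation T := (tens true N R).
Local Notation Gam := (gdeg G).

Definition ir_gen X Z i j (e : 0 + i = j) Y a b (eab : a + b = i)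
    (x : N X Y a) (g : R Y Z b) : M X Z j :=
  ract (deg_induce eab e) (bh Phi (add0r a) x : M X (F Y) a) (g : hom Z (F Y) b).

Definition ir_fun X Z i j (e : 0 + i = j) : T X Z i -> M X Z j := tlift (ir_gen e).

Section Gens.
Variables (X : D) (Z : P) (i j : Gam) (e : 0 + i = j).

Lemma ir_gen_l Y a b (eab : a + b = i) (g : R Y Z b) :
  linear (fun x : N X Y a => ir_gen e eab x g).
Proof. by apply: (lin_app (ract_linl (b := M) _ _)); apply: (bh_lin Phi). Qed.

Lemma ir_gen_r Y a b (eab : a + b = i) (x : N X Y a) :
  linear (fun g : R Y Z b => ir_gen e eab x g).
Proof. exact: (ract_linr (b := M)). Qed.

Lemma ir_gen_bal Y Y' a b c ab bc (e1 : a + b = ab) (e2 : ab + c = i)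
    (e3 : b + c = bc) (e4 : a + bc = i) (x : N X Y a) (f : hom Y' Y b)
    (g : R Y' Z c) : true ->
  ir_gen e e2 (ract e1 x f) g = ir_gen e e4 x (lact e3 f g).
Proof.
move=> _; rewrite /ir_gen (bh_ract Phi e1 (add0r ab) (add0r a) e1).
exact: (ractA (b := M)).
Qed.

Lemma ir_lin : linear (@ir_fun X Z i j e).
Proof. by apply: tlift_lin; [exact: ir_gen_l|exact: ir_gen_r|exact: ir_gen_bal]. Qed.

Lemma irE Y a a' b (eab : a + b = i) (e1 : a' + b = j) (e2 : 0 + a = a')
    (x : N X Y a) (g : R Y Z b) :
  ir_fun e (telt true eab x g : T X Z i) =
  ract e1 (bh Phi e2 x : M X (F Y) a') (g : hom Z (F Y) b).
Proof.
rewrite /ir_fun tliftE; [|exact: ir_gen_l|exact: ir_gen_r|exact: ir_gen_bal].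
have ha : a = a' by rewrite -e2 add0r.
case: _ / ha e1 e2 => e1 e2.
by rewrite /ir_gen (eq_irrelevance (deg_induce _ _) e1) (eq_irrelevance (add0r a) e2).
Qed.

End Gens.

Lemma ir_lact X' X Z i j k j' k' (e : i + j = k) (e1 : 0 + k = k')
    (e2 : 0 + j = j') (e3 : i + j' = k') (g : hom X X' i) (m : T X Z j) :
  ir_fun e1 (lact e g m) = (-1) ^+ (pairing 0 i) *: lact e3 g (ir_fun e2 m).
Proof.
rewrite pairing0l sgr0; move: m; apply: tens_telt_ext => [||Y a b f x y].
- by apply: (lin_app (ir_lin _)); apply: lact_linr.
- by apply: (lin_app (lact_linr _ _)); apply: ir_lin.
have h1 := deg_la f e.
have h2 := deg_induce f e2.
have h3 := deg_induce h1 e1.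
rewrite (lact_telt e f erefl h1) (irE e1 h1 h3 (add0r _)) (irE e2 f h2 (add0r a)).
rewrite (bh_lact Phi erefl (add0r _) (add0r a) erefl) pairing0l sgr0.
exact: (lractA (b := M)).
Qed.

Lemma ir_ract X Z Z' i j k i' k' (e : i + j = k) (e1 : 0 + k = k')
    (e2 : 0 + i = i') (e3 : i' + j = k') (m : T X Z i) (g : hom Z' Z j) :
  ir_fun e1 (ract e m g) = ract e3 (ir_fun e2 m) g.
Proof.
move: m; apply: tens_telt_ext => [||Y a b f x y].
- by apply: (lin_app (ir_lin _)); apply: ract_linl.
- by apply: (lin_app (ract_linl _ _)); apply: ir_lin.
have h1 := deg_ra f e.
have h2 := deg_induce f e2.
have h3 := deg_induce h1 e1.
rewrite (ract_telt e f erefl h1) (irE e1 h1 h3 (add0r a)) (irE e2 f h2 (add0r a)).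
by symmetry; apply: (ractA (b := M)).
Qed.

(** The adjunct of Phi under extension of scalars: x (x) g |-> Phi(x) g. *)
Definition induce_right : bimHom T M 0 := BimHom ir_lin ir_lact ir_ract.

Lemma induce_right_closed : bim_closed Phi -> bim_closed induce_right.
Proof.
move=> /bim_closedE h; apply/bim_closedE => X Z i j e e' e1.
change (forall m : T X Z i, dd e1 (@ir_fun X Z i i e m) = @ir_fun X Z j j e' (dd e1 m)).
apply: tens_telt_ext => [||Y a b f x y].
- by apply: (lin_app (dd_lin _)); apply: ir_lin.
- by apply: (lin_app (ir_lin _)); apply: dd_lin.
have h1 := deg_dl f e1.
have h2 := deg_dr f e1.
rewrite (dd_telt e1 f erefl h1 erefl h2) (linD (ir_lin _)) (linZ (ir_lin _)).
rewrite (irE e f f (add0r a)) (irE e' h1 h1 (add0r _)) (irE e' h2 h2 (add0r a)).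
rewrite -(h _ _ _ _ (add0r a)).
exact: (dd_ract (b := M)).
Qed.

Lemma induce_rightE X Y Z a a' b i j (eab : a + b = i) (e : 0 + i = j)
    (e1 : a' + b = j) (e2 : 0 + a = a') (x : N X Y a) (g : R Y Z b) :
  bh induce_right e (telt true eab x g : T X Z i) =
  ract e1 (bh Phi e2 x : M X (F Y) a') (g : hom Z (F Y) b).
Proof. exact: irE. Qed.

End InduceRight.

(** * The perturbation lemma *)

Section Perturbation.
Variables (G : ground) (V : dgMod G).
Local Notation Gam := (gdeg G).
Variable A : forall i j, i + io = j -> V i -> V j.
Variable S : forall i j, i + io = j -> V j -> V i.
Variable p : forall i, V i -> V i.
Variable N : nat.
Hypothesis A_lin : forall i j (e : i + io = j), linear (@A i j e).
Hypothesis S_lin : forall i j (e : i + io = j), linear (@S i j e).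

(** The operator S A, in which A is the part of the differential that a contraction S
of the unperturbed complex does not see. *)
Definition pert i (x : V i) : V i := S erefl (A erefl x).

Lemma pertE i j (e : i + io = j) (x : V i) : S e (A e x) = pert x.
Proof. by case: _ / e. Qed.

Lemma pert_lin i : linear (@pert i).
Proof. exact: (lin_app (S_lin _)). Qed.

Lemma iter_pert_lin n i : linear (iter n (@pert i)).
Proof.
by elim: n => [|n IH] a x y //; rewrite !iterS IH pert_lin.
Qed.

(** The inverse of 1 + S A, as a geometric series; N bounds the order of
nilpotency. *)
Definition resolvent i (x : V i) : V i :=
  \sum_(n < N) (-1) ^+ n *: iter n (@pert i) x.

Lemma resolvent_lin i : linear (@resolvent i).
Proof.
move=> a x y; rewrite /resolvent scaler_sumr -big_split; apply: eq_bigr => n _.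
by rewrite iter_pert_lin scalerDr !scalerA mulrC.
Qed.

Hypothesis pert_nil : forall i x, iter N (@pert i) x = 0.

Lemma resolventK i (x : V i) : resolvent x + pert (resolvent x) = x.
Proof.
suff h M : \sum_(n < M) (-1) ^+ n *: iter n (@pert i) x +
    pert (\sum_(n < M) (-1) ^+ n *: iter n (@pert i) x) =
    x - (-1) ^+ M *: iter M (@pert i) x by rewrite h pert_nil scaler0 subr0.
elim: M => [|M IH].
  by rewrite !big_ord0 (lin0 (@pert_lin i)) expr0 scale1r addr0 subrr.
rewrite !big_ord_recr /= (linD (@pert_lin i)) (linZ (@pert_lin i)).
by rewrite addrACA IH addrA subrK exprS mulN1r scaleNr opprK.
Qed.

Lemma resolvent_pertK i (x : V i) : resolvent (x + pert x) = x.
Proof.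
rewrite -[RHS]resolventK (linD (@resolvent_lin i)); congr (_ + _).
rewrite /resolvent (lin_sum (@pert_lin i)); apply: eq_bigr => n _.
by rewrite (linZ (@pert_lin i)) -iterS iterSr.
Qed.

Hypothesis A_dd : forall i j k (e : i + io = j) (e' : j + io = k) (x : V i),
  dd e' (A e x) + A e' (dd e x) = A e' (A e x).
Hypothesis S_dd : forall i j k (e : i + io = j) (e' : j + io = k) (x : V j),
  dd e (S e x) + S e' (dd e' x) = x - p x + A e (S e x) + S e' (A e' x).
Hypothesis p_AS : forall i j (e : i + io = j) (x : V j), p (A e (S e x)) = 0.

Lemma resolvent_S i j (e : i + io = j) (x : V j) :
  resolvent (S e x) = S e (x - A e (resolvent (S e x))).
Proof.
have h := resolventK (S e x).
by rewrite (linB (S_lin _)) pertE -{2}h addrK.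
Qed.

(** The operator 1 + S A is injective, so the identity may be proved after applying
it. With y = (1 + S A)^-1 S x it then follows from the relation for dS + Sd at x and
at A y, together with p(A y) = 0. *)
Lemma perturbation i j k (e : i + io = j) (e' : j + io = k) (x : V j) :
  dd e (resolvent (S e x)) + resolvent (S e' (dd e' x)) = x - resolvent (p x).
Proof.
set y := resolvent (S e x).
(* the identity after application of 1 + S A *)
suff h : dd e y + pert (dd e y) + S e' (dd e' x) = x + pert x - p x.
  rewrite -[dd e y]resolvent_pertK -(linD (@resolvent_lin j)) h.
  by rewrite (linB (@resolvent_lin j)) resolvent_pertK.
have hAy : p (A e y) = 0 by rewrite /y resolvent_S p_AS.
have hy : S e x = y + pert y by rewrite resolventK.
have h1 : pert (dd e y) = S e' (A e' (A e y)) - S e' (dd e' (A e y)).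
  by rewrite -(pertE e') -(A_dd e e') (linD (S_lin _)) addrC addKr.
have h2 := S_dd e e' (A e y).
have h3 := S_dd e e' x.
rewrite (pertE e) hAy in h2; rewrite (pertE e') hy in h3.
rewrite (linD (dd_lin _)) (linD (A_lin _)) in h3.
apply: (eq_shift h3); rewrite h1.
apply: (eq_shift (esym h2)); zmod.
Qed.

End Perturbation.

(** * Envelopes of a dg category *)

Section Envelope.
Variables (G : ground) (C P : dgCat G) (F : dgFun C P).
Local Notation Gam := (gdeg G).

(** What the construction uses of Pretr(C): the dg category C is a full subcategory of
P through F, and every object of P is cut into finitely many shifted objects of C by
homogeneous, in general not closed, inclusions and projections, whose differentials
are governed by a twist. Strict triangularity of the twist appears as a height
function, which the entries of the twist lower. An object of C has a single summand,
itself; as the degree of that summand occurs in types, [emb_sum] says so for sums of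
an arbitrary expression in the summand. *)
Record envelope := Envelope {
  full : forall Y Y' n, hom (F Y) (F Y') n -> hom Y Y' n;
  fullK : forall Y Y' n (f : hom (F Y) (F Y') n), fhom F (full f) = f;
  fhomK : forall Y Y' n (f : hom Y Y' n), full (fhom F f) = f;
  idx : P -> finType;
  sdg : forall X, idx X -> Gam;
  trm : forall X, idx X -> C;
  inj : forall X (a : idx X), hom (F (trm a)) X (sdg a);
  prj : forall X (a : idx X), hom X (F (trm a)) (- sdg a);
  tw : forall X, hom X X io;
  tw_dd : forall X i (e : io + io = i), dd e (tw X) = comp e (tw X) (tw X);
  inj_dd : forall X (a : idx X) i (e : sdg a + io = i) (e1 : io + sdg a = i),
    dd e (inj a) = comp e1 (tw X) (inj a);
  prj_dd : forall X (a : idx X) i (e : - sdg a + io = i),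
    dd e (prj a) = - ((-1) ^+ pairing io (sdg a) *: comp e (prj a) (tw X));
  sum_inj_prj : forall X (e : forall a : idx X, sdg a - sdg a = 0),
    \sum_a comp (e a) (inj a) (prj a) = idm X;
  height : forall X, exists h : idx X -> nat, (forall a, h a < #|idx X|)%N /\
    forall a b : idx X, ~~ (h b < h a)%N -> forall n m (e : - sdg a + n = m)
      (e1 : io + sdg b = n), comp e (prj a) (comp e1 (tw X) (inj b)) = 0;
  emb_tw : forall Y : C, tw (F Y) = 0;
  emb_sum : forall (Y : C) (V : zmodType)
    (phi : forall Y' d, hom (F Y') (F Y) d -> hom (F Y) (F Y') (- d) -> V),
    \sum_(a : idx (F Y)) phi (trm a) (sdg a) (inj a) (prj a) =
    phi Y 0 (idm (F Y)) (gcast (esym (oppr0 _)) (idm (F Y))) }.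

Variable env : envelope.

Lemma full_lin (X Y : C) l : linear (@full env X Y l).
Proof.
move=> a f g; rewrite -{1}[f](fullK env) -{1}[g](fullK env) -fhom_lin.
exact: fhomK.
Qed.

Lemma full_comp (X Y Z : C) i j k (e : i + j = k)
    (g : hom (F Y) (F Z) i) (f : hom (F X) (F Y) j) :
  full env (comp e g f) = comp e (full env g) (full env f).
Proof.
by rewrite -{1}[f](fullK env) -{1}[g](fullK env) -fhom_comp fhomK.
Qed.

Lemma full_dd (X Y : C) i j (e : i + io = j) (f : hom (F X) (F Y) i) :
  full env (dd e f) = dd e (full env f).
Proof. by rewrite -{1}[f](fullK env) -fhom_dd fhomK. Qed.

Lemma full_id (X : C) : full env (idm (F X)) = idm X.
Proof. by rewrite -fhom_id fhomK. Qed.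

Variable X : P.

(** The composite pi_a g, as a morphism of C. *)
Definition component (a : idx env X) (Y : C) n m (e : - sdg a + n = m)
  (g : hom (F Y) X n) : hom Y (trm a) m := full env (comp e (prj a) g).

Lemma component_lin a Y n m (e : - sdg a + n = m) : linear (@component a Y n m e).
Proof. by apply: (lin_app (@full_lin _ _ _)); apply: comp_linr. Qed.

Lemma component_comp (a : idx env X) (Y Y' : C) n m i j k (e : - sdg a + n = m)
    (e1 : n + i = j) (e2 : - sdg a + j = k) (e3 : m + i = k)
    (g : hom (F Y) X n) (f : hom Y' Y i) :
  component e2 (comp e1 g (fhom F f)) = comp e3 (component e g) f.
Proof.
by rewrite /component -(compA e e3) full_comp fhomK.
Qed.

(** The deviation from a chain map comes from the differential of the projection. *)
Lemma component_dd (a : idx env X) (Y : C) n m n' m' (e : - sdg a + n = m)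
    (e1 : n + io = n') (e2 : - sdg a + n' = m') (e3 : m + io = m')
    (e4 : io + n = n') (g : hom (F Y) X n) :
  dd e3 (component e g) = (-1) ^+ pairing io (sdg a) *:
    (component e2 (dd e1 g) - component e2 (comp e4 (tw env X) g)).
Proof.
rewrite /component -full_dd.
have h1 : - sdg a + io + n = m' by deg.
rewrite (dd_comp e e3 erefl h1 e1 e2) prj_dd.
rewrite (linN (comp_linl _ _)) (linZ (comp_linl _ _)) (compA _ h1 e4 e2) pairingNr.
rewrite (linD (@full_lin _ _ _)) (linN (@full_lin _ _ _)) !(linZ (@full_lin _ _ _)).
by rewrite scalerBr addrC.
Qed.

Lemma sum_component (Y : C) n (m : idx env X -> Gam) (e : forall a, - sdg a + n = m a)
    (e1 : forall a, sdg a + m a = n) (g : hom (F Y) X n) :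
  \sum_a comp (e1 a) (inj a) (fhom F (component (e a) g)) = g.
Proof.
have h (a : idx env X) : sdg a - sdg a = 0 := subrr (sdg a).
have hn : 0 + n = n by rewrite add0r.
rewrite -[RHS](comp1l hn) -(sum_inj_prj h) (lin_sum (comp_linl _ _)).
apply: eq_bigr => a _; rewrite /component fullK.
by rewrite (compA _ _ (e a) (e1 a)).
Qed.

Lemma component_twist (a b : idx env X) n m (e : - sdg a + n = m)
    (e1 : io + sdg b = n) : comp e (prj a) (comp e1 (tw env X) (inj b)) = 0 ->
  component e (comp e1 (tw env X) (inj b)) = 0.
Proof. by move=> h; rewrite /component h (lin0 (@full_lin _ _ _)). Qed.

End Envelope.

Section Spread.
Variables (G : ground) (C P E : dgCat G) (F : dgFun C P) (env : envelope F).
Variable N : bimod C E.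
Local Notation Gam := (gdeg G).
Local Notation R := (reg (fun_id P) F).
Local Notation L := (tens true R N).

Lemma deg_spread (d i : Gam) : d + (- d + i) = i.
Proof. by deg. Qed.
Lemma deg_spread_lact (d a b j : Gam) : a + b = j -> (- d + a) + b = - d + j.
Proof. by deg. Qed.

Variables (X : P) (Z : E) (i j : Gam).
Variable th : forall a : idx env X, N (trm a) Z (- sdg a + j) ->
  N (trm a) Z (- sdg a + i).

(** Write g (x) x = sum_a sigma_a (x) (pi_a g) x and apply th_a to the second factors.
The expression is balanced over C because components are right linear. *)
Definition spread_gen Y m n (e : m + n = j) (g : R X Y m) (x : N Y Z n) : L X Z i :=
  \sum_a telt true (deg_spread (sdg a) i) (inj a : R X (trm a) _)
    (th (lact (deg_spread_lact (sdg a) e) (component erefl (g : hom (F Y) X m)) x)).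

Definition spread : L X Z j -> L X Z i := tlift spread_gen.

Hypothesis th_lin : forall a, linear (@th a).

Lemma lin_bigsum (U V : lmodType (gring G)) (I : finType) (f : I -> U -> V) :
  (forall a, linear (f a)) -> linear (fun x => \sum_a f a x).
Proof.
move=> h c x y; rewrite scaler_sumr -big_split.
by apply: eq_bigr => a _; rewrite h.
Qed.

Lemma spread_gen_l Y m n (e : m + n = j) (x : N Y Z n) :
  linear (fun g : R X Y m => spread_gen e g x).
Proof.
apply: lin_bigsum => a; apply: (lin_app (telt_linr _ _ _)).
apply: (lin_app (@th_lin a)); apply: (lin_app (lact_linl _ _)).
exact: component_lin.
Qed.

Lemma spread_gen_r Y m n (e : m + n = j) (g : R X Y m) :
  linear (fun x : N Y Z n => spread_gen e g x).
Proof.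
apply: lin_bigsum => a; apply: (lin_app (telt_linr _ _ _)).
by apply: (lin_app (@th_lin a)); apply: lact_linr.
Qed.

Lemma spread_gen_bal Y Y' a b c ab bc (e1 : a + b = ab) (e2 : ab + c = j)
    (e3 : b + c = bc) (e4 : a + bc = j) (g : R X Y a) (f : hom Y' Y b)
    (x : N Y' Z c) : true ->
  spread_gen e2 (ract e1 g f) x = spread_gen e4 g (lact e3 f x).
Proof.
move=> _; apply: eq_bigr => d _; congr (telt _ _ _ (th _)).
have h : - sdg d + a + b = - sdg d + ab by rewrite -e1 addrA.
by rewrite (component_comp erefl e1 erefl h) (lactA h _ e3 (deg_spread_lact (sdg d) e4)).
Qed.

Lemma spread_lin : linear spread.
Proof. by apply: tlift_lin; [exact: spread_gen_l|exact: spread_gen_r|exact: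
  spread_gen_bal]. Qed.

Lemma spreadE Y m n (q : idx env X -> Gam) (e : m + n = j)
    (e1 : forall a, - sdg a + m = q a) (e2 : forall a, q a + n = - sdg a + j)
    (g : R X Y m) (x : N Y Z n) :
  spread (telt true e g x : L X Z j) =
  \sum_a telt true (deg_spread (sdg a) i) (inj a : R X (trm a) _)
    (th (lact (e2 a) (component (e1 a) (g : hom (F Y) X m)) x)).
Proof.
rewrite /spread tliftE; [|exact: spread_gen_l|exact: spread_gen_r|exact: spread_gen_bal].
apply: eq_bigr => a _; congr (telt _ _ _ (th _)).
move: (e1 a) (e2 a); move: (q a) => qa; case: _ / => e3.
by rewrite (eq_irrelevance (deg_spread_lact _ _) e3).
Qed.

End Spread.

Lemma sumrD (V : zmodType) (I : finType) (f g : I -> V) :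
  \sum_a f a + \sum_a g a = \sum_a (f a + g a).
Proof. by rewrite big_split. Qed.

(** * The contraction of the left tensor product *)

Section InducedContraction.
Variables (G : ground) (C P E : dgCat G) (F : dgFun C P) (env : envelope F).
Variables (N : bimod C E) (k : contraction N).
Local Notation Gam := (gdeg G).
Local Notation R := (reg (fun_id P) F).
Local Notation L := (tens true R N).

(** This is sum_a sigma_a pi_a = 1. *)
Lemma spread_id (X : P) (Z : E) j (x : L X Z j) :
  @spread _ _ _ _ _ env N X Z j j (fun a m => m) x = x.
Proof.
move: x; apply: tens_telt_ext => [||Y m n e g x].
- by apply: spread_lin => a; apply: lin_id.
- exact: lin_id.
rewrite (spreadE _ e (fun a => erefl) (fun a => deg_spread_lact (sdg a) e)); last first.
  by move=> a; apply: lin_id.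
have h (a : idx env X) : sdg a + (- sdg a + m) = m := deg_spread _ _.
have hg := sum_component (fun a => erefl) h (g : hom (F Y) X m).
apply: (etrans _ (congr1 (fun g' => telt true e (g' : R X Y m) x) hg)).
rewrite (lin_sum (telt_linl true e x)); apply: eq_bigr => a _; symmetry.
exact: (@telt_bal _ true _ _ _ R N X (trm a) Y Z _ _ _ _ _ _ (h a) e _ _
  (inj a : R X (trm a) _) (component erefl (g : hom (F Y) X m)) x isT).
Qed.

(** The case of [spread_id] with prescribed names for the degrees. *)
Lemma telt_sum_inj X Y Z j m n (q q' : idx env X -> Gam) (e0 : m + n = j)
    (e1 : forall a, - sdg a + m = q a) (e2 : forall a, q a + n = q' a)
    (e3 : forall a, sdg a + q' a = j) (g : R X Y m) (x : N Y Z n) :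
  telt true e0 g x = \sum_a telt true (e3 a) (inj a : R X (trm a) _)
    (lact (e2 a) (component (e1 a) (g : hom (F Y) X m)) x) :> L X Z j.
Proof.
rewrite -[LHS]spread_id.
have h a : q a + n = - sdg a + j by rewrite -(e1 a) -e0 addrA.
rewrite (spreadE _ e0 e1 h); last by move=> a; apply: lin_id.
apply: eq_bigr => a _.
have hq : q' a = - sdg a + j by rewrite -(e3 a) addKr.
move: (h a) (deg_spread (sdg a) j) (e2 a) (e3 a).
rewrite hq => {h} h1 h2 h3 h4.
by rewrite (eq_irrelevance h1 h3) (eq_irrelevance h2 h4).
Qed.

(** Every g (x) x is a sum of elements sigma_a (x) y, by [spread_id]. *)
Lemma inj_ext (X : P) (Z : E) j (V : lmodType (gring G)) (f g : L X Z j -> V) :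
  linear f -> linear g ->
  (forall (a : idx env X) n (e : sdg a + n = j) (y : N (trm a) Z n),
    f (telt true e (inj a : R X (trm a) _) y) =
    g (telt true e (inj a : R X (trm a) _) y)) ->
  forall x, f x = g x.
Proof.
move=> Hf Hg h x; rewrite -[x]spread_id; move: x; apply: tens_telt_ext.
- by apply: (lin_app Hf); apply: spread_lin => a; apply: lin_id.
- by apply: (lin_app Hg); apply: spread_lin => a; apply: lin_id.
move=> Y m n e g' x.
rewrite (spreadE _ e (fun a => erefl) (fun a => deg_spread_lact (sdg a) e)); last first.
  by move=> a; apply: lin_id.
by rewrite (lin_sum Hf) (lin_sum Hg); apply: eq_bigr => a _; apply: h.
Qed.

Lemma deg_spread_htp (d i j : Gam) : i + io = j -> (- d + i) + io = - d + j.
Proof. by deg. Qed.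

(** The operator S: sigma_a (x) y |-> +-sigma_a (x) s(y). The sign is the one which d
acquires in passing sigma_a. *)
Definition spread_htp X Z i j (e : i + io = j) : L X Z j -> L X Z i :=
  @spread _ _ _ _ _ env N X Z i j (fun a m =>
    (-1) ^+ pairing io (sdg a) *: htp k (deg_spread_htp (sdg a) e) m).

Definition spread_aug X Z j : L X Z j -> L X Z j :=
  @spread _ _ _ _ _ env N X Z j j (fun a m => aug k m).

Definition twist_act (X : P) Z i j (e : i + io = j) : L X Z i -> L X Z j :=
  lact (deg_twl e) (tw env X).

Lemma spread_htp_coef_lin (X : P) Z i j (e : i + io = j) (a : idx env X) :
  linear (fun m : N (trm a) Z (- sdg a + j) =>
    (-1) ^+ pairing io (sdg a) *: htp k (deg_spread_htp (sdg a) e) m).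
Proof. by apply: lin_scale; apply: htp_lin. Qed.

Lemma spread_htp_lin X Z i j (e : i + io = j) : linear (@spread_htp X Z i j e).
Proof. by apply: spread_lin => a; apply: spread_htp_coef_lin. Qed.

Lemma spread_aug_lin X Z j : linear (@spread_aug X Z j).
Proof. by apply: spread_lin => a; apply: aug_lin. Qed.

Lemma twist_act_lin X Z i j (e : i + io = j) : linear (@twist_act X Z i j e).
Proof. exact: lact_linr. Qed.

Lemma spread_htpE X Y Z i j m n (q q' : idx env X -> Gam) (e : i + io = j) (e0 : m + n
  = j)
    (e1 : forall a, - sdg a + m = q a) (e2 : forall a, q a + n = q' a + io)
    (e3 : forall a, sdg a + q' a = i) (g : R X Y m) (x : N Y Z n) :
  spread_htp e (telt true e0 g x : L X Z j) =
  \sum_a (-1) ^+ pairing io (sdg a) *: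
    telt true (e3 a) (inj a : R X (trm a) _)
    (htp k erefl (lact (e2 a) (component (e1 a) (g : hom (F Y) X m)) x)).
Proof.
have h a : q a + n = - sdg a + j by rewrite -(e1 a) -e0 addrA.
rewrite /spread_htp (spreadE _ e0 e1 h); last by move=> a; apply: spread_htp_coef_lin.
apply: eq_bigr => a _; rewrite (linZ (telt_linr _ _ _)); congr (_ *: _).
have hq : q' a = - sdg a + i by rewrite -(e3 a) addKr.
move: (deg_spread_htp (sdg a) e) (h a) (deg_spread (sdg a) i) (e2 a) (e3 a).
rewrite hq => {h} f1; case: _ / f1 => h1 h2 h3 h4.
by rewrite (eq_irrelevance h1 h3) (eq_irrelevance h2 h4).
Qed.

Lemma spread_augE X Y Z j m n (q q' : idx env X -> Gam) (e0 : m + n = j)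
    (e1 : forall a, - sdg a + m = q a) (e2 : forall a, q a + n = q' a)
    (e3 : forall a, sdg a + q' a = j) (g : R X Y m) (x : N Y Z n) :
  spread_aug (telt true e0 g x : L X Z j) =
  \sum_a telt true (e3 a) (inj a : R X (trm a) _)
    (aug k (lact (e2 a) (component (e1 a) (g : hom (F Y) X m)) x)).
Proof.
have h a : q a + n = - sdg a + j by rewrite -(e1 a) -e0 addrA.
rewrite /spread_aug (spreadE _ e0 e1 h); last by move=> a; apply: aug_lin.
apply: eq_bigr => a _.
have hq : q' a = - sdg a + j by rewrite -(e3 a) addKr.
move: (h a) (deg_spread (sdg a) j) (e2 a) (e3 a).
rewrite hq => {h} h1 h2 h3 h4.
by rewrite (eq_irrelevance h1 h3) (eq_irrelevance h2 h4).
Qed.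

Lemma spread_aug_htp X' X Z a i j n (e : i + io = j) (e1 : a + i = n)
    (f : hom X X' a) (x : L X Z j) : spread_aug (lact e1 f (spread_htp e x)) = 0.
Proof.
move: x; apply: tens_telt_ext => [||Y m p e0 g x].
- apply: (lin_app (@spread_aug_lin _ _ _)); apply: (lin_app (lact_linr _ _)).
  exact: spread_htp_lin.
- exact: lin_zero.
have h1 (c : idx env X) : - sdg c + m = - sdg c + m by [].
have h2 (c : idx env X) : - sdg c + m + p = (- sdg c + i) + io.
  by rewrite -addrA e0 -e addrA.
rewrite (spread_htpE e e0 h1 h2 (fun c => deg_spread _ _)).
rewrite (lin_sum (lact_linr _ _)) (lin_sum (@spread_aug_lin _ _ _)) big1 // => c _.
rewrite (linZ (lact_linr _ _)) (linZ (@spread_aug_lin _ _ _)).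
have h3 := deg_la (deg_spread (sdg c) i) e1.
rewrite (lact_telt e1 _ erefl h3).
rewrite (spread_augE h3 (fun _ => erefl) (fun d => deg_spread_lact (sdg d) h3) (fun d
  => deg_spread _ _)).
by rewrite big1 ?scaler0 // => d _; rewrite aug_htp (lin0 (telt_linr _ _ _)).
Qed.

(** The Maurer-Cartan equation. In Pretr(C) the differential of the twist is its
square, with a positive sign. *)
Lemma twist_act_dd X Z i j n (e : i + io = j) (e' : j + io = n) (x : L X Z i) :
  dd e' (twist_act e x) + twist_act e' (dd e x) = twist_act e' (twist_act e x).
Proof.
have h1 : io + io + i = n by deg.
rewrite /twist_act (dd_lact _ e' erefl h1 e (deg_twl e')) pairing_io sgr1 subrK.
by rewrite tw_dd (lactA _ h1 (deg_twl e) (deg_twl e')).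
Qed.

(** On each summand this is the relation for the contraction of N. The differentials
of sigma_a and pi_a contribute the twist, once outside and once inside of S. *)
Lemma spread_htp_dd X Z i j n (e : i + io = j) (e' : j + io = n) (x : L X Z j) :
  dd e (spread_htp e x) + spread_htp e' (dd e' x) =
  x - spread_aug x + twist_act e (spread_htp e x) + spread_htp e' (twist_act e' x).
Proof.
move: x; apply: tens_telt_ext => [||Y m p e0 g x].
- apply: lin_add; first by apply: (lin_app (dd_lin _)); apply: spread_htp_lin.
  by apply: (lin_app (@spread_htp_lin _ _ _ _ _)); apply: dd_lin.
- apply: lin_add; last by apply: (lin_app (@spread_htp_lin _ _ _ _ _));
  apply: twist_act_lin.
  apply: lin_add; last by apply: (lin_app (@twist_act_lin _ _ _ _ _));
    apply: spread_htp_lin.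
  by apply: lin_add; last by apply: lin_opp; apply: spread_aug_lin.
have h1 (c : idx env X) : - sdg c + m = - sdg c + m by [].
have h2 (c : idx env X) : - sdg c + m + p = (- sdg c + i) + io.
  by rewrite -addrA e0 -e addrA.
have h3 := deg_dl e0 e'.
have h4 := deg_dr e0 e'.
pose w (c : idx env X) := - sdg c + i + io.
have h5 (c : idx env X) : - sdg c + (m + io) + p = w c + io.
  by rewrite -addrA h3 -e' -e !addrA.
have h6 (c : idx env X) : - sdg c + m + (p + io) = w c + io.
  by rewrite -addrA h4 -e' -e !addrA.
have h7 : io + m + p = n by rewrite (addrC io).
have h8 : io + m = m + io by rewrite addrC.
have h10 (c : idx env X) : sdg c + w c = j by rewrite /w addrA deg_spread.
rewrite (dd_telt e' e0 erefl h3 erefl h4) (linD (@spread_htp_lin _ _ _ _ _)).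
rewrite (linZ (@spread_htp_lin _ _ _ _ _)) [twist_act e' _](lact_telt _ e0 h8 h3).
rewrite (spread_htpE e e0 h1 h2 (fun c => deg_spread _ _)).
rewrite !(spread_htpE e' h3 (fun c => erefl) h5 h10) (spread_htpE e' h4 h1 h6 h10).
rewrite (spread_augE e0 h1 h2 h10) -[in RHS](spread_id (telt _ e0 g x)) spread_id.
rewrite [X in X - _](telt_sum_inj e0 h1 h2 h10).
rewrite (lin_sum (dd_lin _)) (lin_sum (@twist_act_lin _ _ _ _ _)) scaler_sumr.
rewrite -!sumrN !sumrD; apply: eq_bigr => c _; cbv beta.
have h11 : sdg c + io + (- sdg c + i) = j by rewrite -(h10 c) /w; deg.
have h12 : io + sdg c = sdg c + io by rewrite addrC.
rewrite (linZ (dd_lin _)) (dd_telt e (deg_spread (sdg c) i) erefl h11 erefl (h10 c)).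
rewrite (linZ (@twist_act_lin _ _ _ _ _)) [twist_act e _](lact_telt _ (deg_spread (sdg
  c) i) h12 h11).
have -> : dd erefl (inj c : R X (trm c) _) = lact h12 (tw env X) (inj c : R X (trm c) _).
  exact: inj_dd.
rewrite scalerDr sgrD addbb sgr0.
set y := lact (h2 c) _ x.
have h13 : w c + io = w c + io by [].
have h14 : - sdg c + m + io = - sdg c + (m + io) by rewrite addrA.
have hy : dd h13 y = (-1) ^+ pairing io (sdg c) *:
    (lact (h5 c) (component erefl (dd erefl g)) x -
     lact (h5 c) (component erefl (comp h8 (tw env X) g)) x) +
    (-1) ^+ (pairing io (sdg c) (+) pairing io m) *:
      lact (h6 c) (component (h1 c) g) (dd erefl x).
  rewrite /y (dd_lact (h2 c) h13 h14 (h5 c) erefl (h6 c)).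
  rewrite (component_dd (h1 c) erefl erefl h14 h8) pairingDr pairingNr.
  by rewrite (linZ (lact_linl _ _)) (linB (lact_linl _ _)).
have := congr1 (fun z => telt true (h10 c) (inj c : R X (trm c) _) z)
  (htp_dd k erefl h13 y).
rewrite hy !(linD (htp_lin _ _)) !(linZ (htp_lin _ _)) !(linB (htp_lin _ _)).
rewrite !(linD (telt_linr _ _ _)) !(linN (telt_linr _ _ _)) !(linZ (telt_linr _ _ _)).
rewrite !(linB (telt_linr _ _ _)).
rewrite (eq_irrelevance h13 erefl).
move=> hh; apply: (eq_shift hh).
case: (pairing io (sdg c)); case: (pairing io m); rewrite [_ (+) _]/= ?sgr0 ?sgr1; zmod.
Qed.

Local Notation tpert X Z j := (@pert G (L X Z) (@twist_act X Z) (@spread_htp X Z) j).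
Local Notation tresolvent X Z j := (@resolvent G (L X Z) (@twist_act X Z) (@spread_htp
  X Z) #|idx env X| j).

Lemma tpert_inj X Z j (b : idx env X) m (q q' : idx env X -> Gam) (e : sdg b + m = j)
    (e1 : forall a, - sdg a + (io + sdg b) = q a)
    (e2 : forall a, q a + m = q' a + io) (e3 : forall a, sdg a + q' a = j)
    (y : N (trm b) Z m) :
  tpert X Z j (telt true e (inj b : R X (trm b) _) y : L X Z j) =
  \sum_a (-1) ^+ pairing io (sdg a) *:
    telt true (e3 a) (inj a : R X (trm a) _)
    (htp k erefl (lact (e2 a)
      (component (e1 a) (comp erefl (tw env X) (inj b))) y)).
Proof.
have h : io + sdg b + m = j + io by deg.
rewrite /pert [twist_act _ _](lact_telt _ e erefl h).
exact: (spread_htpE _ h e1 e2 e3).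
Qed.

(** Each application of S alpha lowers the height of the index. *)
Lemma tpert_nil X Z j (x : L X Z j) : iter #|idx env X| (tpert X Z j) x = 0 :> L X Z j.
Proof.
have [ht [hlt hdec]] := height env X.
(* n more steps suffice from height at least #|idx env X| - n *)
suff nil n : forall j (b : idx env X) m (e : sdg b + m = j) (y : N (trm b) Z m),
    (#|idx env X| <= n + ht b)%N ->
    iter n (tpert X Z j) (telt true e (inj b : R X (trm b) _) y) = 0.
  move: x; apply: inj_ext => [||a n e y]; last by rewrite nil ?leq_addr.
  - exact: (iter_pert_lin (@twist_act_lin X Z) (@spread_htp_lin X Z)).
  - exact: lin_zero.
elim: n => [|n IH] j' b m e y hn.
  by move: (hlt b); rewrite ltnNge hn.
have h2 (a : idx env X) : - sdg a + (io + sdg b) + m = - sdg a + j' + io by rewrite -e;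
  deg.
have hl : linear (iter n (tpert X Z j')).
  exact: (iter_pert_lin (@twist_act_lin X Z) (@spread_htp_lin X Z)).
rewrite iterSr (tpert_inj e (fun a => erefl) h2 (fun a => deg_spread _ _)).
rewrite (lin_sum hl) big1 // => a _.
rewrite (linZ hl).
case: (boolP (ht b < ht a)%N) => hab.
  rewrite IH ?scaler0 //; apply: leq_trans hn _.
  by rewrite addSnnS leq_add2l.
rewrite component_twist; last by apply: hdec.
by rewrite (lin0 (lact_linl _ _)) (lin0 (htp_lin _ _)) (lin0 (telt_linr _ _ _))
  (lin0 hl) scaler0.
Qed.

Section RightLinear.
Variables (X : P) (Z Z' : E) (a : Gam) (g : hom Z' Z a).

Lemma spread_htp_ract i j l n (e : i + io = j) (e1 : j + a = n) (e2 : l + io = n)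
    (e3 : i + a = l) (x : L X Z j) :
  spread_htp e2 (ract e1 x g) = ract e3 (spread_htp e x) g.
Proof.
move: x; apply: tens_telt_ext => [||Y m p e0 f x].
- by apply: (lin_app (@spread_htp_lin _ _ _ _ _)); apply: ract_linl.
- by apply: (lin_app (ract_linl _ _)); apply: spread_htp_lin.
have h1 (c : idx env X) : - sdg c + m = - sdg c + m by [].
have h2 (c : idx env X) : - sdg c + m + p = - sdg c + i + io.
  by rewrite -addrA e0 -e addrA.
have h3 := deg_ra e0 e1.
have h4 (c : idx env X) : - sdg c + m + (p + a) = - sdg c + l + io.
  by rewrite -addrA h3 -e2 addrA.
rewrite (ract_telt e1 e0 erefl h3) (spread_htpE e e0 h1 h2 (fun c => deg_spread _ _)).
rewrite (spread_htpE e2 h3 h1 h4 (fun c => deg_spread _ _)) (lin_sum (ract_linl _ _)).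
apply: eq_bigr => c _; rewrite (linZ (ract_linl _ _)); congr (_ *: _).
have h5 : - sdg c + i + a = - sdg c + l by rewrite -addrA e3.
rewrite (ract_telt e3 (deg_spread (sdg c) i) h5 (deg_spread (sdg c) l)); congr telt.
have h6 : - sdg c + i + io + a = - sdg c + l + io by rewrite addrAC h5.
by rewrite -(htp_ract k erefl h6 erefl h5) (lractA (h2 c) h6 erefl (h4 c)).
Qed.

Lemma spread_aug_ract j n (e1 : j + a = n) (x : L X Z j) :
  spread_aug (ract e1 x g) = ract e1 (spread_aug x) g.
Proof.
move: x; apply: tens_telt_ext => [||Y m p e0 f x].
- by apply: (lin_app (@spread_aug_lin _ _ _)); apply: ract_linl.
- by apply: (lin_app (ract_linl _ _)); apply: spread_aug_lin.
have h1 (c : idx env X) : - sdg c + m = - sdg c + m by [].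
have h2 (c : idx env X) : - sdg c + m + p = - sdg c + j by rewrite -addrA e0.
have h3 := deg_ra e0 e1.
have h4 (c : idx env X) : - sdg c + m + (p + a) = - sdg c + n by rewrite -addrA h3.
rewrite (ract_telt e1 e0 erefl h3) (spread_augE e0 h1 h2 (fun c => deg_spread _ _)).
rewrite (spread_augE h3 h1 h4 (fun c => deg_spread _ _)) (lin_sum (ract_linl _ _)).
apply: eq_bigr => c _.
have h5 : - sdg c + j + a = - sdg c + n by rewrite -addrA e1.
rewrite (ract_telt e1 (deg_spread (sdg c) j) h5 (deg_spread (sdg c) n)); congr telt.
by rewrite -(aug_ract k h5) (lractA (h2 c) h5 erefl (h4 c)).
Qed.

Lemma twist_act_ract i j l n (e : i + io = j) (e1 : j + a = n) (e2 : l + io = n)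
    (e3 : i + a = l) (x : L X Z i) :
  twist_act e2 (ract e3 x g) = ract e1 (twist_act e x) g.
Proof. by symmetry; apply: lractA. Qed.

Lemma iter_pert_ract n i l (e : i + a = l) (x : L X Z i) :
  iter n (tpert X Z' l) (ract e x g) =
  ract e (iter n (tpert X Z i) x) g.
Proof.
elim: n => [//|n IH]; rewrite !iterS IH {1}/pert.
have h : i + io + a = l + io by rewrite -e addrAC.
by rewrite (twist_act_ract erefl h) (spread_htp_ract erefl h erefl e).
Qed.

Lemma tresolvent_ract i l (e : i + a = l) (x : L X Z i) :
  tresolvent X Z' l (ract e x g) = ract e (tresolvent X Z i x) g.
Proof.
rewrite /resolvent (lin_sum (ract_linl _ _)); apply: eq_bigr => n _.
by rewrite (linZ (ract_linl _ _)) iter_pert_ract.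
Qed.

End RightLinear.

Definition ind_htp X Z i j (e : i + io = j) (x : L X Z j) : L X Z i :=
  tresolvent X Z i (spread_htp e x).
Definition ind_aug X Z j (x : L X Z j) : L X Z j := tresolvent X Z j (spread_aug x).

Lemma tresolvent_lin X Z j : linear (tresolvent X Z j).
Proof. exact: (resolvent_lin _ (@twist_act_lin X Z) (@spread_htp_lin X Z)). Qed.

Lemma ind_htp_lin X Z i j (e : i + io = j) : linear (@ind_htp X Z i j e).
Proof. by apply: (lin_app (@tresolvent_lin _ _ _)); apply: spread_htp_lin. Qed.

Lemma ind_aug_lin X Z j : linear (@ind_aug X Z j).
Proof. by apply: (lin_app (@tresolvent_lin _ _ _)); apply: spread_aug_lin. Qed.

Lemma ind_htp_ract X Z Z' i j a n l (e : i + io = j) (e1 : j + a = n)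
    (e2 : l + io = n) (e3 : i + a = l) (x : L X Z j) (g : hom Z' Z a) :
  ind_htp e2 (ract e1 x g) = ract e3 (ind_htp e x) g.
Proof. by rewrite /ind_htp (spread_htp_ract _ e _ _ e3) tresolvent_ract. Qed.

Lemma ind_aug_ract X Z Z' j a n (e : j + a = n) (x : L X Z j) (g : hom Z' Z a) :
  ind_aug (ract e x g) = ract e (ind_aug x) g.
Proof. by rewrite /ind_aug spread_aug_ract tresolvent_ract. Qed.

Lemma ind_htp_dd X Z i j n (e : i + io = j) (e' : j + io = n) (x : L X Z j) :
  dd e (ind_htp e x) + ind_htp e' (dd e' x) = x - ind_aug x.
Proof.
apply: (perturbation (@twist_act_lin X Z) (@spread_htp_lin X Z) (@tpert_nil X Z)
  (@twist_act_dd X Z) (@spread_htp_dd X Z)) => i1 j1 e1 x1.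
exact: spread_aug_htp.
Qed.

Lemma ind_aug_htp X' X Z a i j n (e : i + io = j) (e1 : a + i = n)
    (f : hom X X' a) (x : L X Z j) : ind_aug (lact e1 f (ind_htp e x)) = 0.
Proof.
rewrite /ind_htp (resolvent_S (@twist_act_lin X Z) (@spread_htp_lin X Z) (@tpert_nil X
  Z)).
by rewrite /ind_aug spread_aug_htp (lin0 (@tresolvent_lin _ _ _)).
Qed.

(** The perturbation lemma, with A the left action of the twist. *)
Definition ind_contraction : contraction L :=
  Contraction ind_htp_lin ind_aug_lin ind_htp_ract ind_aug_ract ind_htp_dd ind_aug_htp.

End InducedContraction.

(** * The perturbed diagonal element *)

Section Unit.
Variables (G : ground) (C P : dgCat G) (F : dgFun C P) (env : envelope F).
Local Notation Gam := (gdeg G).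
Local Notation R := (reg (fun_id P) F).
Local Notation R' := (reg F (fun_id P)).
Local Notation B := (bar C).
Local Notation L := (tens true R B).
Local Notation W := (tens true L R').

Definition barl_contr : contraction L := ind_contraction env (bar_contraction C).
Local Notation kL := barl_contr.
Definition barp_contr : contraction W := tens_contraction R' kL.
Local Notation kW := barp_contr.

Definition inj_unit X (a : idx env X) : L X (trm a) (sdg a) :=
  telt true (addr0 (sdg a)) (inj a : R X (trm a) _) (bar_unit (trm a)).

Definition pert_inj_unit X (a : idx env X) : L X (trm a) (sdg a) :=
  resolvent (@twist_act _ _ _ _ _ env B X (trm a))
    (@spread_htp _ _ _ _ _ env B (bar_contraction C) X (trm a))
    #|idx env X| (inj_unit a).

Definition diag_unit X : W X X 0 :=
  \sum_a telt true (subrr (sdg a)) (inj_unit a) (prj a : R' (trm a) X _).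

Definition pert_diag_unit X : W X X 0 :=
  \sum_a telt true (subrr (sdg a)) (pert_inj_unit a) (prj a : R' (trm a) X _).

(** Decompose f sigma_b as sum_c sigma_c (pi_c f sigma_b): the augmentation carries
the morphism pi_c f sigma_b of C to the right of [1, 1]. *)
Lemma aug_lact_inj_unit X X' (b : idx env X) n j (e : n + sdg b = j) (f : hom X X' n)
    (m : idx env X' -> Gam) (e1 : forall c, - sdg c + j = m c)
    (e2 : forall c, sdg c + m c = j) :
  aug kL (lact e f (inj_unit b)) =
  \sum_c ract (e2 c) (pert_inj_unit c) (component (e1 c) (comp e f (inj b))).
Proof.
have h1 : j + 0 = j by rewrite addr0.
rewrite (lact_telt e _ e h1).
have e3 c : m c + 0 = m c by rewrite addr0.
have e4 c : 0 + m c = m c by rewrite add0r.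
rewrite [LHS]/= /ind_aug (spread_augE _ h1 e1 e3 e2).
rewrite (lin_sum (@tresolvent_lin _ _ _ _ _ env _ (bar_contraction C) _ _ _));
  apply: eq_bigr => c _.
rewrite -[RHS](tresolvent_ract env (bar_contraction C) _ (e2 c)); congr resolvent.
rewrite (ract_telt (e2 c) (addr0 (sdg c)) (e4 c) (e2 c)); congr telt.
have h2 : 0 + 0 = 0 :> Gam by rewrite addr0.
rewrite -{1}[bar_unit (trm b)](ract1 h2).
by rewrite [LHS](bar_aug_unit (e3 c) h2 (e3 c) (e4 c)) comp1r.
Qed.

(** After [aug_lact_inj_unit], the components pi_c f sigma_b pass to the right factor
over C, where sum_b sigma_b pi_b = 1. *)
Lemma aug_lact_diag_unit X Y a j (e : a + 0 = j) (e1 : 0 + a = j) (f : hom Y X a) :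
  aug kW (lact e f (diag_unit Y)) = ract e1 (pert_diag_unit X) f.
Proof.
rewrite (lin_sum (lact_linr _ _)) (lin_sum (aug_lin kW)) (lin_sum (ract_linl _ _)).
have h1 (b : idx env Y) : a + sdg b - sdg b = j by rewrite -addrA subrr.
have h2 (b : idx env Y) (c : idx env X) : sdg c + (- sdg c + (a + sdg b)) = a + sdg b.
  exact: deg_spread.
transitivity (\sum_(b : idx env Y) \sum_(c : idx env X)
  telt true (h1 b) (ract (h2 b c) (pert_inj_unit c)
    (component erefl (comp erefl f (inj b)))) (prj b : R' (trm b) Y _) : W X Y j).
  apply: eq_bigr => b _.
  rewrite (lact_telt e (subrr _) erefl (h1 b)) [LHS]tens_augE.
  rewrite (aug_lact_inj_unit _ _ (fun c => erefl) (h2 b)).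
  exact: (lin_sum (telt_linl true _ _)).
rewrite exchange_big; apply: eq_bigr => c _.
have h3 : - sdg c + a = - sdg c + a by [].
have h4 : sdg c + (- sdg c + a) = j by rewrite -e1 add0r deg_spread.
have h5 (b : idx env Y) : - sdg c + (a + sdg b) - sdg b = - sdg c + a by deg.
rewrite (ract_telt e1 (subrr _) h3 h4).
transitivity (telt true h4 (pert_inj_unit c) (\sum_(b : idx env Y)
  lact (h5 b) (component erefl (comp erefl f (inj b))) (prj b : R' (trm b) Y _)) : W X
    Y j).
  rewrite (lin_sum (telt_linr true _ _)); apply: eq_bigr => b _.
  exact: telt_bal.
congr telt.
have h6 (b : idx env Y) : sdg b - sdg b = 0 by rewrite subrr.
have h7 : a + 0 = a by rewrite addr0.
have h8 : - sdg c + a + 0 = - sdg c + a by rewrite addr0.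
rewrite [RHS]/= /reg_ract /= -[RHS](comp1r h8) -(sum_inj_prj h6).
rewrite (lin_sum (comp_linr _ _)); apply: eq_bigr => b _.
rewrite /= /reg_lact /component fullK.
have h9 : - sdg c + a + sdg b = - sdg c + (a + sdg b) by rewrite addrA.
by rewrite -(compA h3 h9 erefl erefl) (compA h9 (h5 b) (h6 b) h8).
Qed.

Lemma aug_diag_unit X : aug kW (diag_unit X) = pert_diag_unit X.
Proof.
have h : 0 + 0 = 0 :> Gam by rewrite addr0.
by have := aug_lact_diag_unit h h (idm X); rewrite lact1 ract1.
Qed.

Lemma aug_lact_pert_diag_unit X Y a j (e : a + 0 = j) (e1 : 0 + a = j) (f : hom Y X a) :
  aug kW (lact e f (pert_diag_unit Y)) = (-1) ^+ pairing 0 a *: ract e1 (pert_diag_unit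
    X) f.
Proof. by rewrite pairing0l sgr0 -aug_diag_unit aug_lact_aug aug_lact_diag_unit. Qed.

(** The differentials of sigma_a and pi_a contribute the twist on either side. *)
Lemma diag_unit_dd X i (e : 0 + io = i) (e1 : io + 0 = i) :
  dd e (diag_unit X) = lact e1 (tw env X) (diag_unit X) - ract e (diag_unit X) (tw env X).
Proof.
rewrite (lin_sum (dd_lin _)) (lin_sum (lact_linr _ _)) (lin_sum (ract_linl _ _)).
rewrite -sumrN sumrD; apply: eq_bigr => a _.
have h1 : sdg a + io - sdg a = i by rewrite -e; deg.
have h2 : sdg a + (- sdg a + io) = i by rewrite deg_spread -e add0r.
have h3 : io + sdg a = sdg a + io by rewrite addrC.
have h4 : sdg a + io + 0 = sdg a + io by rewrite addr0.
have h5 : sdg a + io = sdg a + (0 + io) by rewrite add0r.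
rewrite (dd_telt e (subrr _) erefl h1 erefl h2).
rewrite (lact_telt e1 (subrr _) h3 h1) (ract_telt e (subrr _) erefl h2).
congr (_ + _).
  congr telt; rewrite /inj_unit (dd_telt erefl _ erefl h4 erefl (esym h5)).
  rewrite bar_unit_dd (lin0 (telt_linr _ _ _)) scaler0 addr0.
  rewrite (lact_telt h3 _ h3 h4); congr telt.
  exact: inj_dd.
rewrite [dd _ (_ : R' _ _ _)]prj_dd (linN (telt_linr _ _ _)) (linZ (telt_linr _ _ _)).
by rewrite scalerN sgrD addbb sgr0.
Qed.

(** The augmentation of the commutator with the twist in [diag_unit_dd] is zero,
because the augmentation carries left multiplication of the diagonal to right
multiplication. *)
Lemma pert_diag_unit_dd X i (e : 0 + io = i) : dd e (pert_diag_unit X) = 0.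
Proof.
have h : io + 0 = i by rewrite addrC.
rewrite -aug_diag_unit -aug_dd (diag_unit_dd _ e h) (linB (aug_lin kW)) aug_ract
  aug_diag_unit.
by rewrite (aug_lact_diag_unit h e) subrr.
Qed.

End Unit.

(** * The homotopy equivalence *)

Section Equivalence.
Variables (G : ground) (C P : dgCat G) (F : dgFun C P) (env : envelope F).
Local Notation Gam := (gdeg G).
Local Notation R := (reg (fun_id P) F).
Local Notation R' := (reg F (fun_id P)).
Local Notation L := (tens true R (bar C)).
Local Notation W := (tens true L R').
Local Notation kL := (barl_contr env).
Local Notation kW := (barp_contr env).
Local Notation pert_diag_unit := (pert_diag_unit env).

Lemma bim_zero_closed (D E : dgCat G) (M N : bimod D E) l : bim_closed (bim_zero M N l).
Proof. by move=> X Y i i' j k e1 e2 e3 e4 m; apply: bim_zero_diff. Qed.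

Lemma aug_bim_zero (D E : dgCat G) (M N : bimod D E) (k : contraction N) l X Z i j
  (e : l + i = j) (x : M X Z i) : aug k (bh (bim_zero M N l) e x) = 0.
Proof. exact: (lin0 (aug_lin k)). Qed.

(** The comparison map with theta = 0. *)
Definition Xi_map : bimHom (bar P) W 0 :=
  comparison kW (add0r io) (bim_zero (bar P) W io) pert_diag_unit.

Lemma Xi_map_closed : bim_closed Xi_map.
Proof.
move=> X Y i i' j k e1 e2 e3 e4 m.
have e5 : io + i = k by rewrite -e2 -e1 add0r addrC.
rewrite (comparison_diff _ (@bim_zero_closed _ _ _ _ _) (fun X Z i j e x =>
  aug_bim_zero _ e x)
  (pert_diag_unit_dd env) (aug_lact_pert_diag_unit env) _ _ _ _ e5) //.
Qed.

Lemma Xi_map_unit X (e : 0 + 0 = 0) : bh Xi_map e (bar_unit X) = pert_diag_unit X.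
Proof.
have e1 : io + 0 = io :> Gam by rewrite addr0.
rewrite /Xi_map (comparison_unit _ _ _ _ _ _ e1 (add0r io) erefl).
by rewrite [bh (bim_zero _ _ _) _ _]/= (lin0 (htp_lin kW _)) add0r.
Qed.

Lemma Xi_map_htp X Z i m j k (e : i + io = m) (e1 : 0 + i = j)
    (e2 : 0 + m = k) (e3 : j + io = k) (x : bar P X Z m) :
  bh Xi_map e1 (bar_htp e x) = htp kW e3 (bh Xi_map e2 x).
Proof.
have e4 : io + i = k by rewrite -e2 -e add0r addrC.
rewrite /Xi_map (comparison_htp _ _ _ _ _ _ e2 e3 e4) pairing0r sgr0.
by rewrite [bh (bim_zero _ _ _) _ _]/= add0r.
Qed.

Local Notation M' := (res (fun_id P) F (bar P)).
Local Notation M := (res F (fun_id C) M').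

Definition kM : contraction M :=
  res_contraction F (fun_id C) (res_contraction (fun_id P) F (bar_contraction P)).

(** The inclusion of Bar(C) into the restriction of Bar(P), obtained as a comparison
map. *)
Definition bar_emb : bimHom (bar C) M 0 :=
  comparison kM (add0r io) (bim_zero (bar C) M io) (fun Y => bar_unit (F Y)).

Lemma aug_emb_unit X Y a j (e : a + 0 = j) (e1 : 0 + a = j) (f : hom Y X a) :
  aug kM (lact e f (bar_unit (F Y) : M Y Y 0)) =
  (-1) ^+ pairing 0 a *: ract e1 (bar_unit (F X) : M X X 0) f.
Proof.
rewrite pairing0l sgr0 /=.
have h : 0 + 0 = 0 :> Gam by rewrite addr0.
have ej : a = j by rewrite -e addr0.
case: _ / ej e e1 => e e1.
have := bar_aug_unit e h e e1 (fhom F f) (idm (F Y)).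
by rewrite ract1 comp1r.
Qed.

Lemma bar_emb_closed : bim_closed bar_emb.
Proof.
move=> X Y i i' j k e1 e2 e3 e4 m.
have e5 : io + i = k by rewrite -e2 -e1 add0r addrC.
rewrite (comparison_diff (u := fun Y => bar_unit (F Y) : M Y Y 0) _ (@bim_zero_closed _
  _ _ _ _) (fun X Z i j e x => aug_bim_zero _ e x)
  (fun X' i1 e => bar_unit_dd (F X') e) aug_emb_unit _ _ _ _ e5) //.
Qed.

Lemma bar_emb_unit X (e : 0 + 0 = 0) : bh bar_emb e (bar_unit X) = bar_unit (F X).
Proof.
have e1 : io + 0 = io :> Gam by rewrite addr0.
rewrite /bar_emb (comparison_unit _ _ _ _ _ _ e1 (add0r io) erefl).
by rewrite [bh (bim_zero _ _ _) _ _]/= (lin0 (htp_lin kM _)) add0r.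
Qed.

Lemma bar_emb_htp X Z i m j k (e : i + io = m) (e1 : 0 + i = j)
    (e2 : 0 + m = k) (e3 : j + io = k) (x : bar C X Z m) :
  bh bar_emb e1 (bar_htp e x) = bar_htp e3 (bh bar_emb e2 x : bar P (F X) (F Z) k).
Proof.
have e4 : io + i = k by rewrite -e2 -e add0r addrC.
rewrite /bar_emb (comparison_htp _ _ _ _ _ _ e2 e3 e4) pairing0r sgr0.
by rewrite [bh (bim_zero _ _ _) _ _]/= add0r.
Qed.

Definition Psi_left : bimHom L M' 0 := induce_left bar_emb.
(** The extension of [bar_emb] to the target of Xi by the actions of P on both
sides. *)
Definition Psi_map : bimHom W (bar P) 0 := induce_right Psi_left.

Lemma Psi_map_closed : bim_closed Psi_map.
Proof. exact/induce_right_closed/induce_left_closed/bar_emb_closed. Qed.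

Lemma Psi_mapE X Y Z Z' i j m n k l (e : 0 + k = l) (e1 : i + j = m) (e2 : m + n = k)
    (e3 : 0 + j = j) (e4 : m + n = l) (g : R X Y i) (x : bar C Y Z j) (g' : R' Z Z' n) :
  bh Psi_map e (telt true e2 (telt true e1 g x : L X Z m) g') =
  ract e4 (lact e1 (g : hom (F Y) X i) (bh bar_emb e3 x : bar P (F Y) (F Z) j))
    (g' : hom Z' (F Z) n).
Proof.
have h : 0 + m = m by rewrite add0r.
by rewrite (induce_rightE _ _ _ e4 h) [bh Psi_left _ _](induce_leftE _ _ _ e1 e3).
Qed.

(** Psi carries the image of S to bars of positive length, where the augmentation
vanishes. *)
Lemma bar_aug_Psi_spread X' X Y Z i j n m k l (e : i + io = j) (e0 : i + n = m)
    (e1 : 0 + m = m) (e2 : k + m = l) (f : hom X X' k) (x : L X Y j) (g : R' Y Z n) :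
  bar_aug (lact e2 f (bh Psi_map e1 (telt true e0 (spread_htp env (bar_contraction C) e
    x) g))) = 0.
Proof.
move: x; apply: tens_telt_ext => [||V a b eab h x].
- apply: (lin_app (@bar_aug_lin _ _ _ _ _)); apply: (lin_app (lact_linr _ _)).
  apply: (lin_app (bh_lin Psi_map _)); apply: (lin_app (telt_linl _ _ _)).
  exact: spread_htp_lin.
- exact: lin_zero.
have h1 (c : idx env X) : - sdg c + a = - sdg c + a by [].
have h2 (c : idx env X) : - sdg c + a + b = - sdg c + i + io.
  by rewrite -addrA eab -e addrA.
rewrite (spread_htpE _ e eab h1 h2 (fun c => deg_spread _ _)).
rewrite (lin_sum (telt_linl _ _ _)) (lin_sum (bh_lin Psi_map _)).
rewrite (lin_sum (lact_linr _ _)) (lin_sum (@bar_aug_lin _ _ _ _ _)) big1 // => c _.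
rewrite (linZ (telt_linl _ _ _)) (linZ (bh_lin Psi_map _)).
rewrite (linZ (lact_linr _ _)) (linZ (@bar_aug_lin _ _ _ _ _)).
have h3 d : 0 + d = d :> Gam by rewrite add0r.
rewrite (Psi_mapE e1 (deg_spread (sdg c) i) e0 (h3 _) e0).
rewrite [bh bar_emb _ _](bar_emb_htp _ _ (h3 _) erefl).
have h4 : k + i + n = l by rewrite -e2 -e0 addrA.
rewrite -(lractA erefl h4) bar_aug_ract.
have h5 : k + sdg c + (- sdg c + i) = k + i by rewrite -addrA deg_spread.
rewrite -[lact erefl f _](lactA (b := bar P) erefl h5) bar_aug_htp.
by rewrite (lin0 (ract_linl _ _)) scaler0.
Qed.

Lemma bar_aug_Psi_htp X' X Z i j k l (e : i + io = j) (e1 : 0 + i = i) (e2 : k + i = l)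
    (f : hom X X' k) (x : W X Z j) :
  bar_aug (lact e2 f (bh Psi_map e1 (htp kW e x))) = 0.
Proof.
move: x; apply: tens_telt_ext => [||Y a b eab x g].
- apply: (lin_app (@bar_aug_lin _ _ _ _ _)); apply: (lin_app (lact_linr _ _)).
  by apply: (lin_app (bh_lin Psi_map _)); apply: htp_lin.
- exact: lin_zero.
rewrite [htp kW e _](tens_htpE _ e eab (deg_tens2 eab e) (deg_tens1 a)).
rewrite [htp kL _ _]/= /ind_htp.
rewrite (resolvent_S (@twist_act_lin _ _ _ _ _ env _ _ _)
  (@spread_htp_lin _ _ _ _ _ env _ (bar_contraction C) _ _)
  (@tpert_nil _ _ _ _ _ env _ (bar_contraction C) _ _)).
exact: bar_aug_Psi_spread.
Qed.

(** Modulo the image of S the perturbed diagonal is sum_a sigma_a (x) [1, 1] (x) pi_a,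
which Psi maps to sum_a sigma_a [1, 1] pi_a. *)
Lemma bar_aug_Psi_unit X Y k (e : k + 0 = k) (e1 : 0 + k = k) (e0 : 0 + 0 = 0)
    (f : hom Y X k) :
  bar_aug (lact e f (bh Psi_map e0 (pert_diag_unit Y))) = ract e1 (bar_unit X) f.
Proof.
rewrite (lin_sum (bh_lin Psi_map _)) (lin_sum (lact_linr _ _)).
rewrite (lin_sum (@bar_aug_lin _ _ _ _ _)).
have h1 (a : idx env Y) : sdg a - sdg a = 0 by rewrite subrr.
have h2 (a : idx env Y) : k + sdg a - sdg a = k by rewrite addrK.
have h3 (a : idx env Y) : 0 + (k + sdg a) = k + sdg a by rewrite add0r.
have h4 (a : idx env Y) : sdg a + 0 = sdg a by rewrite addr0.
have h5 (a : idx env Y) : k + sdg a + 0 = k + sdg a by rewrite addr0.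
rewrite -[f in RHS](comp1r e) -(sum_inj_prj h1) (lin_sum (comp_linr _ _)).
rewrite (lin_sum (ract_linr _ _)); apply: eq_bigr => a _.
have hv := resolventK (@twist_act_lin _ _ _ _ _ env _ _ _)
  (@spread_htp_lin _ _ _ _ _ env _ (bar_contraction C) _ _)
  (@tpert_nil _ _ _ _ _ env _ (bar_contraction C) _ _) (inj_unit a).
rewrite -[resolvent _ _ _ _]/(pert_inj_unit a) in hv.
rewrite -[pert_inj_unit a](addrK (pert (twist_act env (Z:=trm a))
  (spread_htp env (bar_contraction C) (Z:=trm a)) (pert_inj_unit a))) hv.
rewrite (linB (telt_linl _ _ _)) (linB (bh_lin Psi_map _)) (linB (lact_linr _ _)).
rewrite (linB (@bar_aug_lin _ _ _ _ _)) /pert bar_aug_Psi_spread subr0.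
rewrite /inj_unit (Psi_mapE e0 (addr0 (sdg a)) _ e0 (h1 a)) bar_emb_unit.
rewrite -(lractA erefl (h2 a)) bar_aug_ract.
rewrite -[lact erefl f _](lactA (b := bar P) erefl (h5 a)).
have := bar_aug_unit (h5 a) e0 (h5 a) (h3 a) (comp erefl f (inj a)) (idm _).
rewrite ract1 comp1r => ->.
rewrite (ractA (h3 a) (h2 a) (h2 a) e1).
by rewrite (compA _ (h2 a) (h1 a) e).
Qed.

Definition defect : bimHom (bar P) (bar P) 0 := comp_sub_id Xi_map Psi_map.

Lemma defect_closed : bim_closed defect.
Proof. exact: comp_sub_id_closed Xi_map_closed Psi_map_closed. Qed.

(** On the image of [bar_htp] both maps take values of zero augmentation; at [1, 1]
they agree by [bar_aug_Psi_unit]. *)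
Lemma aug_defect X Z i j (e : 0 + i = j) (x : bar P X Z i) :
  aug (bar_contraction P) (bh defect e x) = 0.
Proof.
have ej : i = j by rewrite -e add0r.
case: _ / ej e => e; rewrite [bh _ _ _](@comp_sub_idE _ _ _ _ _ Xi_map Psi_map _ _ _ e x).
rewrite (linB (aug_lin _)); apply/eqP; rewrite subr_eq0; apply/eqP.
elim/bar_ind: x e => {X Z i j}.
- by move=> X Z i e; rewrite !(lin0 (bh_lin _ _)).
- move=> X Z i a x y Hx Hy e.
  by rewrite !bh_lin !aug_lin Hx Hy.
- move=> X Y Z i j k n e0 e1 g y e.
  have h0 : 0 + j = j by rewrite add0r.
  have h00 : 0 + 0 = 0 :> Gam by rewrite add0r.
  have h1 : 0 + n = j by [].
  rewrite (bh_lact Xi_map e0 e h0 e0) pairing0l sgr0 (bh_ract Xi_map e1 h0 h00 e1).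
  rewrite Xi_map_unit (bh_lact Psi_map e0 e h0 e0) pairing0l sgr0.
  rewrite (bh_ract Psi_map e1 h0 h00 e1).
  have h2 : i + 0 = i by rewrite addr0.
  have h3 : 0 + i = i by rewrite add0r.
  have h4 : i + n = k by rewrite -e0 -e1 add0r.
  rewrite -!(lractA h2 h4 e1 e0) [LHS]bar_aug_ract [RHS]bar_aug_ract.
  congr (ract h4 _ y); rewrite (bar_aug_Psi_unit h2 h3).
  have := bar_aug_unit h2 h00 h2 h3 g (idm Y).
  by rewrite ract1 comp1r => ->.
move=> X Y Z i j k n e0 e1 g x _ e.
have h0 : 0 + j = j by rewrite add0r.
have h1 : 0 + n = n by rewrite add0r.
rewrite (bh_lact Xi_map e0 e h0 e0) pairing0l sgr0 (bh_lact Psi_map e0 e h0 e0).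
rewrite pairing0l sgr0 (Xi_map_htp e1 h0 h1 e1).
by rewrite [LHS]bar_aug_Psi_htp [RHS]bar_aug_htp.
Qed.

(** The comparison theorem with theta = Psi Xi - 1 and u = 0 provides the
homotopy. *)
Lemma Psi_Xi : bim_inverse_mod_exact Xi_map Psi_map.
Proof.
exists (comparison (bar_contraction P) (addNr io) defect (fun X => 0)).
move=> X Y i i' j e e1 e2 e3 e4 x.
rewrite (comparison_diff _ defect_closed aug_defect _ _ e1 e2 e3 e4 e).
- by symmetry; apply: comp_sub_idE.
- by move=> X' i1 e'; rewrite (lin0 (dd_lin _)).
move=> X' Y' a j' e' e1' f.
by rewrite (lin0 (lact_linr _ _)) (lin0 (aug_lin _)) (lin0 (ract_linl _ _)) scaler0.
Qed.

(** The twist of an object of C is zero. *)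
Lemma resolvent_emb (Y : C) Z j (x : L (F Y) Z j) :
  resolvent (twist_act env (Z:=Z)) (spread_htp env (bar_contraction C) (Z:=Z))
    #|idx env (F Y)| x = x.
Proof.
have := resolventK (@twist_act_lin _ _ _ _ _ env _ _ _)
  (@spread_htp_lin _ _ _ _ _ env _ (bar_contraction C) _ _)
  (@tpert_nil _ _ _ _ _ env _ (bar_contraction C) _ _) x.
rewrite /pert /twist_act emb_tw (lin0 (lact_linl _ _)).
by rewrite (lin0 (@spread_htp_lin _ _ _ _ _ env _ _ _ _ _ _ _)) addr0.
Qed.

Definition bar_incl (Y Z : C) i (x : bar C Y Z i) : W (F Y) (F Z) i :=
  telt true (addr0 i) (telt true (add0r i) (idm (F Y) : R (F Y) Y 0) x : L (F Y) Z i)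
    (idm (F Z) : R' Z (F Z) 0).

Lemma bar_incl_lin Y Z i : linear (@bar_incl Y Z i).
Proof. by apply: (lin_app (telt_linl _ _ _)); apply: telt_linr. Qed.

Lemma bar_incl_lact X Y Z i j k (e : i + j = k) (g : hom Y X i) (x : bar C Y Z j) :
  bar_incl (lact e g x) = lact e (fhom F g) (bar_incl x).
Proof.
have h : i + 0 = i by rewrite addr0.
have h' : 0 + i = i by rewrite add0r.
rewrite /bar_incl (lact_telt e (addr0 j) e (addr0 k)); congr telt.
rewrite (lact_telt e (add0r j) h e).
rewrite -(telt_bal (M := R) h' e) //; congr telt.
by rewrite /= /reg_ract /reg_lact /= comp1l comp1r.
Qed.

Lemma bar_incl_ract X Y Z i j k (e : i + j = k) (x : bar C X Y i) (g : hom Z Y j) :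
  bar_incl (ract e x g) = ract e (bar_incl x) (fhom F g).
Proof.
have h : j + 0 = j by rewrite addr0.
have h' : 0 + j = j by rewrite add0r.
rewrite /bar_incl (ract_telt e (addr0 i) h' e).
rewrite -(ract_telt e (add0r i) e (add0r k)) (telt_bal (N := R') e (addr0 k) h e) //.
by congr telt; rewrite /= /reg_ract /reg_lact /= comp1l comp1r.
Qed.

Lemma bar_incl_unit Y : pert_diag_unit (F Y) = bar_incl (bar_unit Y).
Proof.
have -> : pert_diag_unit (F Y) = diag_unit env (F Y).
  by apply: eq_bigr => a _; rewrite /pert_inj_unit resolvent_emb.
rewrite /diag_unit /inj_unit.
rewrite (emb_sum env (fun Y' d (i : hom (F Y') (F Y) d) (p : hom (F Y) (F Y') (- d)) =>
  telt true (subrr d) (telt true (addr0 d) (i : R (F Y) Y' d) (bar_unit Y')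
    : L (F Y) Y' d) (p : R' Y' (F Y) _) : W (F Y) (F Y) 0)).
rewrite /bar_incl [RHS](telt_eq true (addr0 0) (subrr 0) erefl (esym (oppr0 _))).
by congr telt; rewrite [gcast erefl _]/= (eq_irrelevance (addr0 0) (add0r 0)).
Qed.

Lemma bar_incl_htp Y Z i j (e : i + io = j) (x : bar C Y Z j) :
  htp kW e (bar_incl x) = bar_incl (bar_htp e x).
Proof.
rewrite /bar_incl [LHS](tens_htpE _ e _ (addr0 i) e); congr telt.
rewrite [LHS]/= /ind_htp resolvent_emb.
have h1 (c : idx env (F Y)) : - sdg c + 0 + j = - sdg c + i + io.
  by rewrite addr0 -e addrA.
rewrite (spread_htpE _ e (add0r j) (fun c => erefl) h1 (fun c => deg_spread _ _)).
have h2 d : - d + 0 + j = - d + i + io by rewrite addr0 -e addrA.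
have h3 (d : Gam) : - d + 0 = - d + 0 by [].
rewrite (eq_bigr (fun c : idx env (F Y) => (-1) ^+ pairing io (sdg c) *:
  telt true (deg_spread (sdg c) i) (inj c : R (F Y) (trm c) _)
    (bar_htp erefl (lact (h2 (sdg c)) (full env (comp (h3 (sdg c)) (prj c) (idm (F
      Y)))) x)))); last first.
  move=> c _; congr (_ *: telt _ _ _ _).
  by rewrite (eq_irrelevance (h1 c) (h2 _)) (eq_irrelevance (h3 _) erefl).
rewrite (emb_sum env (fun Y' d (i0 : hom (F Y') (F Y) d) (p : hom (F Y) (F Y') (- d)) =>
  (-1) ^+ pairing io d *: telt true (deg_spread d i) (i0 : R (F Y) Y' d)
   (bar_htp erefl (lact (h2 d) (full env (comp (h3 d) p (idm (F Y)))) x)) : L (F Y) Z i)).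
rewrite pairing0r sgr0.
(* with - 0 replaced by 0 the cast of the projection becomes trivial *)
move: (deg_spread 0 i) (h2 0) (h3 0) (esym (oppr0 Gam)).
rewrite oppr0 => h4 h5 h6 h7.
rewrite gcast_refl.
have gen d1 d2 d3 (f1 : 0 + d2 = i) (f2 : d1 + j = d3) (f3 : 0 + 0 = d1)
    (f4 : d2 + io = d3) :
    telt true f1 (idm (F Y) : R (F Y) Y 0)
      (bar_htp f4 (lact f2 (full env (comp f3 (idm (F Y)) (idm (F Y)))) x)) =
    telt true (add0r i) (idm (F Y) : R (F Y) Y 0) (bar_htp e x) :> L (F Y) Z i.
  have E1 : d2 = i by rewrite -f1 add0r.
  have E2 : d3 = j by rewrite -f4 E1.
  have E3 : d1 = 0 by rewrite -f3 add0r.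
  move: f1 f2 f3 f4; rewrite E1 E2 E3 => f1 f2 f3 f4.
  rewrite comp1l full_id lact1.
  by rewrite (eq_irrelevance f4 e) (eq_irrelevance f1 (add0r i)).
exact: gen.
Qed.

(** Over C the recursions of both comparison maps are the unperturbed one. *)
Lemma Xi_map_bar_emb Y Z i (e : 0 + i = i) (x : bar C Y Z i) :
  bh Xi_map e (bh bar_emb e x : bar P (F Y) (F Z) i) = bar_incl x.
Proof.
elim/bar_ind: x e => {Y Z i}.
- by move=> Y Z i e; rewrite (lin0 (@bar_incl_lin _ _ _)) (lin0 (bh_lin bar_emb _))
  (lin0 (bh_lin Xi_map _)).
- move=> Y Z i a x y Hx Hy e.
  rewrite (bar_incl_lin a x y) (bh_lin bar_emb e a x y) -(Hx e) -(Hy e).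
  exact: (bh_lin Xi_map e a).
- move=> X Y Z i j k n e0 e1 g y e.
  have h0 : 0 + j = j by rewrite add0r.
  have h00 : 0 + 0 = 0 :> Gam by rewrite add0r.
  rewrite bar_incl_lact bar_incl_ract -bar_incl_unit.
  rewrite (bh_lact bar_emb e0 e h0 e0) pairing0l sgr0 (bh_ract bar_emb e1 h0 h00 e1)
    bar_emb_unit.
  rewrite [LHS](bh_lact Xi_map e0 e h0 e0) pairing0l sgr0; congr (lact e0 _ _).
  by rewrite [LHS](bh_ract Xi_map e1 h0 h00 e1) Xi_map_unit.
move=> X Y Z i j k n e0 e1 g x IH e.
have h0 : 0 + j = j by rewrite add0r.
have h1 : 0 + n = n by rewrite add0r.
rewrite bar_incl_lact -bar_incl_htp -(IH h1).
rewrite (bh_lact bar_emb e0 e h0 e0) pairing0l sgr0 (bar_emb_htp e1 h0 h1 e1).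
rewrite [LHS](bh_lact Xi_map e0 e h0 e0) pairing0l sgr0; congr (lact e0 _ _).
exact: Xi_map_htp.
Qed.

Lemma Xi_Psi X Z i (e : 0 + i = i) (x : W X Z i) :
  bh Xi_map e (bh Psi_map e x) = x.
Proof.
move: x; apply: tens_telt_ext => [||Y a b eab x g].
- by apply: (lin_app (bh_lin Xi_map _)); apply: (bh_lin Psi_map).
- exact: lin_id.
move: x; apply: tens_telt_ext => [||Y' c d ecd f x].
- apply: (lin_app (bh_lin Xi_map _)); apply: (lin_app (bh_lin Psi_map _)).
  exact: (telt_linl true).
- exact: (telt_linl true).
have h d' : 0 + d' = d' :> Gam by rewrite add0r.
have h' d' : d' + 0 = d' :> Gam by rewrite addr0.
rewrite (Psi_mapE e ecd eab (h d) eab) (bh_ract Xi_map eab e (h a) eab).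
rewrite (bh_lact Xi_map ecd (h a) (h d) ecd) pairing0l sgr0 Xi_map_bar_emb /bar_incl.
rewrite (lact_telt ecd (addr0 d) ecd (h' a)) (lact_telt ecd (add0r d) (h' c) ecd).
rewrite (ract_telt eab (h' a) (h b) eab); congr telt.
  by congr telt; rewrite /= /reg_lact /= comp1r.
by rewrite /= /reg_ract /= comp1l.
Qed.

Lemma Xi_map_equivalence : bim_homotopy_equivalence Xi_map.
Proof.
split; first exact: Xi_map_closed.
exists Psi_map; split; [exact: Psi_map_closed|exact: Psi_Xi|].
exists (bim_zero W W (- io)) => X Y i i' j e e1 e2 e3 e4 m.
by rewrite bim_zero_diff Xi_Psi subrr.
Qed.

End Equivalence.

(** * The explicit formula *)

Section BarElements.
Variables (G : ground) (D : dgCat G).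
Local Notation Gam := (gdeg G).

(** The generators of the bar complex arise by iterating x |-> s(f x), so that the
recursion for a comparison map reaches all of them. *)
Lemma bar_htp_elt (X Y Z : D) n k m l (h : hom Y X k) (t : chain Y Z)
    (e0 : 0 + cdeg t 0 = n + io *+ clen t) (e1 : k + n = m) (e2 : l + io = m)
    (e3 : 0 + cdeg (ccons h t) 0 = l + io *+ clen (ccons h t)) :
  bar_htp e2 (lact e1 h (bar_elt (idm Y) t (idm Z) e0)) =
  (-1) ^+ (odd (clen t) && pairing io k) *:
    bar_elt (idm X) (ccons h t) (idm Z) e3.
Proof.
rewrite /bar_elt [lact e1 h _]bar_lactE sgr_mulb (linZ (bar_htp_lin _)) bar_htpE.
congr (_ *: bin _).
have e4 : k + 0 = k by rewrite addr0.
have e5 : k + cdeg t 0 = m + io *+ clen t by rewrite -e1 -addrA -e0 add0r.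
rewrite (lact_telt _ e0 e4 e5).
have -> : lact e4 h (idm Y : regC D Y Y 0) = (h : regC D X Y k).
  by rewrite /= /reg_lact /= comp1r.
move: (deg_bar_htp _ _) (e3) => /=; case: _ / e5 => e6 e7.
by rewrite (eq_irrelevance e6 e7).
Qed.

Lemma bar_elt_ctens0 (X Y Z : D) (t : chain X Z) i l (e : i + cdeg t 0 = l + io *+ clen t)
    (f : hom X Y i) : ctens t (idm Z) = 0 -> bar_elt f t (idm Z) e = 0.
Proof.
by move=> h; rewrite /bar_elt h (lin0 (telt_linr _ _ _)) (lin0 (@bin_lin _ _ _ _ _ _)).
Qed.

End BarElements.

Section Formula.
Variables (G : ground) (C P : dgCat G) (F : dgFun C P) (env : envelope F).
Local Notation Gam := (gdeg G).
Local Notation R := (reg (fun_id P) F).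
Local Notation R' := (reg F (fun_id P)).
Local Notation L := (tens true R (bar C)).
Local Notation W := (tens true L R').
Local Notation kL := (barl_contr env).
Local Notation kW := (barp_contr env).
Local Notation pert_diag_unit := (pert_diag_unit env).
Local Notation Xi_map := (Xi_map env).
Local Notation idx := (idx env).
Local Notation rsv X Z j :=
  (@resolvent G (L X Z) (@twist_act _ _ _ _ _ env _ X Z)
    (@spread_htp _ _ _ _ _ env _ (bar_contraction C) X Z) #|idx X| j).
Local Notation prt X Z j :=
  (@pert G (L X Z) (@twist_act _ _ _ _ _ env _ X Z)
    (@spread_htp _ _ _ _ _ env _ (bar_contraction C) X Z) j).

(** The definitions whose names begin with g read the ingredients of the theorem in an
arbitrary envelope; for Pretr(C) they become the original ones by computation. *)
Definition ghmor (X Y : P) k (f : hom Y X k) (a : idx X) (b : idx Y) :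
    hom (trm b) (trm a) (- sdg a + k + sdg b) :=
  full env (comp erefl (comp erefl (prj a) f) (inj b)).

Fixpoint gtwist_chain (X : P) (a : idx X) (s : seq (idx X)) (Z : C) :
    chain (trm (last a s)) Z -> chain (trm a) Z :=
  match s return chain (trm (last a s)) Z -> chain (trm a) Z with
  | [::] => fun t => t
  | b :: s' => fun t => ccons (ghmor (tw env X) a b) (@gtwist_chain X b s' Z t)
  end.

(** The element sigma_a (x) [1, t, 1]. The degrees and their equations are parameters,
since the same element arises with different ones. *)
Definition inj_elt X Z (a : idx X) (t : chain (trm a) Z) m j (e : sdg a + m = j)
    (d : 0 + cdeg t 0 = m + io *+ clen t) : L X Z j :=
  telt true e (inj a : R X (trm a) _) (bar_elt (idm _) t (idm _) d).

Lemma inj_elt_irr X Z (a : idx X) (t : chain (trm a) Z) m m' j (e : sdg a + m = j)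
    (e' : sdg a + m' = j) d d' : @inj_elt X Z a t m j e d = @inj_elt X Z a t m' j e' d'.
Proof.
have hm : m' = m by apply: (addrI (sdg a)); rewrite e e'.
move: e' d'; rewrite hm => e' d'.
by rewrite (eq_irrelevance e e') (eq_irrelevance d d').
Qed.

(** S prepends to the bar the components of f sigma_b. *)
Lemma spread_htp_elt X Y Z (b : idx Y) (t : chain (trm b) Z) k m i j n
    (f : hom Y X k) (e : sdg b + m = i) (d : 0 + cdeg t 0 = m + io *+ clen t)
    (e1 : k + i = j) (e2 : n + io = j) (q : idx X -> Gam)
    (e3 : forall a, sdg a + q a = n)
    (d' : forall a, 0 + cdeg (ccons (ghmor f a b) t) 0 =
      q a + io *+ clen (ccons (ghmor f a b) t)) :
  spread_htp env (bar_contraction C) e2 (lact e1 f (inj_elt e d)) =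
  \sum_a (-1) ^+ (pairing io (sdg a) (+)
      odd (clen t) && (pairing io (sdg a) (+) pairing io k (+) pairing io (sdg b))) *:
    inj_elt (e3 a) (d' a).
Proof.
have h1 : k + sdg b + m = j by rewrite -addrA e.
rewrite (lact_telt e1 e erefl h1).
have h2 (a : idx X) : - sdg a + (k + sdg b) = - sdg a + k + sdg b by rewrite addrA.
have h3 a : - sdg a + k + sdg b + m = q a + io.
  by apply: (addrI (sdg a)); rewrite [RHS]addrA e3 e2 -h1; deg.
rewrite (spread_htpE _ _ h1 h2 h3 e3); apply: eq_bigr => a _; rewrite -sgrD.
congr (_ *: _); rewrite /inj_elt -(linZ (telt_linr _ _ _)); congr telt.
have -> : component (h2 a) (lact erefl f (inj b : R Y (trm b) _)) = ghmor f a b.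
  rewrite /component /ghmor /= /reg_lact /=; congr full.
  by symmetry; apply: compA.
by rewrite [LHS](bar_htp_elt _ _ _ (d' a)) !pairingE.
Qed.

Lemma gtwist_deg X Z (a : idx X) s (t : chain (trm (last a s)) Z) m j :
  sdg (last a s) + m = j -> 0 + cdeg t 0 = m + io *+ clen t ->
  0 + cdeg (gtwist_chain t) 0 = (j - sdg a) + io *+ clen (gtwist_chain t).
Proof.
elim: s a t => [|b s IH] a t /= h1 h2; first by rewrite h2 -h1; deg.
have := IH b t h1 h2; rewrite !add0r => ->; deg.
Qed.

Lemma inj_elt_deg X (a : idx X) j : sdg a + (j - sdg a) = j.
Proof. by deg. Qed.

(** A non-empty word is a pair of a head and a tail; n is the length of the tail. *)
Fixpoint words X n : seq (idx X * seq (idx X)) :=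
  if n is n'.+1 then [seq (a, w.1 :: w.2) | a <- enum (idx X), w <- words X n']
  else [seq (a, [::]) | a <- enum (idx X)].

Lemma mem_words X n (w : idx X * seq (idx X)) : (w \in words X n) = (size w.2 == n).
Proof.
elim: n w => [|n IH] [a s].
  apply/mapP/idP => /= [[b _ [_ ->]] //|/nilP ->]; exists a => //.
  by rewrite mem_enum.
apply/allpairsP/idP => /= [[[b w] /= [_ hw [_ ->]]]|] /=; first by rewrite eqSS -IH.
case: s => [//|b s]; rewrite eqSS => h; exists (a, (b, s)) => /=; split=> //.
  by rewrite mem_enum.
by rewrite IH.
Qed.

Lemma uniq_words X n : uniq (words X n).
Proof.
elim: n => [|n IH]; first by rewrite map_inj_uniq ?enum_uniq // => a b [].
apply: allpairs_uniq => //; first exact: enum_uniq.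
by move=> [a [b s]] [a' [b' s']] _ _ /= [-> -> ->].
Qed.

Fixpoint short_words X N : seq (idx X * seq (idx X)) :=
  if N is N'.+1 then short_words X N' ++ words X N' else [::].

Lemma mem_short_words X N (w : idx X * seq (idx X)) :
  (w \in short_words X N) = (size w.2 < N)%N.
Proof.
elim: N => [//|N IH]; rewrite mem_cat IH mem_words ltnS.
by rewrite [RHS]leq_eqVlt orbC.
Qed.

Lemma uniq_short_words X N : uniq (short_words X N).
Proof.
elim: N => [//|N IH]; rewrite cat_uniq IH uniq_words andbT /=.
apply/hasPn => w; rewrite mem_words mem_short_words => /eqP ->.
by rewrite ltnn.
Qed.

(** The exponent of the sign which a block contributes when p entries follow it in the
bar; [kap] is the exponent already carried by the term. *)
Definition block_sgn X (p : nat) (kap : idx X -> bool) (w : idx X * seq (idx X)) : bool :=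
  kap (last w.1 w.2) (+) odd (p + size w.2) && pairing io (sdg w.1) (+)
  odd p && pairing io (sdg (last w.1 w.2)) (+)
  odd (size w.2 * p.+1 + 'C(size w.2, 2)).

Lemma block_sgn_cons X p kap (a : idx X) w :
  block_sgn p kap (a, w.1 :: w.2) = block_sgn p kap w (+) (true (+) (pairing io (sdg a)
    (+)
    odd (size w.2 + p) && (pairing io (sdg a) (+) true (+) pairing io (sdg w.1)))).
Proof.
rewrite /block_sgn [(a, _).1]/= [(a, _).2]/= [size (_ :: _)]/= [last a _]/=.
rewrite mulSn binS bin1 !(oddD, oddS).
move: (odd (_ * _)) (odd ('C(_, _))) => x y.
case: (kap _); case: (odd p); case: (odd (size w.2)); case: (pairing io (sdg a));
  case: (pairing io (sdg w.1)); case: (pairing io (sdg (last w.1 w.2)));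
  by case: x; case: y.
Qed.

Section Block.
Variables (X : P) (Z : idx X -> C) (j : idx X -> Gam) (p : nat) (kap : idx X -> bool).
Variable t : forall a : idx X, chain (trm a) (Z a).
Variable m : idx X -> Gam.
Hypothesis e : forall a, sdg a + m a = j a.
Hypothesis d : forall a, 0 + cdeg (t a) 0 = m a + io *+ clen (t a).
Hypothesis hp : forall a, clen (t a) = p.
Variable V : lmodType (gring G).

(** The element sigma_a (x) [1, t, 1] whose bar begins with the entries of the twist
along the word w. *)
Definition block_elt (w : idx X * seq (idx X)) :
    L X (Z (last w.1 w.2)) (j (last w.1 w.2)) :=
  inj_elt (inj_elt_deg w.1 _)
    (@gtwist_deg X _ w.1 w.2 (t (last w.1 w.2)) _ (j (last w.1 w.2)) (e _) (d _)).

Lemma clen_gtwist (a : idx X) s Z' (t' : chain (trm (last a s)) Z') :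
  clen (gtwist_chain t') = (size s + clen t')%N.
Proof. by elim: s a t' => [//|b s IH] a t' /=; rewrite IH. Qed.

Lemma prt_lin Z' j' : linear (prt X Z' j').
Proof. by apply: pert_lin; [apply: twist_act_lin|apply: spread_htp_lin]. Qed.

(** The element of the word w with the letter a prepended; the type is that of the
element of w, as the last letter is the same. *)
Definition block_elt_cons (w : idx X * seq (idx X)) (a : idx X) :
  L X (Z (last w.1 w.2)) (j (last w.1 w.2)) := block_elt (a, w.1 :: w.2).

Lemma pert_block_elt w :
  prt X _ _ (block_elt w) = \sum_a (-1) ^+ (pairing io (sdg a) (+)
    odd (size w.2 + p) && (pairing io (sdg a) (+) true (+) pairing io (sdg w.1))) *:
    block_elt_cons w a.
Proof.
rewrite /pert /twist_act /block_elt.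
have d' a : 0 + cdeg (ccons (ghmor (tw env X) a w.1)
      (@gtwist_chain X w.1 w.2 _ (t (last w.1 w.2)))) 0 =
    (j (last w.1 w.2) - sdg a) + io *+ clen (ccons (ghmor (tw env X) a w.1)
      (@gtwist_chain X w.1 w.2 _ (t (last w.1 w.2)))).
  exact: (@gtwist_deg X _ a (w.1 :: w.2) (t (last w.1 w.2)) _ _ (e _) (d _)).
rewrite (spread_htp_elt _ _ _ _ (fun a => inj_elt_deg a _) d').
apply: eq_bigr => a _; rewrite clen_gtwist hp pairing_io.
by congr (_ *: _); apply: inj_elt_irr.
Qed.

(** Each application of S alpha prepends one letter to the word. The linear
functionals [Phi] allow the sum over the first index to be treated inside a larger
sum. *)
Lemma iter_pert_block n (Phi : forall a, L X (Z a) (j a) -> V) :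
  (forall a, linear (Phi a)) ->
  \sum_a Phi a ((-1) ^+ kap a *: ((-1) ^+ n *: iter n (prt X (Z a) (j a))
    (inj_elt (e a) (d a)))) =
  \sum_(w <- words X n) (-1) ^+ block_sgn p kap w *: Phi _ (block_elt w).
Proof.
elim: n Phi => [|n IH] Phi hPhi.
  rewrite /= big_map enumT; apply: eq_bigr => a _.
  have -> : block_sgn p kap (a, [::]) = kap a.
    rewrite /block_sgn [size _]/= mul0n addn0 bin0n [last _ _]/=.
    by case: (kap a); case: (odd p); case: pairing.
  rewrite expr0 scale1r (linZ (hPhi a)); congr (_ *: Phi _ _).
  exact: inj_elt_irr.
pose Psi a x := Phi a (- prt X (Z a) (j a) x).
have hPsi a : linear (Psi a).
  by apply: (lin_app (hPhi a)); apply: lin_opp; apply: prt_lin.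
have := IH Psi hPsi; rewrite /Psi.
under eq_bigr => a _.
  rewrite !(linZ (@prt_lin _ _)) -scalerN -scalerN -iterS.
  rewrite -[- iter _ _ _]scaleN1r.
  rewrite [X in (-1) ^+ kap a *: X]scalerA -exprSr.
  over.
move=> ->; rewrite /= big_allpairs_dep enumT [RHS]exchange_big /=.
apply: eq_bigr => w _.
rewrite pert_block_elt -sumrN (lin_sum (hPhi _)) scaler_sumr.
apply: eq_bigr => a _; rewrite block_sgn_cons -!sgrD sgr1.
rewrite (linN (hPhi _)) !(linZ (hPhi _)).
by [].
Qed.

(** The term of order n of the geometric series is the sum over the words with n + 1
letters. *)
Lemma resolvent_block (Phi : forall a, L X (Z a) (j a) -> V) :
  (forall a, linear (Phi a)) ->
  \sum_a Phi a ((-1) ^+ kap a *: rsv X (Z a) (j a) (inj_elt (e a) (d a))) =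
  \sum_(w <- short_words X #|idx X|) (-1) ^+ block_sgn p kap w *: Phi _ (block_elt w).
Proof.
move=> hPhi; rewrite /resolvent; elim: #|_| => [|N IH].
  rewrite big_nil big1 // => a _.
  by rewrite big_ord0 scaler0 (lin0 (hPhi a)).
rewrite /= big_cat -iter_pert_block // -IH [RHS]sumrD; apply: eq_bigr => a _.
by rewrite big_ord_recr scalerDr (linD (hPhi a)).
Qed.

End Block.

Definition gblk (X : P) : choiceType := (idx X * seq (idx X))%type.

Fixpoint gxidx (X Z : P) (c : chain X Z) : choiceType :=
  match c with
  | cnil X0 => gblk X0
  | ccons X0 _ _ _ _ c' => (gblk X0 * gxidx c')%type
  end.

Definition gxfst (X Z : P) (c : chain X Z) : gxidx c -> idx X :=
  match c in chain X0 Z0 return gxidx c -> idx X0 with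
  | cnil _ => fun w => w.1
  | ccons _ _ _ _ _ _ => fun w => w.1.1
  end.

Fixpoint gxlst (X Z : P) (c : chain X Z) : gxidx c -> idx Z :=
  match c in chain X0 Z0 return gxidx c -> idx Z0 with
  | cnil _ => fun w => last w.1 w.2
  | ccons _ _ _ _ _ c' => fun w => gxlst w.2
  end.

Fixpoint gxcount (X Z : P) (c : chain X Z) : gxidx c -> seq nat :=
  match c return gxidx c -> seq nat with
  | cnil _ => fun w => [:: size w.2]
  | ccons _ _ _ _ _ c' => fun w => size w.1.2 :: gxcount w.2
  end.

Fixpoint gcdegs (X Z : P) (c : chain X Z) : seq Gam :=
  if c is ccons _ _ _ k _ c' then k :: gcdegs c' else [::].

Fixpoint ghchain (X Z : P) (c : chain X Z) :
    forall w : gxidx c, chain (trm (gxfst w)) (trm (gxlst w)) :=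
  match c in chain X0 Z0
    return forall w : gxidx c, chain (trm (gxfst w)) (trm (gxlst w)) with
  | cnil X0 => fun w => @gtwist_chain X0 w.1 w.2 _ (cnil (trm (last w.1 w.2)))
  | ccons X0 Y0 Z0 k f c' => fun w =>
      @gtwist_chain X0 w.1.1 w.1.2 _
        (ccons (ghmor f (last w.1.1 w.1.2) (gxfst w.2)) (ghchain w.2))
  end.

Definition gxsgn (X Z : P) (c : chain X Z) (w : gxidx c) : nat :=
  let r := clen c in
  let n u := nth 0 (gxcount w) u in
  let N := (\sum_(0 <= u < r.+1) n u)%N in
  let fdeg u := nth 0 (gcdegs c) u.-1 in
  ((r + N) * pairing io (sdg (gxfst w)) + 'C(N.+1, 2)
   + \sum_(0 <= u < r.+1) (r - u) * n u
   + \sum_(1 <= u < r.+1) \sum_(u <= u' < r.+1) pairing io (fdeg u) * n u')%N.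

Definition gterm (X Z : P) (c : chain X Z) (w : gxidx c) m j l
    (e : sdg (gxfst w) + m = j)
    (d : 0 + cdeg (ghchain w) 0 = m + io *+ clen (ghchain w))
    (e2 : j - sdg (gxlst w) = l) : W X Z l :=
  telt true e2 (inj_elt e d) (prj (gxlst w) : R' (trm (gxlst w)) Z _).

Lemma gterm_irr (X Z : P) (c : chain X Z) (w : gxidx c) m m' j j' l e e' d d' e2 e2' :
  @gterm X Z c w m j l e d e2 = @gterm X Z c w m' j' l e' d' e2'.
Proof.
have hj : j' = j by apply: (addIr (- sdg (gxlst w))); rewrite e2 e2'.
move: e' e2'; rewrite hj => e' e2'.
by rewrite /gterm (eq_irrelevance e2 e2') (inj_elt_irr e e' d d').
Qed.

Lemma ghchain_deg (X Z : P) (c : chain X Z) (w : gxidx c) l :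
  0 + cdeg c 0 = l + io *+ clen c ->
  0 + cdeg (ghchain w) 0 =
    (l + sdg (gxlst w) - sdg (gxfst w)) + io *+ clen (ghchain w).
Proof.
elim: c w l => [X0|X0 Y0 Z0 k f c IH] w l e.
  have h1 : sdg (last w.1 w.2) + 0 = l + sdg (last w.1 w.2).
    by rewrite /= in e; degw e.
  by apply: (gtwist_deg h1); rewrite /= addr0.
have e' : 0 + cdeg c 0 = l + io - k + io *+ clen c by rewrite /= in e; degw e.
have h := IH w.2 _ e'.
set b := last w.1.1 w.1.2; set z := sdg (gxlst w.2).
have h1 : sdg b + (l + z - sdg b) = l + z by deg.
apply: (gtwist_deg h1); rewrite /= -/b; move: h; rewrite -/z => h.
by degw h.
Qed.

Lemma gterm_of_deg (l z a : Gam) : a + (l + z - a) = l + z.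
Proof. by deg. Qed.

Definition gterm_of (X Z : P) (c : chain X Z) l (e : 0 + cdeg c 0 = l + io *+ clen c)
    (w : gxidx c) : W X Z l :=
  gterm (gterm_of_deg l _ _) (ghchain_deg w e) (addrK _ l).

(** The index of the sum in the theorem, cut off where the terms vanish. *)
Fixpoint short_index (X Z : P) (c : chain X Z) : seq (gxidx c) :=
  match c return seq (gxidx c) with
  | cnil X0 => short_words X0 #|idx X0|
  | ccons X0 _ _ _ _ c' =>
      [seq (b, w) | b <- short_words X0 #|idx X0|, w <- short_index c']
  end.

Lemma uniq_short_index (X Z : P) (c : chain X Z) : uniq (short_index c).
Proof.
elim: c => [X0|X0 Y0 Z0 k f c IH] /=; first exact: uniq_short_words.
apply: allpairs_uniq => //; first exact: uniq_short_words.
by move=> [a b] [a' b'].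
Qed.

Lemma gtwist_chain0 X (a : idx X) s Z (t : chain (trm (last a s)) Z) :
  ctens t (idm Z) = 0 -> ctens (gtwist_chain t) (idm Z) = 0.
Proof.
elim: s a t => [//|b s IH] a t h /=.
by rewrite (IH b t h) (lin0 (telt_linr _ _ _)).
Qed.

(** Non-zero entries of the twist lower the height, which is less than the cardinality
of idx X. *)
Lemma gtwist_chain_long X (a : idx X) s Z (t : chain (trm (last a s)) Z) :
  (#|idx X| <= size s)%N -> ctens (gtwist_chain t) (idm Z) = 0.
Proof.
have [ht [hlt hdec]] := height env X.
move=> hs; have {hs} : (ht a < size s)%N by apply: leq_trans hs.
elim: s a t => [//|b s IH] a t /= hs.
case: (boolP (ht b < ht a)%N) => hab.
  by rewrite IH ?(lin0 (telt_linr _ _ _)) //; apply: leq_trans hab _.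
have -> : ghmor (tw env X) a b = 0.
  have h : - sdg a + (io + sdg b) = - sdg a + io + sdg b by rewrite addrA.
  rewrite /ghmor (compA _ _ erefl h) (hdec _ _ hab).
  exact: (lin0 (@full_lin _ _ _ _ env _ _ _)).
exact: (lin0 (telt_linl _ _ _)).
Qed.

Lemma ghchain_long (X Z : P) (c : chain X Z) (w : gxidx c) :
  w \notin short_index c -> ctens (ghchain w) (idm _) = 0.
Proof.
elim: c w => [X0|X0 Y0 Z0 k f c IH] w hw /=.
  by apply: gtwist_chain_long; rewrite leqNgt -mem_short_words.
(* a word is too long either in the first block or later *)
case: (boolP (w.2 \in short_index c)) => h2.
  apply: gtwist_chain_long; rewrite leqNgt -mem_short_words.
  apply: contra hw => h1; apply/allpairsP; exists w; split=> //.
  by case: (w).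
apply: gtwist_chain0 => /=; rewrite IH //.
exact: (lin0 (telt_linr _ _ _)).
Qed.

Lemma gterm_long (X Z : P) (c : chain X Z) (w : gxidx c) m j l e d e2 :
  w \notin short_index c -> @gterm X Z c w m j l e d e2 = 0.
Proof.
move=> h; rewrite /gterm /inj_elt bar_elt_ctens0; last exact: ghchain_long.
by rewrite (lin0 (telt_linr _ _ _)) (lin0 (telt_linl _ _ _)).
Qed.

Lemma clen_ghchain (X Z : P) (c : chain X Z) (w : gxidx c) :
  clen (ghchain w) = (clen c + \sum_(0 <= u < (clen c).+1) nth 0 (gxcount w) u)%N.
Proof.
elim: c w => [X0|X0 Y0 Z0 k f c IH] w /=.
  by rewrite clen_gtwist /= big_nat1 add0n addn0.
rewrite clen_gtwist [clen (ccons _ _)]/= IH [in RHS]big_nat_recl //.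
by rewrite addnS addSn addnCA.
Qed.

(** The contribution of the first block to the binomial term of the sign. *)
Lemma bin2_add n m : ('C((n + m).+1, 2) = 'C(m.+1, 2) + n * m.+1 + 'C(n, 2))%N.
Proof.
elim: n => [|n IH]; first by rewrite add0n mul0n !addn0.
by rewrite addSn binS bin1 IH (binS n 1) bin1 mulSn; lia.
Qed.

(** The number N of the theorem. *)
Definition gtotal (X Z : P) (c : chain X Z) (w : gxidx c) : nat :=
  (\sum_(0 <= u < (clen c).+1) nth 0 (gxcount w) u)%N.
Definition gpositions (X Z : P) (c : chain X Z) (w : gxidx c) : nat :=
  (\sum_(0 <= u < (clen c).+1) (clen c - u) * nth 0 (gxcount w) u)%N.
Definition gdegrees (X Z : P) (c : chain X Z) (w : gxidx c) : nat :=
  (\sum_(1 <= u < (clen c).+1) \sum_(u <= u' < (clen c).+1)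
    pairing io (nth 0%R (gcdegs c) u.-1) * nth 0 (gxcount w) u')%N.

Lemma gxsgnE (X Z : P) (c : chain X Z) (w : gxidx c) :
  gxsgn w = ((clen c + gtotal w) * pairing io (sdg (gxfst w)) + 'C((gtotal w).+1, 2) +
    gpositions w + gdegrees w)%N.
Proof. by []. Qed.

Lemma gxsgn_nil (X : P) (w : gxidx (cnil X)) :
  odd (gxsgn w) = block_sgn 0 (fun=> false) w.
Proof.
rewrite gxsgnE.
have -> : gtotal w = size w.2 by rewrite /gtotal [clen _]/= big_nat1.
have -> : gpositions w = 0%N by rewrite /gpositions [clen _]/= big_nat1.
have -> : gdegrees w = 0%N by rewrite /gdegrees [clen _]/= big_geq.
rewrite [clen _]/= /block_sgn add0n !addn0 binS bin1 muln1 !oddD oddM oddb.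
by case: (odd _); case: pairing; case: odd.
Qed.

Section SignStep.
Variables (X Y Z : P) (k : Gam) (f : hom Y X k) (c : chain Y Z).
Variable w : gxidx (ccons f c).

Lemma gtotal_cons : gtotal w = (size w.1.2 + gtotal w.2)%N.
Proof. by rewrite /gtotal [clen _]/= big_nat_recl. Qed.

Lemma gpositions_cons : gpositions w = ((clen c).+1 * size w.1.2 + gpositions w.2)%N.
Proof.
rewrite /gpositions [clen (ccons f c)]/= big_nat_recl // subn0; congr (_ + _)%N.
Qed.

Lemma gdegrees_cons : (gdegrees w = pairing io k * gtotal w.2 + gdegrees w.2)%N.
Proof.
rewrite /gdegrees [clen (ccons f c)]/= big_ltn //; congr (_ + _)%N.
  by rewrite big_add1 /gtotal big_distrr.
rewrite big_add1; apply: eq_big_nat => u /andP[hu _].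
rewrite big_add1; apply: eq_big_nat => u' _.
by case: u hu => //.
Qed.

(** The sign of the theorem satisfies the recursion by which the comparison map is
defined. *)
Lemma gxsgn_cons :
  let p := clen (ghchain w.2) in
  let b := sdg (gxfst w.2) in
  odd (gxsgn w) = odd (clen c) && pairing io k (+) odd (gxsgn w.2) (+)
    block_sgn p.+1 (fun a : idx X => pairing io (sdg a) (+)
      odd p && (pairing io (sdg a) (+) pairing io k (+) pairing io b)) w.1.
Proof.
move=> p b; rewrite !gxsgnE gtotal_cons gpositions_cons gdegrees_cons /block_sgn.
have -> : p = (clen c + gtotal w.2)%N by exact: clen_ghchain.
have -> : clen (ccons f c) = (clen c).+1 by [].
have -> : gxfst w = w.1.1 by [].
rewrite bin2_add -/b.
move: 'C((gtotal w.2).+1, 2) 'C(size w.1.2, 2) => B1 B2.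
rewrite !(oddD, oddM, oddS, oddb).
move: (odd (clen c)) (odd (gtotal w.2)) (odd (size w.1.2)) (pairing io k) (pairing io b)
  (pairing io (sdg w.1.1)) (pairing io (sdg (last w.1.1 w.1.2)))
  (odd (gpositions w.2)) (odd (gdegrees w.2)) (odd B1) (odd B2).
by move=> [] [] [] [] [] [] [] [] [] [] [].
Qed.

End SignStep.

(** One step of the recursion on a single term: S prepends the entry pi f sigma, and
the resolvent a block of twist entries. *)
Lemma htp_gterm (X Y Z : P) k (f : hom Y X k) (c : chain Y Z) (w' : gxidx c) l l'
    (e : 0 + cdeg (ccons f c) 0 = l + io *+ clen (ccons f c))
    (e' : 0 + cdeg c 0 = l' + io *+ clen c) (e1 : k + l' = l + io)
    (p := clen (ghchain w')) (b := sdg (gxfst w')) :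
  htp kW erefl (lact e1 f (gterm_of e' w')) =
  \sum_(v <- short_words X #|idx X|)
    (-1) ^+ block_sgn p.+1 (fun a : idx X => pairing io (sdg a) (+)
      odd p && (pairing io (sdg a) (+) pairing io k (+) pairing io b)) v *:
    gterm_of e ((v, w') : gxidx (ccons f c)).
Proof.
rewrite /gterm_of /gterm; set z := sdg (gxlst w').
have h1 : k + (l' + z) = l + z + io by rewrite addrA e1 addrAC.
have h2 : l + z + io - z = l + io by rewrite addrAC addrK.
rewrite (lact_telt e1 _ h1 h2).
have h3 : l + z - z = l by rewrite addrK.
rewrite [LHS](tens_htpE _ erefl h2 h3 erefl).
have d' (a : idx X) : 0 + cdeg (ccons (ghmor f a (gxfst w')) (ghchain w')) 0 =
    (l + z - sdg a) + io *+ clen (ccons (ghmor f a (gxfst w')) (ghchain w')).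
  have h := ghchain_deg w' e'; rewrite -/z in h; rewrite /=.
  apply: (eq_shift h); apply: (eq_shift e1); rewrite mulrS; zmod.
rewrite [htp kL _ _]/= /ind_htp.
rewrite (spread_htp_elt _ _ _ erefl (fun a : idx X => inj_elt_deg a (l + z)) d').
rewrite (lin_sum (@tresolvent_lin _ _ _ _ _ env _ (bar_contraction C) _ _ _)).
rewrite (lin_sum (telt_linl true _ _)).
have := resolvent_block (fun a : idx X => pairing io (sdg a) (+)
      odd p && (pairing io (sdg a) (+) pairing io k (+) pairing io b))
  (fun a : idx X => inj_elt_deg a (l + z)) d' (fun a => erefl : _ = p.+1)
  (fun a => telt_linl true h3 (prj (gxlst w') : R' (trm (gxlst w')) Z _)).
move=> h; apply: etrans (etrans h _).
  apply: eq_bigr => a _.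
  by rewrite (linZ (@tresolvent_lin _ _ _ _ _ env _ (bar_contraction C) _ _ _)).
apply: eq_bigr => v _; congr (_ *: _).
rewrite (eq_irrelevance h3 (addrK _ l)); congr telt.
exact: inj_elt_irr.
Qed.

Lemma Xi_map_elt (X Z : P) (c : chain X Z) l (e : 0 + cdeg c 0 = l + io *+ clen c) :
  bh Xi_map (add0r l) (bar_elt (idm X) c (idm Z) e) =
  \sum_(w <- short_index c) (-1) ^+ gxsgn w *: gterm_of e w.
Proof.
elim: c l e => [X0|X0 Y0 Z0 k f c IH] l e.
  have hl : l = 0 by rewrite /= in e; degw e.
  subst l.
  have -> : bar_elt (idm X0) (cnil X0) (idm X0) e = bar_unit X0.
    by rewrite /bar_unit (eq_irrelevance (deg_bar_unit G) e).
  rewrite Xi_map_unit /pert_diag_unit.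
  have d0 (a : idx X0) : 0 + cdeg (cnil (trm a)) 0 = 0 + io *+ clen (cnil (trm a)).
    by rewrite /= addr0.
  have h := resolvent_block (fun=> false) (fun a : idx X0 => addr0 (sdg a)) d0
    (fun a => erefl : _ = 0%N)
    (fun a => telt_linl true (subrr (sdg a)) (prj a : R' (trm a) X0 _)).
  apply: etrans (etrans h _).
    apply: eq_bigr => a _; rewrite sgr0; congr telt.
    rewrite /pert_inj_unit /inj_unit; congr resolvent.
    by rewrite /inj_elt /bar_unit /bar1 /bar_elt (eq_irrelevance (d0 a) (deg_bar_unit G)).
  apply: eq_bigr => w _; rewrite [in RHS]sgr_nat gxsgn_nil; congr (_ *: _).
  exact: (@gterm_irr X0 X0 (cnil X0) w).
have e' : 0 + cdeg c 0 = (l + io - k) + io *+ clen c by rewrite /= in e; degw e.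
have e1 : k + (l + io - k) = l + io by deg.
have h := bar_htp_elt e' e1 erefl e.
have -> : bar_elt (idm X0) (ccons f c) (idm Z0) e =
    (-1) ^+ (odd (clen c) && pairing io k) *:
      bar_htp erefl (lact e1 f (bar_elt (idm Y0) c (idm Z0) e')).
  by rewrite h sgrD addbb sgr0.
rewrite (linZ (bh_lin Xi_map _)) (Xi_map_htp _ _ _ (add0r (l + io)) erefl).
rewrite (bh_lact Xi_map e1 _ (add0r _) e1) pairing0l sgr0 IH.
rewrite (lin_sum (lact_linr _ _)) (lin_sum (htp_lin kW _)) scaler_sumr.
rewrite [in RHS]/short_index -/short_index big_allpairs_dep [RHS]exchange_big;
  apply: eq_bigr => w _.
rewrite (linZ (lact_linr _ _)) (linZ (htp_lin kW _)) (htp_gterm w e e' e1).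
rewrite !scaler_sumr; apply: eq_bigr => v _.
rewrite [in RHS]sgr_nat (gxsgn_cons (f := f) (v, w)) -!sgrD.
by congr (_ *: _); rewrite [LHS]sgr_nat.
Qed.

Lemma Xi_map_elt_fsum (X Z : P) (c : chain X Z) l (e : 0 + cdeg c 0 = l + io *+ clen c) :
  bh Xi_map (add0r l) (bar_elt (idm X) c (idm Z) e) =
  \sum_(w \in [set: gxidx c]%classic) (-1) ^+ gxsgn w *: gterm_of e w.
Proof.
rewrite Xi_map_elt (fsbig_seq _ _ (uniq_short_index c)).
apply: fsbig_widen => // w [_ hw] /=.
rewrite /gterm_of gterm_long ?scaler0 //.
by apply/negP.
Qed.

End Formula.

(** * The pretriangulated envelope *)

Section Summands.
Variables (G : ground) (C : dgCat G).
Local Notation Gam := (gdeg G).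
Local Notation P := (pretr C).

Lemma adelta_dd (D : dgCat G) (X : aobj D) (a b : aidx X) i (e : 0 + io = i) :
  dd e (adelta a b) = 0.
Proof.
case: (eqVneq b a) => [->|h]; first by rewrite adeltaxx dd_idm.
by rewrite adelta_neq // (lin0 (dd_lin _)).
Qed.

Lemma phi_dd (Y : C) i j (e : i + io = j) : dd e (phi Y i) = 0.
Proof.
rewrite /= /shom_dd /phi.
have h : io = j + sdeg (SObj 0 Y) - sdeg (SObj i Y) by rewrite /= -e addr0 addrC addKr.
have h0 : 0 + io = io :> Gam by rewrite add0r.
by rewrite (dd_cast _ h h0) dd_idm (lin0 (gcast_lin _)) scaler0.
Qed.

Lemma phiV_dd (Y : C) i j (e : - i + io = j) : dd e (phiV Y i) = 0.
Proof.
rewrite /= /shom_dd /phiV.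
have h : io = j + sdeg (SObj i Y) - sdeg (SObj 0 Y).
  by rewrite /= -e subr0 addrAC addNr add0r.
have h0 : 0 + io = io :> Gam by rewrite add0r.
by rewrite (dd_cast _ h h0) dd_idm (lin0 (gcast_lin _)) scaler0.
Qed.

Lemma phiK (Y : C) i (e : i - i = 0) : comp e (phi Y i) (phiV Y i) = idm _.
Proof.
rewrite /= /scomp /phi /phiV /sid /=.
rewrite (comp_cast _ _ (deg_s1 i) (addr0 0)) comp1l.
by congr gcast; apply: eq_irrelevance.
Qed.

(** Stated in an arbitrary dg category, which keeps the composites defining inclusions
and projections folded. *)
Lemma comp_cancel_mid (D : dgCat G) (Y1 Y2 Y3 Y4 : D) i j (e : i + j = 0)
    (a : hom Y3 Y4 0) (f : hom Y2 Y3 i) (g : hom Y3 Y2 j) (b : hom Y1 Y3 0) :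
  comp e f g = idm Y3 ->
  comp e (comp (add0r i) a f) (comp (addr0 j) g b) = comp (addr0 0) a b.
Proof.
move=> h; rewrite (compA _ _ e (addr0 0)) -(compA e (addr0 0)).
by rewrite h comp1l.
Qed.

Lemma comp_zero_mid (D : dgCat G) (Y1 Y2 Y3 Y4 Y5 : D) i j k m n (e : i + m = n)
    (e1 : j + k = m) (g : hom Y4 Y5 i) (b : hom Y3 Y4 0) (t : hom Y3 Y3 j)
    (c : hom Y2 Y3 0) (f : hom Y1 Y2 k) :
  (forall (e2 : 0 + j = j) (e3 : j + 0 = j), comp e2 b (comp e3 t c) = 0) ->
  comp e (comp (addr0 i) g b) (comp e1 t (comp (add0r k) c f)) = 0.
Proof.
move=> h; rewrite (compA _ _ (add0r m) e) -(compA (addr0 j) e1).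
rewrite -(compA (add0r j) e1) h.
by rewrite (lin0 (comp_linl _ _)) (lin0 (comp_linr _ _)).
Qed.

Variable X : P.

Lemma sigma_dd (a : pidx X) i (e : pdeg a + io = i) (e1 : io + pdeg a = i) :
  dd e (sigma a) = comp e1 (ptwist X) (sigma a).
Proof.
rewrite /= /twhom_dd (lin0 (comp_linr _ _)) scaler0 subr0.
rewrite [X in X + _](_ : _ = 0) ?add0r.
  by rewrite (eq_irrelevance (deg_twl e) e1).
have h1 : 0 + io + pdeg a = i by rewrite add0r.
have h2 : 0 + i = i by rewrite add0r.
rewrite /sigma (dd_comp (add0r _) e erefl h1 e h2).
rewrite [X in comp _ X _](_ : _ = 0); last first.
  by apply: (@ahom_ext _ (dgS C)) => b c; exact: (@adelta_dd (dgS C) _ b a).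
rewrite (lin0 (comp_linl _ _)) add0r.
rewrite [X in comp _ _ X](_ : _ = 0) ?(lin0 (comp_linr _ _)) ?scaler0 //.
by apply: (@ahom_ext _ (dgS C)) => b c; exact: (@phi_dd (pterm a) (pdeg a)).
Qed.

Lemma proj_dd (a : pidx X) i (e : - pdeg a + io = i) :
  dd e (proj a) = - ((-1) ^+ pairing io (pdeg a) *: comp e (proj a) (ptwist X)).
Proof.
rewrite /= /twhom_dd (lin0 (comp_linl _ _)) addr0 pairingNr.
rewrite [X in X - _](_ : _ = 0) ?add0r //.
have h1 : i + 0 = i by rewrite addr0.
have h2 : - pdeg a + (0 + io) = i by rewrite add0r.
rewrite /proj (dd_comp (addr0 _) e e h1 erefl h2).
rewrite [X in _ + _ *: comp _ _ X](_ : _ = 0); last first.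
  by apply: (@ahom_ext _ (dgS C)) => b c; exact: (@adelta_dd (dgS C) _ a c).
rewrite (lin0 (comp_linr _ _)) scaler0 addr0.
rewrite [X in comp _ X _](_ : _ = 0) ?(lin0 (comp_linl _ _)) //.
by apply: (@ahom_ext _ (dgS C)) => b c; exact: (@phiV_dd (pterm a) (pdeg a)).
Qed.

Lemma amor_comp (D : dgCat G) (Y1 Y2 Y3 : D) i j k (e : i + j = k)
    (g : hom Y2 Y3 i) (f : hom Y1 Y2 j) :
  comp e (amor g) (amor f) = amor (comp e g f) :> hom (aone Y1) (aone Y3) k.
Proof.
apply: ahom_ext => -[] []; rewrite /= /acomp /amor.
by rewrite (big_pred1 tt) //; case.
Qed.

Lemma amor_id (D : dgCat G) (Y : D) : amor (idm Y) = idm (aone Y).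
Proof. by apply: ahom_ext => -[] []; rewrite /= /aid adeltaxx. Qed.

Lemma ains_aproj (D : dgCat G) (T : aobj D) (e : 0 + 0 = 0 :> Gam) :
  \sum_(a : aidx T) comp e (ains a) (aproj a) = idm (T : dgA D).
Proof.
apply: ahom_ext => b c; rewrite sumE /=.
rewrite -[RHS](congr1 (fun f => f b c) (acomp1l e (aid T))) /acomp.
apply: eq_bigr => a _; rewrite /= /acomp (big_pred1 tt) //; by case.
Qed.

Lemma aproj_entry (D : dgCat G) (T T' : aobj D) (a : aidx T) i (e : 0 + i = i)
    (f : hom (T' : dgA D) (T : dgA D) i) :
  comp e (aproj a) f = (fun _ c => f a c).
Proof.
apply: ahom_ext => -[] c; rewrite -[in RHS](acomp1l e f) /=.
by rewrite /acomp; apply: eq_bigr.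
Qed.

Lemma ains_entry (D : dgCat G) (T T' : aobj D) (a : aidx T) i (e : i + 0 = i)
    (f : hom (T : dgA D) (T' : dgA D) i) :
  comp e f (ains a) = (fun c _ => f c a).
Proof.
apply: ahom_ext => c []; rewrite -[in RHS](acomp1r e f) /=.
by rewrite /acomp; apply: eq_bigr.
Qed.

Lemma sigma_proj (a : pidx X) (e : pdeg a - pdeg a = 0) :
  comp e (sigma a) (proj a) =
  @comp _ (dgA (dgS C)) (tbase (sval X)) (aone (abase a)) (tbase (sval X)) _ _ _
    (addr0 0) (ains a) (aproj a).
Proof.
have := @comp_cancel_mid (dgA (dgS C)) (tbase (sval X))
  (aone (SObj 0 (pterm a) : dgS C)) (aone (abase a)) (tbase (sval X)) _ _ e
  (ains a) (amor (phi (pterm a) (pdeg a))) (amor (phiV (pterm a) (pdeg a))) (aproj a).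
apply.
have h : @comp _ (dgS C) (abase a) (SObj 0 (pterm a)) (abase a) _ _ _ e
    (phi (pterm a) (pdeg a)) (phiV (pterm a) (pdeg a)) = idm (abase a : dgS C).
  exact: phiK.
by rewrite (@amor_comp (dgS C)) h (@amor_id (dgS C)).
Qed.

Lemma sum_sigma_proj (e : forall a : pidx X, pdeg a - pdeg a = 0) :
  \sum_a comp (e a) (sigma a) (proj a) = idm X.
Proof.
under eq_bigr => a _ do rewrite sigma_proj.
exact: (ains_aproj (tbase (sval X)) (addr0 0)).
Qed.

Lemma proj_twist_sigma (a b : pidx X) i j (e : - pdeg a + i = j)
    (e1 : io + pdeg b = i) : twist (sval X) a b = 0 ->
  comp e (proj a) (comp e1 (ptwist X) (sigma b)) = 0.
Proof.
move=> h.
have := @comp_zero_mid (dgA (dgS C)) (aone (SObj 0 (pterm b) : dgS C)) (aone (abase b))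
  (tbase (sval X)) (aone (abase a)) (aone (SObj 0 (pterm a) : dgS C)) _ _ _ _ _ e e1
  (amor (phiV (pterm a) (pdeg a))) (aproj a) (ptwist X) (ains b)
  (amor (phi (pterm b) (pdeg b))).
apply.
by move=> h2' h3'; rewrite aproj_entry ains_entry; apply: ahom_ext.
Qed.

End Summands.

Section PretrEnvelope.
Variables (G : ground) (C : dgCat G).
Local Notation Gam := (gdeg G).
Local Notation P := (pretr C).

(** In the differential of Pretr(C) the two products with the twist add to the
differential of A(S(C)), which is minus the square of the twist. *)
Lemma twist_dd (X : P) i (e : io + io = i) :
  dd e (ptwist X) = comp e (ptwist X) (ptwist X).
Proof.
have /eqP := twistP (sval X); rewrite addr_eq0 => /eqP h.
case: _ / e; set t := twist (sval X) in h.
change (dd erefl t + comp (deg_twl erefl) t t -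
  (-1) ^+ @pairing G io io *: comp erefl t t = comp erefl t t).
by rewrite h pairing_io sgr1 opprK (eq_irrelevance (deg_twl _) erefl) addNr add0r.
Qed.

(** The height of a is the number of elements strictly below a for the given order; as
a is not counted, it is less than the cardinality. *)
Lemma twist_height (X : P) : exists h : pidx X -> nat,
  (forall a, h a < #|pidx X|)%N /\
  forall a b : pidx X, ~~ (h b < h a)%N -> twist (sval X) a b = 0.
Proof.
have [le [refl anti trans tri]] := proj2_sig X.
exists (fun a => #|[pred c | le c a && (c != a)]|); split=> [a|a b].
  apply/proper_card/properP; split; first exact: subset_predT.
  by exists a; rewrite // inE refl eqxx.
move=> hab; apply: tri; apply: contra hab => /andP[hle hne].
apply/proper_card/properP; split; last first.
  by exists b; rewrite inE ?eqxx ?andbF // hle eq_sym hne.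
apply/fintype.subsetP => c; rewrite !inE => /andP[hcb ne].
rewrite (trans _ _ _ hcb hle) /=; apply: contraNneq ne => hca; subst c.
by apply/eqP; apply: anti; rewrite hcb hle.
Qed.

Lemma phi0 (Y : C) : phi Y 0 = idm (SObj 0 Y : dgS C).
Proof. by rewrite /phi /= /sid; congr gcast; apply: eq_irrelevance. Qed.

Lemma phiV0 (Y : C) :
  phiV Y 0 = gcast (esym (oppr0 _)) (idm (SObj 0 Y : dgS C)).
Proof.
rewrite /phiV /= /sid.
have h l (e : 0 = l) (e1 : 0 = 0 + 0 - 0) (e2 : 0 = l + 0 - 0) :
    gcast e2 (idm Y) = gcast e (gcast e1 (idm Y) : @shom G C (SObj 0 Y) (SObj 0 Y) 0).
  by case: _ / e e2 => e2; congr gcast; apply: eq_irrelevance.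
exact: h.
Qed.

Lemma amor_gcast (D : dgCat G) (Y Y' : D) i j (e : i = j) (f : hom Y Y' i) :
  amor (gcast e f) = gcast e (amor f : hom (aone Y) (aone Y') i).
Proof. by case: _ / e. Qed.

Lemma ains_one (D : dgCat G) (Y : D) : ains (tt : aidx (aone Y)) = idm (aone Y).
Proof. by apply: ahom_ext => b []. Qed.

Lemma aproj_one (D : dgCat G) (Y : D) : aproj (tt : aidx (aone Y)) = idm (aone Y).
Proof. by apply: ahom_ext => [[]] b. Qed.

Lemma sigma_emb (Y : C) : sigma (tt : pidx (emb_obj Y)) = idm (emb_obj Y).
Proof.
rewrite /sigma (@ains_one (dgS C) (SObj 0 Y)) phi0 (@amor_id _ (dgS C)).
exact: comp1l.
Qed.

Lemma proj_emb (Y : C) : proj (tt : pidx (emb_obj Y)) =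
  gcast (esym (oppr0 _)) (idm (emb_obj Y)).
Proof.
rewrite /proj (@aproj_one (dgS C) (SObj 0 Y)) phiV0 (@amor_gcast (dgS C)) (@amor_id _
  (dgS C)).
apply: comp1r.
Qed.

(** Transparent, because the comparison with the theorem is by computation. *)
Definition pretr_envelope : envelope (emb C).
Proof.
refine (@Envelope G C P (emb C) (@unemb_hom G C) _ _ (fun X : P => fidx_finType (pidx X))
  (@pdeg G C) (@pterm G C) (@sigma G C) (@proj G C) (@ptwist G C) _ _ _ _ _ _ _).
- exact: unemb_homK.
- exact: emb_homK.
- exact: twist_dd.
- exact: sigma_dd.
- exact: proj_dd.
- exact: sum_sigma_proj.
- move=> X; have [h [h1 h2]] := twist_height X; exists h; split=> // a b hab n m e e1.
  by apply: proj_twist_sigma; apply: h2.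
- by [].
- move=> Y V phi; rewrite (big_pred1 (tt : pidx (emb_obj Y))); last by case.
  exact: f_equal2 (sigma_emb Y) (proj_emb Y).
Defined.

End PretrEnvelope.

(** * The theorem *)

Section Compare.
Variables (G : ground) (C : dgCat G).
Local Notation P := (pretr C).
Local Notation env := (pretr_envelope C).

(** Both sides agree by computation, with the degree equations chosen as in the
theorem. *)
Lemma xtermE (X Z : P) (c : chain X Z) l (e : 0 + cdeg c 0 = l + io *+ clen c)
   (w : xidx c) :
  xterm e w = @gterm _ _ _ _ env _ _ c w _ _ _ erefl (deg_xbar w) (deg_xterm w e).
Proof. by []. Qed.

End Compare.

Theorem lemma5p27 (G : ground) (C : dgCat G) :
  exists Xi : bimHom (bar (pretr C)) (pbarp C) 0,
    [/\ bim_closed Xi,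
        forall (X Z : pretr C) (c : chain X Z) (l : gdeg G)
          (e : 0 + cdeg c 0 = l + io *+ clen c),
          bh Xi (add0r l) (bar_elt (idm X) c (idm Z) e) =
          \sum_(w \in [set: xidx c]%classic) (-1) ^+ xsgn w *: xterm e w
      & bim_homotopy_equivalence Xi].
Proof.
exists (Xi_map (pretr_envelope C)); split; [exact: Xi_map_closed| |exact:
  Xi_map_equivalence].
move=> X Z c l e; apply: etrans (Xi_map_elt_fsum (pretr_envelope C) e) _.
apply: eq_fsbigr => w _; rewrite xtermE.
by congr (_ *: _); apply: gterm_irr.
Qed.
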